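(* Let $n\geq 3$, let $\mathbb{B}^n_\rho\subset\mathbb{R}^n$ be the ball of radius $\rho$ centered at the origin, and for $0<\epsilon<1$ and $k=1,2,3,\ldots$ let $\sigma_k(\mathbb{B}^n_1\setminus\mathbb{B}^n_\epsilon)$ denote the $k$-th distinct nonzero Steklov eigenvalue of $\mathbb{B}^n_1\setminus\mathbb{B}^n_\epsilon$. Then for each $k\geq 1$, for $\epsilon$ sufficiently small, $$\sigma_k(\mathbb{B}^n_1\setminus\mathbb{B}^n_\epsilon)=k-\frac{k(2k+n-2)}{k+n-2}\,\epsilon^{2k+n-2}+O(\epsilon^{2k+n-1})\qquad(\epsilon\to 0).$$ In particular, for $\epsilon$ sufficiently small the first nonzero Steklov eigenvalue is $$\sigma_1(\mathbb{B}^n_1\setminus\mathbb{B}^n_\epsilon)=1-\frac{n}{n-1}\,\epsilon^{n}+O(\epsilon^{n+1}),$$ and, for each $k\geq 1$ and all sufficiently small $\epsilon>0$, $$\sigma_k(\mathbb{B}^n_1)\,|\partial\mathbb{B}^n_1|^{\frac{1}{n-1}}<\sigma_k(\mathbb{B}^n_1\setminus\mathbb{B}^n_\epsilon)\,|\partial(\mathbb{B}^n_1\setminus\mathbb{B}^n_\epsilon)|^{\frac{1}{n-1}},$$ where $\sigma_k(\mathbb{B}^n_1)$ is the $k$-th distinct nonzero Steklov eigenvalue of $\mathbb{B}^n_1$.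
   Context: The Steklov eigenvalues of a bounded domain $\Omega\subset\mathbb{R}^n$ are the numbers $\sigma$ for which there is a nonzero $u$ with $\Delta u=0$ in $\Omega$ and $\partial u/\partial\nu=\sigma u$ on $\partial\Omega$, where $\nu$ is the outward unit normal (equivalently, the eigenvalues of the Dirichlet-to-Neumann map). They form a discrete sequence $0<\cdots\to\infty$ together with $0$; ''$k$-th distinct nonzero'' means that the positive eigenvalues are listed in strictly increasing order without multiplicity, indexed from $k=1$. $|\partial\Omega|$ denotes the $(n-1)$-dimensional volume of $\partial\Omega$. The constants in the $O(\cdot)$ terms, and the threshold for $\epsilon$, may depend on $n$ and $k$. *)

(* Defs.v *)
From HB Require Import structures.
From mathcomp Require Import all_boot all_order all_algebra.
From mathcomp Require Import all_classical all_reals all_analysis.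

Set Implicit Arguments.
Unset Strict Implicit.
Unset Printing Implicit Defensive.

Import Order.TTheory GRing.Theory Num.Theory.
Import numFieldNormedType.Exports.

Local Open Scope classical_set_scope.
Local Open Scope ring_scope.

(* The library norm on 'rV[R]_n is the sup norm, hence the explicit Euclidean
   structure below; topology, differentiability and derivatives do not depend
   on the choice of norm and are the library's. *)
Definition dotv (R : realType) (n : nat) (x y : 'rV[R]_n) : R :=
  \sum_(i < n) x 0 i * y 0 i.

Definition enorm (R : realType) (n : nat) (x : 'rV[R]_n) : R :=
  Num.sqrt (dotv x x).

Definition eball (R : realType) (n : nat) (r : R) : set 'rV[R]_n :=
  [set x | enorm x < r].

(* The open set eps < |x| < 1: the domain B_1 \ B_eps, with the closed inner
   ball removed. *)
Definition shell (R : realType) (n : nat) (eps : R) : set 'rV[R]_n :=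
  @eball R n 1 `\` [set x | enorm x <= eps].

Definition boundary (T : topologicalType) (A : set T) : set T :=
  closure A `\` interior A.

Section differential_operators.
Context (R : realType) (n : nat).
Implicit Types (U : set 'rV[R]_n) (f : 'rV[R]_n -> R).

Definition partial (i : 'I_n) f (x : 'rV[R]_n) : R := 'D_(delta_mx 0 i) f x.

Definition grad f (x : 'rV[R]_n) : 'rV[R]_n := \row_(i < n) partial i f x.

Definition laplacian f (x : 'rV[R]_n) : R :=
  \sum_(i < n) partial i (partial i f) x.

(* Meant for open U. *)
Definition C1_on U f : Prop :=
  forall x, U x -> differentiable f x /\ {for x, continuous (grad f)}.

Definition C2_on U f : Prop :=
  C1_on U f /\ forall i, C1_on U (partial i f).

End differential_operators.

(* nu is the outward unit normal of Om at x: near x, Om is {phi < 0} for a C^1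
   function phi vanishing at x with nonzero gradient there, and nu is the
   normalized gradient of phi at x. *)
Definition outward_unit_normal (R : realType) (n : nat) (Om : set 'rV[R]_n)
    (x nu : 'rV[R]_n) : Prop :=
  exists (U : set 'rV[R]_n) (phi : 'rV[R]_n -> R),
    [/\ open U /\ U x, C1_on U phi,
        (forall y, U y -> (Om y <-> phi y < 0)),
        phi x = 0 /\ grad phi x != 0
      & nu = (enorm (grad phi x))^-1 *: grad phi x].

(* Classical solutions, of class C^2 in Om and C^1 up to the boundary: G is the
   continuous extension of grad u to the closure of Om, so that dotv (G x) nu
   is the normal derivative of u at a boundary point x. *)
Definition steklov_eigenfunction (R : realType) (n : nat) (Om : set 'rV[R]_n)
    (sigma : R) (u : 'rV[R]_n -> R) : Prop :=
  [/\ C2_on Om u, {within closure Om, continuous u},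
      (exists2 x, Om x & u x != 0),
      (forall x, Om x -> laplacian u x = 0)
    & exists G : 'rV[R]_n -> 'rV[R]_n,
        [/\ {within closure Om, continuous G},
            (forall x, Om x -> G x = grad u x)
          & forall x, boundary Om x ->
              exists2 nu, outward_unit_normal Om x nu
                        & dotv (G x) nu = sigma * u x]].

Definition steklov_eigenvalue (R : realType) (n : nat) (Om : set 'rV[R]_n)
    (sigma : R) : Prop :=
  exists u, steklov_eigenfunction Om sigma u.

(* sigma is a positive eigenvalue, and exactly k positive eigenvalues (counted
   without multiplicity) are at most sigma. *)
Definition is_kth_steklov (R : realType) (n : nat) (Om : set 'rV[R]_n)
    (k : nat) (sigma : R) : Prop :=
  [/\ 0 < sigma, steklov_eigenvalue Om sigma
    & ([set t | steklov_eigenvalue Om t /\ 0 < t <= sigma] #= `I_k)%card].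

(* The k-th distinct nonzero eigenvalue, for 0 < k; it is unique if it exists,
   and the value is 0 by convention if it does not. *)
Definition steklov (R : realType) (n : nat) (k : nat) (Om : set 'rV[R]_n) : R :=
  xget 0 [set s | is_kth_steklov Om k s].

(* Volume of the unit ball of R^m. *)
Fixpoint unit_ball_volume (R : realType) (m : nat) : R :=
  match m with
  | 0 => 1
  | 1 => 2
  | (m'.+2)%N => 2 * pi / (m'.+2)%:R * unit_ball_volume R m'
  end.

Section hausdorff_measure.
Context (R : realType) (n : nat).
Implicit Types (A : set 'rV[R]_n) (m : nat).
Local Open Scope ereal_scope.

Definition ediam A : \bar R :=
  ereal_sup [set (enorm (p.1 - p.2)%R)%:E | p in A `*` A].

(* The volume of an m-dimensional ball with the diameter of A. *)
Definition hausdorff_gauge m A : \bar R :=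
  if `[< A !=set0 >] then (unit_ball_volume R m / 2 ^+ m)%:E * ediam A ^+ m
  else 0.

Definition hausdorff_content m (delta : R) A : \bar R :=
  ereal_inf [set \sum_(i <oo) hausdorff_gauge m (F i) |
    F in [set F : nat -> set 'rV[R]_n |
            A `<=` \bigcup_i F i /\ forall i, ediam (F i) <= delta%:E]].

(* m-dimensional Hausdorff measure for the Euclidean metric, normalized so as
   to be the m-dimensional volume. *)
Definition hausdorff_measure m A : \bar R :=
  ereal_sup [set hausdorff_content m delta A | delta in [set d : R | (0 < d)%R]].

End hausdorff_measure.

(* |boundary of Om|, the (n-1)-dimensional volume. *)
Definition boundary_volume (R : realType) (n : nat) (Om : set 'rV[R]_n) :
    \bar R :=
  hausdorff_measure n.-1 (boundary Om).

(* Main.v *)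
From HB Require Import structures.
Require Import Defs.
From mathcomp Require Import all_boot all_order all_algebra finmap.
From mathcomp Require Import all_classical all_reals all_analysis.
From mathcomp Require Import ring lra zify.
Import Order.TTheory GRing.Theory Num.Theory.
Import numFieldNormedType.Exports.
Local Open Scope classical_set_scope.
Local Open Scope ring_scope.
Set Implicit Arguments.
Unset Strict Implicit.
Unset Printing Implicit Defensive.

(* Separation of variables: a spherical harmonic of degree d times
   al + be |x|^-(n+2d-2) is a Steklov eigenfunction of the shell for sigma iff
   sigma is a root of a quadratic [steklov_poly e d]. For small e its roots up
   to k are one root close to each d = 1, ..., k, and expanding at sigma = d
   gives the asymptotics.

   That there is no other eigenvalue is proved without spherical harmonics.
   For a unit vector c the zonal function (c.x)^d has Laplacian proportional to
   (c.x)^(d-2), so by induction on d an eigenfunction u sees it as harmonic.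
   If sigma is not a root for d, Green's formula against the two radial
   multiples of (c.x)^d that satisfy the boundary condition on one of the two
   spheres makes u orthogonal to (c.x)^d on every sphere; the powers of
   1 + c.x/|x| then peak at c and force u = 0. The same argument with the
   origin in place of the inner sphere treats the ball. Integrals are replaced
   by lattice sums, for which integration by parts is a change of index.

   The surface measure of the shell boundary is at least (1 + e^(n-1)) times
   that of the unit sphere, and this gain beats the loss of order e^n in
   sigma_k. *)

(** * Partial derivatives *)

(** An eigenfunction is [C^2] only in the open domain, and its gradient merely extends continuously
    to the closure, so Green's formula cannot be applied up to the boundary. It is tested instead
    against radial cutoffs supported in the open shell. The weighted flux then depends only on the
    mass of the radial weight, and pushing this mass towards a sphere where a boundary condition
    holds (or towards the origin) shows that the flux is zero. Eliminating the radial derivative of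
    [u] between two such fluxes leaves [u] times the zonal function, multiplied by the determinant
    of the two conditions, which is [steklov_poly] up to sign. Lattice sums suffice because
    integrals enter only through their vanishing in the limit, through linearity and through
    monotonicity. Eigenvalues are counted without multiplicity, so one harmonic per degree proves
    existence: the real part of a complex power. For the strict comparison of volumes, the measure
    of the unit sphere must be shown finite and positive, since it is divided out of both sides. *)

Lemma differentiable_near {R : numFieldType} {V W : normedModType R} (f g : V -> W)
  (x : V) : {near x, f =1 g} ->
  differentiable f x -> differentiable g x.
Proof.
move=> fg df; pose h y := g y - f y.
have -> : g = f + h by apply/funext => y; rewrite /h !fctE addrC subrK.
apply: differentiableD => //.
have hx : h x = 0 by rewrite /h (nbhs_singleton fg) subrr.
have H : h \o shift x = cst (h x) + (\0 : V -> W) +o_ 0 id.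
  apply/eqaddoP => _/posnumP[e].
  have : \forall y \near (0 : V), f (y + x) = g (y + x).
    have fg' : \forall y \near x, f y = g y by [].
    move: fg'; rewrite (near_shift 0 x); apply: filterS => y /=.
    by rewrite subr0.
  apply: filterS => y /= fgy.
  by rewrite !fctE /= hx addr0 /h fgy subrr sub0r oppr0 normr0 mulr_ge0.
have dh : 'd h x = (\0 : V -> W) :> (V -> W).
  by apply: diff_unique => //; exact: cst_continuous.
apply/diff_locallyP; rewrite dh; split => //.
exact: cst_continuous.
Qed.

Section partial_calculus.
Context {R : realType} {n : nat}.
Implicit Types (f g : 'rV[R]_n -> R) (x y : 'rV[R]_n) (U : set 'rV[R]_n).

Lemma continuous_rV (T : topologicalType) (F : T -> 'rV[R]_n) (x0 : T) :
  (forall i, {for x0, continuous (fun t => F t 0 i)}) -> {for x0, continuous F}.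
Proof.
move=> h; rewrite /prop_for /continuous_at.
apply/cvgrPdist_le => /= e e0.
near=> t.
rewrite /Num.Def.normr/= mx_normrE (bigmax_le _ (ltW e0))//= => -[i j] _.
rewrite !mxE/= (ord1 i).
move: j {i}; near: t; apply: filter_forall => /= j.
by have /cvgrPdist_le := h j; apply.
Unshelve. all: by end_near. Qed.

Lemma continuous_gradP f x :
  {for x, continuous (grad f)} <-> forall i, {for x, continuous (partial i f)}.
Proof.
split=> [h i|h].
  have -> : partial i f = (fun M : 'rV[R]_n => M 0 i) \o grad f.
    by apply/funext => y /=; rewrite mxE.
  by apply: continuous_comp => //; exact: coord_continuous.
apply: continuous_rV => i.
by rewrite (_ : (fun t => _) = partial i f)//; apply/funext => y; rewrite mxE.
Qed.

Lemma partial_near f g x i : {near x, f =1 g} -> partial i f x = partial i g x.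
Proof. by move=> h; apply: near_eq_derive. Qed.

Lemma partialD f g x i : differentiable f x -> differentiable g x ->
  partial i (fun y => f y + g y) x = partial i f x + partial i g x.
Proof.
move=> df dg; rewrite /partial.
by have := deriveD (@diff_derivable _ _ _ _ _ (delta_mx 0 i) df) (@diff_derivable _ _ _ _ _ (delta_mx 0 i) dg).
Qed.

Lemma partialM f g x i : differentiable f x -> differentiable g x ->
  partial i (fun y => f y * g y) x = partial i f x * g x + f x * partial i g x.
Proof.
move=> df dg; rewrite /partial.
have := deriveM (@diff_derivable _ _ _ _ _ (delta_mx 0 i) df) (@diff_derivable _ _ _ _ _ (delta_mx 0 i) dg).
by move=> /= ->; rewrite /GRing.scale /= addrC mulrC.
Qed.

Lemma partial_cst (c : R) x i : partial i (fun=> c) x = 0.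
Proof. exact: derive_cst. Qed.

Lemma partialZ (c : R) f x i : differentiable f x ->
  partial i (fun y => c * f y) x = c * partial i f x.
Proof.
by move=> df; rewrite /partial [LHS]deriveZ//; exact: diff_derivable.
Qed.

Lemma partial_comp (h : R -> R) f x i : differentiable f x ->
  derivable h (f x) 1 ->
  partial i (fun y => h (f y)) x = h^`()%classic (f x) * partial i f x.
Proof.
move=> df dh.
have dh' := (derivable1_diffP h (f x)).1 dh.
rewrite /partial !deriveE//; last exact: (@differentiable_comp _ _ _ _ f h x df dh').
by rewrite [LHS](congr1 (fun F => F _) (diff_comp df dh')) /= deriv1E// mulrC.
Qed.

Lemma partial_coord x i j : partial i (fun y => y 0 j) x = (i == j)%:R.
Proof.
rewrite /partial deriveE; last exact: differentiable_coord.
have lin : linear (fun y : 'rV[R]_n => y 0 j : R).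
  by move=> a b c; rewrite !mxE.
pose L := GRing.isLinear.Build _ _ _ _ _ lin.
pose F : {linear 'rV[R]_n -> R} := HB.pack (fun y : 'rV[R]_n => y 0 j) L.
rewrite (congr1 (fun F => F _) (@diff_lin _ _ _ F x _)) /=; last first.
  exact: coord_continuous.
by rewrite !mxE eqxx /= eq_sym.
Qed.

Lemma D_partial f x v : differentiable f x ->
  'D_v f x = \sum_i v 0 i * partial i f x.
Proof.
move=> df; rewrite deriveE// {1}(row_sum_delta v) linear_sum.
by apply: eq_bigr => i _; rewrite linearZ /partial deriveE.
Qed.

Lemma continuous_near (V : topologicalType) (F G : 'rV[R]_n -> V) x :
  {near x, F =1 G} -> {for x, continuous F} -> {for x, continuous G}.
Proof.
move=> FG cF; rewrite /prop_for /continuous_at -(nbhs_singleton FG).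
by move=> A /cF; apply: filterS2 FG => y /= ->.
Qed.

Lemma partial_sumr (I : finType) (F : I -> 'rV[R]_n -> R) x i :
  (forall i, differentiable (F i) x) ->
  partial i (fun y => \sum_j F j y) x = \sum_j partial i (F j) x.
Proof.
move=> dF; suff H : forall s : seq I,
    differentiable (fun y => \sum_(j <- s) F j y) x /\
    partial i (fun y => \sum_(j <- s) F j y) x = \sum_(j <- s) partial i (F j) x.
  exact: (H (index_enum I)).2.
elim=> [|j s [d p]].
  under eq_fun do rewrite big_nil.
  by rewrite big_nil partial_cst; split => //; exact: differentiable_cst.
under eq_fun do rewrite big_cons.
by rewrite big_cons partialD// p; split => //; exact: (@differentiableD _ _ _ _ _).
Qed.

Lemma C1_onP U f : C1_on U f <-> forall x, U x ->
  differentiable f x /\ forall i, {for x, continuous (partial i f)}.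
Proof.
by split=> h x /h[d c]; (split; first exact: d); apply/continuous_gradP.
Qed.

Lemma near_open U f g x : open U -> U x -> (forall y, U y -> f y = g y) ->
  {near x, f =1 g}.
Proof. by move=> oU Ux fg; near=> y; apply: fg; near: y; exact: open_nbhs_nbhs.
Unshelve. all: by end_near. Qed.

Lemma eq_partial U f g x i : open U -> (forall y, U y -> f y = g y) -> U x ->
  partial i f x = partial i g x.
Proof. by move=> oU fg Ux; exact/partial_near/(near_open oU Ux). Qed.

Lemma C1_on_eq U f g : open U -> (forall x, U x -> f x = g x) ->
  C1_on U f -> C1_on U g.
Proof.
move=> oU fg /C1_onP Hf; apply/C1_onP => x Ux; have [df cf] := Hf x Ux.
split=> [|i]; first exact/(differentiable_near _ df)/(near_open oU Ux).
apply: continuous_near (cf i); apply: (near_open oU Ux) => y Uy.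
exact: (eq_partial _ oU).
Qed.

Lemma C1_on_sub U (V : set 'rV[R]_n) f : V `<=` U -> C1_on U f -> C1_on V f.
Proof. by move=> VU h x /VU /h. Qed.

Lemma C2_on_sub U (V : set 'rV[R]_n) f : V `<=` U -> C2_on U f -> C2_on V f.
Proof.
move=> VU [h1 h2]; split => [|i]; first exact: C1_on_sub h1.
exact: C1_on_sub (h2 i).
Qed.

Lemma C1_on_cst U (c : R) : C1_on U (fun=> c).
Proof.
apply/C1_onP => x _; split => [|i]; first exact: differentiable_cst.
rewrite (_ : partial i _ = cst 0); first exact: cst_continuous.
by apply/funext => y; exact: partial_cst.
Qed.

Lemma C1_on_coord U j : C1_on U (fun x => x 0 j).
Proof.
apply/C1_onP => x _; split => [|i]; first exact: differentiable_coord.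
rewrite (_ : partial i _ = cst (i == j)%:R); first exact: cst_continuous.
by apply/funext => y; exact: partial_coord.
Qed.

Lemma C1_onD U f g : open U -> C1_on U f -> C1_on U g ->
  C1_on U (fun x => f x + g x).
Proof.
move=> oU /C1_onP Hf /C1_onP Hg; apply/C1_onP => x Ux.
have [df cf] := Hf x Ux; have [dg cg] := Hg x Ux.
split=> [|i]; first exact: (@differentiableD _ _ _ f g x df dg).
apply: (@continuous_near _ (fun y => partial i f y + partial i g y)).
  apply: (near_open oU Ux) => y Uy; rewrite (partialD _ (Hf y Uy).1 (Hg y Uy).1).
  by [].
have cfi := cf i; have cgi := cg i.
exact: (@continuousD _ _ _ (partial i f) (partial i g) x cfi cgi).
Qed.

Lemma C1_onM U f g : open U -> C1_on U f -> C1_on U g ->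
  C1_on U (fun x => f x * g x).
Proof.
move=> oU /C1_onP Hf /C1_onP Hg; apply/C1_onP => x Ux.
have [df cf] := Hf x Ux; have [dg cg] := Hg x Ux.
split=> [|i]; first exact: (@differentiableM _ _ f g x df dg).
apply: (@continuous_near _ (fun y => partial i f y * g y + f y * partial i g y)).
  apply: (near_open oU Ux) => y Uy; rewrite (partialM _ (Hf y Uy).1 (Hg y Uy).1).
  by [].
have cfi := cf i; have cgi := cg i.
have cf0 := differentiable_continuous df.
have cg0 := differentiable_continuous dg.
have c1 := @continuousM _ _ (partial i f) g x cfi cg0.
have c2 := @continuousM _ _ f (partial i g) x cf0 cgi.
exact: (@continuousD _ _ _ _ _ x c1 c2).
Qed.

Lemma C1_on_comp U f (h : R -> R) : open U -> C1_on U f ->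
  (forall x, U x -> derivable h (f x) 1 /\ {for f x, continuous h^`()%classic}) ->
  C1_on U (fun x => h (f x)).
Proof.
move=> oU /C1_onP Hf Hh; apply/C1_onP => x Ux.
have [df cf] := Hf x Ux; have [dh ch] := Hh x Ux.
split=> [|i].
  have dh' := (derivable1_diffP h (f x)).1 dh.
  exact: (@differentiable_comp _ _ _ _ f h x df dh').
apply: (@continuous_near _ (fun y => h^`()%classic (f y) * partial i f y)).
  apply: (near_open oU Ux) => y Uy.
  by rewrite (partial_comp _ (Hf y Uy).1 (Hh y Uy).1).
have cfi := cf i.
have cf0 := differentiable_continuous df.
have cdh := @continuous_comp _ _ _ f (h^`()%classic) x cf0 ch.
exact: (@continuousM _ _ (h^`()%classic \o f) (partial i f) x cdh cfi).
Qed.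

Lemma C2_on_cst U (c : R) : C2_on U (fun=> c).
Proof.
split; first exact: C1_on_cst.
move=> i; rewrite (_ : partial i _ = cst 0); first exact: C1_on_cst.
by apply/funext => y; exact: partial_cst.
Qed.

Lemma C2_on_coord U j : C2_on U (fun x => x 0 j).
Proof.
split; first exact: C1_on_coord.
move=> i; rewrite (_ : partial i _ = cst (i == j)%:R); first exact: C1_on_cst.
by apply/funext => y; exact: partial_coord.
Qed.

Lemma C2_onD U f g : open U -> C2_on U f -> C2_on U g ->
  C2_on U (fun x => f x + g x).
Proof.
move=> oU [f1 f2] [g1 g2]; split; first exact: (C1_onD oU f1 g1).
move=> i; apply: (@C1_on_eq U (fun y => partial i f y + partial i g y) _ oU).
  by move=> x Ux; rewrite (partialD _ (f1 x Ux).1 (g1 x Ux).1).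
exact: (C1_onD oU (f2 i) (g2 i)).
Qed.

Lemma C2_onM U f g : open U -> C2_on U f -> C2_on U g ->
  C2_on U (fun x => f x * g x).
Proof.
move=> oU [f1 f2] [g1 g2]; split; first exact: (C1_onM oU f1 g1).
move=> i.
apply: (@C1_on_eq U (fun y => partial i f y * g y + f y * partial i g y) _ oU).
  by move=> x Ux; rewrite (partialM _ (f1 x Ux).1 (g1 x Ux).1).
exact: (C1_onD oU (C1_onM oU (f2 i) g1) (C1_onM oU f1 (g2 i))).
Qed.

Lemma C2_onX U f k : open U -> C2_on U f -> C2_on U (fun x => f x ^+ k).
Proof.
move=> oU Hf; elim: k => [|k IH]; first exact: C2_on_cst.
under eq_fun do rewrite exprS; exact: (C2_onM oU Hf IH).
Qed.

Lemma C2_on_sum U (I : finType) (F : I -> 'rV[R]_n -> R) : open U ->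
  (forall i, C2_on U (F i)) -> C2_on U (fun x => \sum_i F i x).
Proof.
move=> oU HF; elim: (index_enum I) => [|i s IH].
  under eq_fun do rewrite big_nil; exact: C2_on_cst.
under eq_fun do rewrite big_cons; exact: (C2_onD oU (HF i) IH).
Qed.

End partial_calculus.

(** * Calculus of the Euclidean norm *)

Section enorm_calculus.
Context {R : realType} {n : nat}.
Implicit Types (x y : 'rV[R]_n) (U : set 'rV[R]_n).

Lemma dotvC x y : dotv x y = dotv y x.
Proof. by apply: eq_bigr => i _; rewrite mulrC. Qed.

Lemma dotv_ge0 x : 0 <= dotv x x.
Proof. by apply: sumr_ge0 => i _; rewrite -expr2 sqr_ge0. Qed.

Lemma enorm_ge0 x : 0 <= enorm x. Proof. exact: sqrtr_ge0. Qed.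

Lemma sqr_enorm x : enorm x ^+ 2 = dotv x x.
Proof. by rewrite sqr_sqrtr// dotv_ge0. Qed.

Lemma C2_on_dotv U : open U -> C2_on U (fun x => dotv x x).
Proof.
move=> oU; apply: (C2_on_sum oU) => i.
exact: (C2_onM oU (C2_on_coord U i) (C2_on_coord U i)).
Qed.

Lemma partial_dotv x i : partial i (fun y => dotv y y) x = 2 * x 0 i.
Proof.
rewrite partial_sumr => [|j]; last first.
  by apply: differentiableM; exact: differentiable_coord.
rewrite (bigD1 i)//= big1 ?addr0 => [|j ji]; last first.
  rewrite partialM ?partial_coord; [|exact: differentiable_coord..].
  by rewrite eq_sym (negPf ji) mul0r mulr0 addr0.
rewrite partialM ?partial_coord; [|exact: differentiable_coord..].
by rewrite eqxx mulr1 mul1r -mulr2n mulr_natl.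
Qed.

Lemma differentiable_dotv x : differentiable (fun y : 'rV[R]_n => dotv y y) x.
Proof. by have [/(_ x I)[]] := C2_on_dotv openT. Qed.

Lemma enorm_continuous : continuous (@enorm R n).
Proof.
move=> x; apply: (@continuous_comp _ _ _ (fun y => dotv y y) Num.sqrt).
  exact: differentiable_continuous (differentiable_dotv x).
exact: sqrt_continuous.
Qed.

Lemma derivable_sqrt (s : R) : 0 < s -> derivable Num.sqrt s 1.
Proof. by move=> /is_derive1_sqrt[]. Qed.

Lemma derive1_sqrt (s : R) : 0 < s ->
  (Num.sqrt : R -> R)^`()%classic s = (2 * Num.sqrt s)^-1.
Proof. by move=> /is_derive1_sqrt h; rewrite derive1E derive_val. Qed.

Lemma dotv_gt0 x : (0 < dotv x x) = (0 < enorm x).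
Proof. by rewrite sqrtr_gt0. Qed.

Lemma differentiable_enorm x : 0 < enorm x -> differentiable (@enorm R n) x.
Proof.
move=> x0; apply: (@differentiable_comp _ _ _ _ (fun y => dotv y y) Num.sqrt).
  exact: differentiable_dotv.
by apply/derivable1_diffP/derivable_sqrt; rewrite dotv_gt0.
Qed.

Lemma partial_enorm x i : 0 < enorm x ->
  partial i (@enorm R n) x = x 0 i / enorm x.
Proof.
move=> x0; rewrite (@partial_comp _ _ Num.sqrt (fun y => dotv y y)).
- rewrite partial_dotv derive1_sqrt ?dotv_gt0// -/(enorm x).
  by field; rewrite gt_eqF.
- exact: differentiable_dotv.
- by apply/derivable_sqrt; rewrite dotv_gt0.
Qed.

Lemma C1_on_enorm U : open U -> (forall x, U x -> 0 < enorm x) ->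
  C1_on U (@enorm R n).
Proof.
move=> oU U0; apply/C1_onP => x Ux; split=> [|i].
  exact/differentiable_enorm/U0.
apply: (@continuous_near _ _ _ (fun y => y 0 i / enorm y)).
  by apply: (near_open oU Ux) => y Uy; rewrite partial_enorm// U0.
apply: (@continuousM _ _ (fun y => y 0 i) (fun y => (enorm y)^-1)).
  exact: coord_continuous.
apply: (@continuousV _ _ (@enorm R n)); first by rewrite gt_eqF// U0.
exact: enorm_continuous.
Qed.

Lemma C1_on_radial U (h : R -> R) : open U -> (forall x, U x -> 0 < enorm x) ->
  (forall x, U x -> derivable h (enorm x) 1 /\
    {for enorm x, continuous h^`()%classic}) ->
  C1_on U (fun x => h (enorm x)).
Proof. by move=> oU U0 hh; exact: (C1_on_comp oU (C1_on_enorm oU U0) hh). Qed.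

Lemma partial_radial (h : R -> R) x i : 0 < enorm x -> derivable h (enorm x) 1 ->
  partial i (fun y => h (enorm y)) x = h^`()%classic (enorm x) * (x 0 i / enorm x).
Proof.
move=> x0 dh; rewrite partial_comp//; first by rewrite partial_enorm.
exact: differentiable_enorm.
Qed.

Lemma partial_enormV x i : 0 < enorm x ->
  partial i (fun y => (enorm y)^-1) x = - x 0 i * (enorm x)^-1 ^+ 3.
Proof.
move=> x0; have x1 : enorm x != 0 by rewrite gt_eqF.
rewrite (@partial_comp _ _ GRing.inv (@enorm R n)).
- rewrite partial_enorm// derive1E deriveV// ?derive_id /GRing.scale/=.
  by field.
- exact: differentiable_enorm.
- exact: derivableV.
Qed.

Lemma C2_on_enormV U : open U -> (forall x, U x -> 0 < enorm x) ->
  C2_on U (fun x => (enorm x)^-1).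
Proof.
move=> oU U0; have C1 : C1_on U (fun x => (enorm x)^-1).
  apply/C1_onP => x Ux; have x0 : enorm x != 0 by rewrite gt_eqF ?U0.
  split=> [|i].
    by apply: (@differentiableV _ _ (@enorm R n)) => //; exact/differentiable_enorm/U0.
  apply: (@continuous_near _ _ _ (fun y => - y 0 i * (enorm y)^-1 ^+ 3)).
    by apply: (near_open oU Ux) => y Uy; rewrite partial_enormV// U0.
  apply: (@continuousM _ _ (fun y => - y 0 i) (fun y => (enorm y)^-1 ^+ 3)).
    by apply: (@continuousN _ _ _ (fun y => y 0 i)); exact: coord_continuous.
  apply: (@continuous_comp _ _ _ (fun y => (enorm y)^-1) (fun t => t ^+ 3)).
    by apply: (@continuousV _ _ (@enorm R n)) => //; exact: enorm_continuous.
  exact: exprn_continuous.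
split; first exact: C1.
move=> i.
apply: (@C1_on_eq _ _ _ (fun y => (-1 * y 0 i) * ((enorm y)^-1 *
   ((enorm y)^-1 * (enorm y)^-1))) _ oU).
  by move=> x Ux; rewrite (partial_enormV _ (U0 x Ux)); ring.
apply: (C1_onM oU); last exact: (C1_onM oU C1 (C1_onM oU C1 C1)).
apply: (@C1_onM _ _ _ (fun=> -1) (fun y => y 0 i) oU).
  exact: C1_on_cst.
exact: C1_on_coord.
Qed.

End enorm_calculus.

(** * Lattice sums *)

Section lattice_sums.
Context {R : realType} {n : nat}.
Implicit Types (f g : 'rV[R]_n -> R) (x y : 'rV[R]_n) (N : nat).

Definition mesh N : R := N.+1%:R^-1.

(** Indices 0, ..., 2(N + 1) give coordinates from -1 to 1 with both ends included, so a cyclic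
    shift wraps around only on the faces of the cube. *)
Definition grid_size N := (2 * N.+1).+1.

Definition grid_point N (j : {ffun 'I_n -> 'I_(grid_size N)}) : 'rV[R]_n :=
  \row_i ((j i)%:R * mesh N - 1).

Definition rsum N f : R := mesh N ^+ n * \sum_j f (grid_point (N := N) j).

(* The integral of [f] over the cube vanishes. *)
Definition null f : Prop := rsum N f @[N --> \oo] --> (0 : R).

Lemma mesh_gt0 N : 0 < mesh N. Proof. by rewrite invr_gt0. Qed.

Lemma mesh_le1 N : mesh N <= 1. Proof. by rewrite invf_le1// ler1n. Qed.

Lemma mesh_cvg0 : mesh N @[N --> \oo] --> (0 : R).
Proof. exact: cvg_harmonic. Qed.

Lemma rsumD N f g : rsum N (fun x => f x + g x) = rsum N f + rsum N g.
Proof. by rewrite /rsum big_split mulrDr. Qed.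

Lemma rsumZ N c f : rsum N (fun x => c * f x) = c * rsum N f.
Proof. by rewrite /rsum -mulr_sumr mulrCA. Qed.

Lemma rsumB N f g : rsum N (fun x => f x - g x) = rsum N f - rsum N g.
Proof. by rewrite /rsum sumrB mulrBr. Qed.

Lemma eq_rsum N f g : (forall x, f x = g x) -> rsum N f = rsum N g.
Proof. by move=> fg; congr rsum; exact/funext. Qed.

Lemma grid_point_cube N (j : {ffun 'I_n -> 'I_(grid_size N)}) k :
  `|grid_point j 0 k| <= 1.
Proof.
rewrite mxE ler_norml lerBrDr addNr mulr_ge0 ?(ltW (mesh_gt0 N))//=.
rewrite lerBlDr ler_pdivrMr// -[1 + 1]/(2%:R) -natrM ler_nat.
by have := ltn_ord (j k); rewrite /grid_size ltnS.
Qed.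

Lemma ler_rsum N f g : (forall x, (forall k, `|x 0 k| <= 1) -> f x <= g x) ->
  rsum N f <= rsum N g.
Proof.
move=> fg; rewrite ler_pM2l ?exprn_gt0 ?mesh_gt0//; apply: ler_sum => j _.
by apply: fg => k; exact: grid_point_cube.
Qed.

Lemma rsum_cst N c : rsum N (fun=> c) = (2 + mesh N) ^+ n * c.
Proof.
rewrite /rsum sumr_const card_ffun !card_ord -[c *+ _]mulr_natl mulrA natrX.
rewrite -exprMn; congr (_ ^+ _ * _); rewrite /grid_size -[X in _ * X]natr1.
rewrite natrM /mesh; field.
by rewrite nat1r pnatr_eq0.
Qed.

(** Counting both ends of each axis gives the lattice the volume [(2 + mesh N) ^+ n]; 3 bounds this
    side uniformly in [N]. *)
Lemma ler_norm_rsum N f B : (forall x, (forall k, `|x 0 k| <= 1) -> `|f x| <= B) ->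
  `|rsum N f| <= 3 ^+ n * B.
Proof.
move=> fB.
have B0 : 0 <= B.
  by apply: le_trans (fB 0 _) => // k; rewrite mxE normr0.
apply: (@le_trans _ _ (rsum N (fun=> B))).
  rewrite ler_norml; apply/andP; split.
    rewrite -[X in X <= _]mulN1r -rsumZ; apply: ler_rsum => x /fB.
    by rewrite mulN1r ler_norml => /andP[].
  by apply: ler_rsum => x /fB; rewrite ler_norml => /andP[].
rewrite rsum_cst ler_wpM2r// lerXn2r ?nnegrE ?addr_ge0 ?(ltW (mesh_gt0 _))//.
have := mesh_le1 N; lra.
Qed.

Lemma nullD f g : null f -> null g -> null (fun x => f x + g x).
Proof.
move=> f0 g0; have h := cvgD f0 g0; rewrite addr0 in h.
by rewrite /null; under eq_fun do rewrite rsumD; exact: h.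
Qed.

Lemma nullZ c f : null f -> null (fun x => c * f x).
Proof.
move=> f0; have h := cvgMl_tmp (a := c) f0; rewrite mulr0 in h.
by rewrite /null; under eq_fun do rewrite rsumZ; exact: h.
Qed.

Lemma eq_null f g : (forall x, f x = g x) -> null f -> null g.
Proof. by move=> fg; rewrite (_ : f = g)//; exact/funext. Qed.

Lemma null0 : null (fun=> 0).
Proof.
rewrite /null; under eq_fun do rewrite rsum_cst mulr0; exact: (@cvg_cst R).
Qed.

Lemma null_sum (I : finType) (F : I -> 'rV[R]_n -> R) :
  (forall i, null (F i)) -> null (fun x => \sum_i F i x).
Proof.
move=> F0; elim: (index_enum I) => [|i s IH].
  by under eq_fun do rewrite big_nil; exact: null0.
by under eq_fun do rewrite big_cons; exact: nullD.
Qed.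

(* [f] vanishes outside the open cube, so the cyclic shift of the lattice in
   direction [i] acts on the sum as a genuine translation. *)
Lemma rsum_shift N f i : (forall x, f x != 0 -> forall k, `|x 0 k| < 1) ->
  rsum N (fun x => f (x + mesh N *: delta_mx 0 i)) = rsum N f.
Proof.
move=> f0; congr (_ * _).
pose s (j : {ffun 'I_n -> 'I_(grid_size N)}) : {ffun 'I_n -> 'I_(grid_size N)} :=
  [ffun k => if k == i then ordS (j k) else j k].
pose t (j : {ffun 'I_n -> 'I_(grid_size N)}) : {ffun 'I_n -> 'I_(grid_size N)} :=
  [ffun k => if k == i then ord_pred (j k) else j k].
rewrite [RHS](reindex s)/=; last first.
  exists t => j _; apply/ffunP => k; rewrite !ffunE; case: eqP => // _.
    exact: ordSK.
  exact: ord_predK.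
apply: eq_bigr => j _.
have [ji|] := ltnP (j i) (2 * N.+1).
  congr (f _); apply/rowP => k; rewrite !mxE !ffunE eqxx /=.
  case: eqP => [->|_]; last by rewrite mulr0 addr0.
  rewrite /= modn_small ?ltnS//.
  by rewrite mulr1 -[(j i).+1%:R]natr1 mulrDl mul1r addrAC.
move=> ji; have {ji} ji : nat_of_ord (j i) = (2 * N.+1)%N.
  by apply/eqP; rewrite eqn_leq ji -ltnS -/(grid_size N) ltn_ord.
have -> : f (grid_point (s j)) = 0.
  apply/eqP; apply: contraT => /f0 /(_ i).
  by rewrite !mxE ffunE eqxx /= ji modnn mul0r sub0r normrN normr1 ltxx.
apply/eqP; apply: contraT => /f0 /(_ i).
rewrite !mxE !eqxx /= ji ltr_norml natrM /mesh -mulrA divff ?pnatr_eq0// mulr1.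
have := mesh_gt0 N; rewrite /mesh => h /andP[_].
by rewrite mulr1 -[2%:R]/(1 + 1 : R) addrK gtrDl ltNge ltW.
Qed.

Lemma is_derive_line f x i t : differentiable f (x + t *: delta_mx 0 i) ->
  is_derive t 1 (fun s => f (x + s *: delta_mx 0 i))
    (partial i f (x + t *: delta_mx 0 i)).
Proof.
move=> df; have := @diff_derivable _ _ _ f _ (delta_mx 0 i : 'rV[R]_n) df.
set y := x + t *: delta_mx 0 i => dfy.
have E : (fun h : R => h^-1 *: (((fun s => f (x + s *: delta_mx 0 i)) \o shift t)
     (h *: 1) - f y)) = (fun h => h^-1 *: ((f \o shift y) (h *: delta_mx 0 i) - f y)).
  apply/funext => h /=; congr (_ *: (f _ - _)).
  by rewrite -[h%:A]/(h * 1) mulr1 scalerDl addrCA.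
by split; [rewrite /derivable E | rewrite /partial /derive E].
Qed.

(** Compactness of the cube makes the threshold on [t] independent of [x]. The shifted point may
    leave the cube, as [f] is continuous on the whole space. *)
Lemma uniform_shift f (e : 'rV[R]_n) (del : R) : continuous f -> 0 < del ->
  \forall t \near (0 : R), forall x, (forall k, `|x 0 k| <= 1) ->
    `|f (x + t *: e) - f x| <= del.
Proof.
move=> cf del0.
have cK : compact [set x : 'rV[R]_n | forall k, `[-1, 1]%classic (x ord0 k)].
  by apply: (@rV_compact _ _ (fun=> `[(-1:R), 1]%classic)) => _; exact: segment_compact.
have /compact_near_coveringP cov := cK.
have H : forall x : 'rV[R]_n, [set x0 : 'rV[R]_n| forall k, `[-1, 1]%classic (x0 ord0 k)] x ->
    \forall x' \near x & t \near (0 : R), `|f (x' + t *: e) - f x'| <= del.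
  move=> x _.
  have c1 : {for (x, 0 : R), continuous (fun z : 'rV[R]_n * R => f (z.1 + z.2 *: e))}.
    apply: (@continuous_comp _ _ _ (fun z : 'rV[R]_n * R => z.1 + z.2 *: e) f).
      apply: (@cvgD _ _ _ _ _ (fun z : 'rV[R]_n * R => z.1) (fun z => z.2 *: e)).
        exact: cvg_fst.
      by apply: cvgZr_tmp; exact: cvg_snd.
    exact: cf.
  have c2 : {for (x, 0 : R), continuous (fun z : 'rV[R]_n * R => f z.1)}.
    by apply: (@continuous_comp _ _ _ (fun z : 'rV[R]_n * R => z.1) f);
      [exact: cvg_fst|exact: cf].
  have := @cvgB _ _ _ (nbhs (x, 0 : R)) (nbhs_filter _) _ _ _ _ c1 c2.
  rewrite /= scale0r addr0 subrr => /cvgr0Pnorm_le /(_ _ del0).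
  by [].
have h := cov R (nbhs (0 : R)) (fun t x => `|f (x + t *: e) - f x| <= del)
  (nbhs_filter _) H.
by apply: filterS h => t Ht x Hx; apply: Ht => k /=; rewrite in_itv /= -ler_norml.
Qed.

(** Difference quotients have lattice sum exactly zero by translation, and by the mean value theorem
    they are uniformly close to the partial derivative. *)
Lemma null_partial f i : (forall x, differentiable f x) ->
  continuous (partial i f) -> (forall x, f x != 0 -> forall k, `|x 0 k| < 1) ->
  null (partial i f).
Proof.
move=> df cf f0; apply/cvgr0Pnorm_le => e e0.
have d0 : 0 < e / 3 ^+ n by rewrite divr_gt0// exprn_gt0.
have /nbhs_norm0P[r /= r0 Hr] := uniform_shift (delta_mx 0 i) cf d0.
have /cvgr0Pnorm_lt/(_ r r0) := mesh_cvg0; apply: filterS => N Nr.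
have h0 := mesh_gt0 N; rewrite gtr0_norm// in Nr.
have -> : rsum N (partial i f) = rsum N (fun x => partial i f x -
    (mesh N)^-1 * (f (x + mesh N *: delta_mx 0 i) - f x)).
  by rewrite rsumB rsumZ rsumB rsum_shift// subrr mulr0 subr0.
rewrite (_ : e = 3 ^+ n * (e / 3 ^+ n)); last by field; rewrite expf_neq0.
apply: ler_norm_rsum => x x1.
have [c] : exists2 c, c \in `[0, mesh N] &
    f (x + mesh N *: delta_mx 0 i) - f (x + 0 *: delta_mx 0 i) =
    partial i f (x + c *: delta_mx 0 i) * (mesh N - 0).
  apply: (@MVT_segment R (fun s => f (x + s *: delta_mx 0 i))
      (fun s => partial i f (x + s *: delta_mx 0 i))) => //.
  - exact: ltW.
  - by move=> t _; exact: is_derive_line.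
  - apply: derivable_within_continuous => t _.
    by case: (@is_derive_line f x i t (df _)).
rewrite in_itv /= => /andP[c0 cN]; rewrite scale0r addr0 subr0 => ->.
rewrite mulrCA mulVf ?gt_eqF// mulr1 distrC.
by apply: Hr => //=; rewrite ger0_norm// (le_lt_trans cN).
Qed.

End lattice_sums.

(** * Counting lattice points in boxes *)

Section lattice_count.
Context {R : realType}.
Implicit Types (t r : R) (N : nat).

Definition axis_near N t r : {set 'I_(grid_size N)} :=
  [set j : 'I_(grid_size N) | `|j%:R * mesh N - 1 - t| <= r].

(** About [2 * r / mesh N] indices qualify. Keeping a run of about half of them, starting just past
    [t - r], gives a bound free of rounding terms. *)
Lemma axis_near_ge N t r : `|t| + r <= 1 -> mesh N <= r ->
  r <= mesh N * #|axis_near N t r|%:R.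
Proof.
move=> tr hr; have h0 := @mesh_gt0 R N.
have r0 : 0 < r by exact: lt_le_trans hr.
pose a := (t + 1 - r) / mesh N.
have a0 : 0 <= a.
  by rewrite divr_ge0 ?(ltW h0)//; have := ler_norm (- t); rewrite normrN; lra.
pose j0 := (Num.truncn a).+1; pose L := (Num.truncn (r / mesh N)).+1.
have /andP[j0l j0u] := truncn_itv a0.
have q0 : 0 <= r / mesh N by rewrite divr_ge0// ltW.
have /andP[ql qu] := truncn_itv q0.
have qr : r / mesh N * mesh N = r by rewrite divfK// gt_eqF.
have am : a * mesh N = t + 1 - r by rewrite divfK// gt_eqF.
have lb (l : 'I_L) : (t + 1) - r <= (j0 + l)%:R * mesh N <= (t + 1) + r.
  have l2 : l%:R <= r / mesh N.
    by apply: le_trans ql; rewrite ler_nat -ltnS.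
  have j1 : (j0%:R : R) <= a + 1 by rewrite /j0 -natr1; lra.
  rewrite -am natrD; apply/andP; split.
    apply: ler_wpM2r; first exact: ltW.
    by apply: le_trans (ltW j0u) _; rewrite lerDl.
  apply: (@le_trans _ _ ((a + 1 + r / mesh N) * mesh N)).
    by apply: ler_wpM2r; [exact: ltW|lra].
  by rewrite !mulrDl am qr mul1r; lra.
have lt (l : 'I_L) : (j0 + l < grid_size N)%N.
  rewrite /grid_size ltnS -(ler_nat R) natrM.
  have /andP[_ h] := lb l.
  rewrite -(ler_pM2r h0) -mulrA divff ?mulr1 ?pnatr_eq0//.
  by apply: le_trans h _; have := ler_norm t; lra.
pose f (l : 'I_L) : 'I_(grid_size N) := Ordinal (lt l).
have fi : injective f.
  by move=> l l' /(congr1 val)/= /addnI; exact: val_inj.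
have : (L <= #|axis_near N t r|)%N.
  rewrite -[X in (X <= _)%N](card_ord L) -(card_imset _ fi); apply: subset_leq_card.
  apply/fintype.subsetP => _ /imsetP[l _ ->]; rewrite inE /= ler_norml.
  have /andP[h1 h2] := lb l; lra.
rewrite -(ler_nat R) => LA.
rewrite -{1}qr mulrC ler_pM2l//; apply: le_trans LA; exact: ltW.
Qed.

(** Indices are counted from the smallest one in the set; all others lie within [2 * r / mesh N] of
    it. *)
Lemma axis_near_le N t r : 0 <= r ->
  mesh N * #|axis_near N t r|%:R <= 2 * r + mesh N.
Proof.
move=> r0; have h0 := @mesh_gt0 R N.
have [A0|[j1 j1A]] := set_0Vmem (axis_near N t r).
  by rewrite A0 cards0 mulr0 addr_ge0 ?mulr_ge0// ltW.
have [jm jmA jmin] : exists2 j0, j0 \in axis_near N t r &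
    forall j, j \in axis_near N t r -> (j0 <= j)%N.
  by case: (arg_minnP (P := mem (axis_near N t r)) (fun j => val j) j1A) => i; exists i.
pose L := (Num.truncn (2 * r / mesh N)).+1.
have q0 : 0 <= 2 * r / mesh N by rewrite divr_ge0 ?(ltW h0)// mulr_ge0.
have /andP[ql qu] := truncn_itv q0.
have lt j : j \in axis_near N t r -> (j - jm < L)%N.
  move=> jA; rewrite ltnNge; apply/negP => Lj.
  move: (jA) (jmA); rewrite !inE !ler_norml => /andP[a1 a2] /andP[b1 b2].
  have : ((j - jm)%:R : R) <= 2 * r / mesh N.
    rewrite ler_pdivlMr// natrB ?jmin// mulrBl; lra.
  apply/negP; rewrite -ltNge; apply: lt_le_trans qu _.
  by rewrite ler_nat.
pose f (j : 'I_(grid_size N)) : 'I_L := insubd ord0 (j - jm)%N.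
have fi : {in axis_near N t r &, injective f}.
  move=> j j' jA j'A /(congr1 val); rewrite /= !insubdK; try exact: lt.
  move=> /(congr1 (addn jm)); rewrite !subnKC ?jmin//; exact: val_inj.
have : (#|axis_near N t r| <= L)%N.
  by rewrite -(card_in_imset fi) -[X in (_ <= X)%N](card_ord L) max_card.
rewrite -(ler_nat R) /L -natr1 => LA.
have -> : 2 * r + mesh N = mesh N * (2 * r / mesh N + 1).
  by field; rewrite gt_eqF.
rewrite ler_pM2l//; apply: le_trans LA _; lra.
Qed.

Context {n : nat}.
Implicit Types (c x : 'rV[R]_n).

Definition in_box c r x := [forall k, `|x 0 k - c 0 k| <= r].

Lemma rsum_box N c r : rsum N (fun x => (in_box c r x)%:R) =
  \prod_(k < n) (mesh N * #|axis_near N (c 0 k) r|%:R).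
Proof.
rewrite big_split /= prodr_const card_ord; congr (_ * _).
under [RHS]eq_bigr => k _ do
  rewrite -sum1_card natr_sum big_mkcond /=.
rewrite bigA_distr_bigA /=; apply: eq_bigr => j _.
rewrite /in_box; case: forallP => [h|h].
  rewrite big1 // => k _; rewrite inE.
  by move: (h k); rewrite mxE => ->.
apply/esym/eqP/prodf_eq0.
have [k hk] : exists k, ~~ (`|grid_point j 0 k - c 0 k| <= r).
  by apply/existsP; rewrite -negb_forall; apply/negP => /forallP.
by exists k => //; move: hk; rewrite inE mxE => /negPf ->.
Qed.

Lemma rsum_box_ge N c r : (forall k, `|c 0 k| + r <= 1) -> mesh N <= r ->
  r ^+ n <= rsum N (fun x => (in_box c r x)%:R).
Proof.
move=> cr hr; rewrite rsum_box -[X in r ^+ X](card_ord n) -prodr_const.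
apply: ler_prod => k _; rewrite axis_near_ge// andbT.
by apply: le_trans hr; rewrite ltW// mesh_gt0.
Qed.

Lemma rsum_box_le N c r : 0 <= r ->
  rsum N (fun x => (in_box c r x)%:R) <= (2 * r + mesh N) ^+ n.
Proof.
move=> r0; rewrite rsum_box -[X in _ <= _ ^+ X](card_ord n) -prodr_const.
apply: ler_prod => k _; rewrite axis_near_le// andbT mulr_ge0//.
by rewrite ltW// mesh_gt0.
Qed.

End lattice_count.

(** * Radial weights and fluxes *)

Section radial_tests.
Context {R : realType}.
Implicit Types (a b r : R) (psi eta : R -> R).

Definition rtest a b psi :=
  continuous psi /\ forall r, psi r != 0 -> a <= r <= b.

(** A weight [psi] of total mass zero, kept together with its compactly supported primitive:
    [eta (enorm x)] multiplies a vector field, and [psi] arises from the gradient of that factor. *)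
Definition cutoff a b eta psi :=
  [/\ continuous psi, forall r, is_derive r 1 eta (psi r)
    & forall r, eta r != 0 -> a <= r <= b].

Lemma derive0_eq (f : R -> R) a b : a <= b ->
  (forall r, a <= r <= b -> is_derive r (1 : R) f (0 : R)) -> f a = f b.
Proof.
move=> ab df.
have [] := @MVT_segment R f (fun=> 0) a b ab.
- by move=> x; rewrite in_itv /= => /andP[ax xb]; apply: df; rewrite !ltW.
- apply: derivable_within_continuous => x; rewrite in_itv /= => /df dx.
  exact: ex_derive.
- by move=> c _; rewrite mul0r => /eqP; rewrite subr_eq0 => /eqP.
Qed.

(** [c] is the total mass of [psi]; a compactly supported primitive exists when [c = 0]. *)
Lemma rtest_primitive a b psi : a <= b -> rtest a b psi ->
  exists eta c, [/\ forall r, is_derive r 1 eta (psi r),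
    forall r, r <= a -> eta r = 0 & forall r, b <= r -> eta r = c].
Proof.
move=> ab [cpsi psi0].
(* Starting at [a - 2] leaves room to the left of [a], where the fundamental theorem of calculus
   holds at interior points. *)
pose F r := \int[lebesgue_measure]_(t in `[a - 2, r]) psi t.
have dF r : a - 2 < r -> is_derive r (1 : R) F (psi r).
  move=> ar.
  have ru : r < r + 1 by rewrite ltrDl.
  have pint : lebesgue_measure.-integrable `[a - 2, r + 1] (EFin \o psi).
    apply: continuous_compact_integrable; first exact: segment_compact.
    exact: continuous_subspaceT.
  have [d1 d2] := continuous_FTC1_closed ru pint ar (cpsi r).
  apply: DeriveDef; first exact: d1.
  by rewrite -derive1E; exact: d2.
have psia r : r < a -> psi r = 0.
  by move=> ra; apply/eqP; apply: contraT => /psi0; rewrite leNgt ra.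
have psib r : b < r -> psi r = 0.
  by move=> ra; apply/eqP; apply: contraT => /psi0; rewrite [r <= b]leNgt ra andbF.
have psiaa : psi a = 0.
  apply: (@cvg_unique _ (@Rhausdorff R) (psi x @[x --> a^'-])).
    by apply: cvg_at_left_filter; exact: cpsi.
  apply: (cvg_trans _ (@cvg_cst _ (0 : R) _ (a^'-) _)).
  by apply: near_eq_cvg; near=> x; rewrite psia.
have psibb : psi b = 0.
  apply: (@cvg_unique _ (@Rhausdorff R) (psi x @[x --> b^'+])).
    by apply: cvg_at_right_filter; exact: cpsi.
  apply: (cvg_trans _ (@cvg_cst _ (0 : R) _ (b^'+) _)).
  by apply: near_eq_cvg; near=> x; rewrite psib.
have psia' r : r <= a -> psi r = 0.
  by rewrite le_eqVlt => /predU1P[->//|]; exact: psia.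
have psib' r : b <= r -> psi r = 0.
  by rewrite le_eqVlt => /predU1P[<-//|]; exact: psib.
(* Forcing 0 on the left gives one function on the whole line; it agrees with [F r - F a] on the
   range where [F] is known to be differentiable. *)
pose eta r := if r <= a then 0 else F r - F a.
have etaE r : a - 2 < r -> eta r = F r - F a.
  rewrite /eta; case: ifP => // ra ar.
  suff -> : F r = F a by rewrite subrr.
  apply: derive0_eq => [//|s /andP[rs sa]].
  by rewrite -(psia' s sa); apply: dF; exact: lt_le_trans rs.
exists eta, (F b - F a); split.
- move=> r; have [ar|ra] := ltP (a - 2) r.
    apply: (@near_eq_is_derive _ _ _ (fun s => F s - F a)).
      by near=> s; rewrite etaE//; near: s; exact: lt_nbhsr.
    have h := @is_deriveB _ _ _ F (cst (F a)) r 1 (psi r) 0 (dF _ ar) (is_derive_cst _ _ _).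
    by rewrite subr0 in h.
  apply: (@near_eq_is_derive _ _ _ (fun s => 0)).
    near=> s; rewrite /eta ifT//; near: s.
    apply: (@filterS _ _ _ [set s | s < a]); first by move=> s /ltW.
    by apply: lt_nbhsl; lra.
  rewrite psia; last lra.
  exact: is_derive_cst.
- by move=> r ra; rewrite /eta ra.
- move=> r br; rewrite etaE; last lra.
  suff -> : F b = F r by [].
  apply: derive0_eq => [//|s /andP[bs sr]].
  by rewrite -(psib' s bs); apply: dF; lra.
Unshelve. all: by end_near. Qed.

(** Twice the positive part of [(r - a) * (b - r)], written with an absolute value to make
    continuity immediate. *)
Definition hat a b r : R := (r - a) * (b - r) + `|(r - a) * (b - r)|.

Lemma hat_ge0 a b r : 0 <= hat a b r.
Proof. by have := ler_norm (- ((r - a) * (b - r))); rewrite normrN /hat; lra. Qed.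

Lemma hat_ge a b r s : 0 <= s -> a + s <= r <= b - s -> s ^+ 2 <= hat a b r.
Proof.
move=> s0 /andP[h1 h2]; have w : s ^+ 2 <= (r - a) * (b - r).
  by rewrite expr2; apply: ler_pM => //; lra.
by apply: le_trans w _; rewrite lerDl.
Qed.

Lemma rtest_hat a b : a <= b -> rtest a b (hat a b).
Proof.
move=> ab; split=> [r|r].
  have c1 : {for r, continuous (fun s => s - a)}.
    by apply: (@cvgB _ _ _ (nbhs r) _ id (cst a)); [exact: cvg_id|exact: cvg_cst].
  have c2 : {for r, continuous (fun s => b - s)}.
    by apply: (@cvgB _ _ _ (nbhs r) _ (cst b) id); [exact: cvg_cst|exact: cvg_id].
  have c3 := continuousM c1 c2.
  exact: (continuousD c3 (continuous_comp c3 (@norm_continuous _ R _))).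
apply: contraNT; rewrite negb_and -!ltNge => H.
have [rb|br] := leP r b; last first.
  by rewrite /hat ler0_norm ?subrr// mulr_ge0_le0//; lra.
by rewrite /hat ler0_norm ?subrr// mulr_le0_ge0//; case/orP: H => H; lra.
Qed.

(** The hat is divided by its mass, which is positive by the mean value theorem. *)
Lemma bump_exists a b : a < b -> exists rho eta,
  [/\ rtest a b rho, forall r, 0 <= rho r, forall r, is_derive r 1 eta (rho r),
    forall r, r <= a -> eta r = 0 & forall r, b <= r -> eta r = 1].
Proof.
move=> ab; pose h := hat a b; have ht : rtest a b h := rtest_hat (ltW ab).
have h0 r : 0 <= h r := hat_ge0 a b r.
have [eta [c [deta eta0 etac]]] := rtest_primitive (ltW ab) ht.
have c0 : 0 < c.
  have [] := @MVT R eta h a b ab.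
  - by apply: derivable_within_continuous => r rab; exact: ex_derive.
  move=> s; rewrite in_itv /= => /andP[aas sb].
  rewrite (eta0 a)// (etac b)// subr0 => ->.
  have w0 : 0 < (s - a) * (b - s) by rewrite mulr_gt0; lra.
  by rewrite mulr_gt0 ?subr_gt0// /h /hat gtr0_norm ?addr_gt0.
exists (fun r => c^-1 * h r), (fun r => c^-1 * eta r); split.
- split=> [r|r H].
    have c1 : {for r, continuous (fun=> c^-1 : R)} by exact: cst_continuous.
    exact: (continuousM c1 (ht.1 r)).
  by apply: ht.2; apply: contraNN H => /eqP ->; rewrite mulr0.
- by move=> r; rewrite mulr_ge0// invr_ge0 ltW.
- by move=> r; have := @is_deriveZ _ _ _ eta c^-1 r 1 _ (deta r).
- by move=> r ra; rewrite eta0// mulr0.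
- by move=> r br; rewrite etac// mulVf// gt_eqF.
Qed.

(** Outside [[a, b]] the primitive [eta] is locally zero, hence so is its derivative [psi]. *)
Lemma cutoff_rtest a b eta psi : cutoff a b eta psi -> rtest a b psi.
Proof.
move=> [cpsi deta eta0]; split=> // r.
apply: contraNT; rewrite negb_and -!ltNge => H.
rewrite -(@derive_val _ _ _ _ _ _ _ (deta r)).
have -> : 'D_1 eta r = 'D_1 (cst (0 : R)) r.
  apply: near_eq_derive; case/orP: H => H.
    near=> s; apply/eqP; apply: contraT => /eta0; rewrite leNgt.
    by suff -> : s < a by []; near: s; exact: lt_nbhsl.
  near=> s; apply/eqP; apply: contraT => /eta0; rewrite andbC leNgt.
  by suff -> : b < s by []; near: s; exact: lt_nbhsr.
by rewrite derive_cst.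
Unshelve. all: by end_near. Qed.

End radial_tests.

(** * Divergence theorem against radial cutoffs *)

Section flux.
Context {R : realType} {n : nat}.
Implicit Types (x y : 'rV[R]_n) (a b e r : R) (psi eta : R -> R).

Unset Implicit Arguments.
Lemma open_enorm_lt r : open [set x : 'rV[R]_n | enorm x < r].
Proof.
apply: (@open_comp _ _ (@enorm R n) [set s | s < r]); last exact: open_lt.
by move=> x _; exact: enorm_continuous.
Qed.

Lemma open_enorm_gt r : open [set x : 'rV[R]_n | r < enorm x].
Proof.
apply: (@open_comp _ _ (@enorm R n) [set s | r < s]); last exact: open_gt.
by move=> x _; exact: enorm_continuous.
Qed.

Lemma shellE e x : shell e x <-> e < enorm x < 1.
Proof.
rewrite /shell /eball /=; split=> [[x1 /negP]|/andP[x0 x1]].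
  by rewrite -ltNge => ->.
by split=> //; apply/negP; rewrite -ltNge.
Qed.

Lemma open_shell e : open (@shell R n e).
Proof.
rewrite (_ : shell e = [set x | enorm x < 1] `&` [set x | e < enorm x]).
  by apply: openI; [exact: open_enorm_lt|exact: open_enorm_gt].
apply/seteqP; split=> x; first by rewrite shellE => /andP[].
by move=> [h1 h2]; rewrite shellE; apply/andP.
Qed.
Set Implicit Arguments.

Lemma coord_le_enorm x k : `|x 0 k| <= enorm x.
Proof.
rewrite -sqrtr_sqr ler_wsqrtr// /dotv (bigD1 k)//= -expr2 lerDl.
by apply: sumr_ge0 => i _; rewrite -expr2 sqr_ge0.
Qed.

Lemma partial_cst0 (f : 'rV[R]_n -> R) x i : {near x, f =1 (fun=> 0)} ->
  partial i f x = 0.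
Proof. by move=> /partial_near ->; rewrite partial_cst. Qed.

(* The products [eta |x| * Phi i x] extend by zero to a compactly supported
   field of class C^1. *)
Lemma null_div e a b eta psi (Phi : 'I_n -> 'rV[R]_n -> R) :
  0 <= e -> e < a -> b < 1 -> cutoff a b eta psi ->
  (forall i, C1_on (shell e) (Phi i)) ->
  null (fun x => psi (enorm x) * (enorm x)^-1 * (\sum_i x 0 i * Phi i x)
                 + eta (enorm x) * \sum_i partial i (Phi i) x).
Proof.
move=> e0 ea b1 cut C1Phi.
have [cpsi deta eta0] := cut; have [_ psi0] := cutoff_rtest cut.
have detar r : derivable eta r 1 by exact: ex_derive.
have etaE : eta^`()%classic = psi by apply/funext => r; rewrite derive1E derive_val.
pose F i x := eta (enorm x) * Phi i x.
(* The space is covered by two open sets: [V], where the field is zero, and the shell, where it is a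
   product of [C^1] functions. *)
pose V := [set x : 'rV[R]_n | enorm x < a] `|` [set x | b < enorm x].
have oV : open V by apply: openU; [exact: open_enorm_lt|exact: open_enorm_gt].
have out x : V x -> eta (enorm x) = 0 /\ psi (enorm x) = 0.
  move=> Vx; have H : ~~ (a <= enorm x <= b).
    by rewrite negb_and -!ltNge; case: Vx => /= ->; rewrite ?orbT.
  split; apply/eqP; apply: contraNT H; [exact: eta0|exact: psi0].
have FV i x : V x -> F i x = 0 by move=> /out[h _]; rewrite /F h mul0r.
have cover x : ~ V x -> shell e x.
  move=> /not_orP[] /= /negP; rewrite -leNgt => ax /negP; rewrite -leNgt => xb.
  by apply/shellE; apply/andP; split; lra.
have C1eta : C1_on (shell e) (fun x : 'rV[R]_n => eta (enorm x)).
  have U0 x : shell e x -> 0 < enorm x by move=> /shellE /andP[h _]; exact: le_lt_trans h.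
  have hh x : shell e x -> derivable eta (enorm x) 1 /\
    {for enorm x, continuous eta^`()%classic}.
    by move=> _; split; [exact: detar|rewrite etaE; exact: cpsi].
  exact: (@C1_on_radial _ _ _ eta (open_shell e) U0 hh).
have C1F i : C1_on (shell e) (F i) by exact: (C1_onM (open_shell e) C1eta (C1Phi i)).
have C1V i : C1_on V (F i).
  by apply: (C1_on_eq oV (f := fun=> 0)); [move=> x /FV ->|exact: C1_on_cst].
have reg i x : differentiable (F i) x /\ {for x, continuous (partial i (F i))}.
  have [|/cover] := pselect (V x).
    by move/C1_onP : (C1V i) => h /h[d c]; split; [exact: d|exact: c].
  by move/C1_onP : (C1F i) => h /h[d c]; split; [exact: d|exact: c].
have Fn i : null (partial i (F i)).
  apply: null_partial => [x|x|x Fx k]; [exact: (reg i x).1|exact: (reg i x).2|].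
  apply: le_lt_trans (coord_le_enorm x k) _.
  rewrite ltNge; apply/negP => x1.
  by rewrite FV ?eqxx// in Fx; right => /=; lra.
apply: (eq_null _ (null_sum Fn)) => x.
have [Vx|/cover sx] := pselect (V x).
  have [-> ->] := out x Vx; rewrite !mul0r addr0 big1// => i _.
  by apply: partial_cst0; apply: (near_open oV Vx) => y; exact: FV.
have x0 : 0 < enorm x by move/shellE : sx => /andP[h _]; exact: le_lt_trans h.
have pF i : partial i (F i) x =
    psi (enorm x) * (enorm x)^-1 * (x 0 i * Phi i x) + eta (enorm x) * partial i (Phi i) x.
  have -> := partialM i (C1eta x sx).1 (C1Phi i x sx).1.
  rewrite partial_radial// etaE; congr (_ + _); ring.
by rewrite (eq_bigr _ (fun i _ => pF i)) big_split /= -!mulr_sumr.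
Qed.

Lemma C2_on_enormVX U k : open U -> (forall x, U x -> 0 < enorm x) ->
  C2_on U (fun x : 'rV[R]_n => (enorm x)^-1 ^+ k).
Proof. by move=> oU U0; exact: (C2_onX k oU (C2_on_enormV oU U0)). Qed.

Lemma partial_enormVX k x i : 0 < enorm x ->
  partial i (fun y => (enorm y)^-1 ^+ k) x = - k%:R * (enorm x)^-1 ^+ k.+2 * x 0 i.
Proof.
move=> x0; have x1 : enorm x != 0 by rewrite gt_eqF.
have dv : differentiable (fun y : 'rV[R]_n => (enorm y)^-1) x.
  exact: ((C2_on_enormV (open_enorm_gt 0) (fun x h => h)).1 x x0).1.
elim: k => [|k IH].
  rewrite (_ : (fun y => _) = fun=> 1); last by apply/funext => y; rewrite expr0.
  by rewrite partial_cst oppr0 !mul0r.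
rewrite (_ : (fun y => _) = fun y => (enorm y)^-1 * (enorm y)^-1 ^+ k); last first.
  by apply/funext => y; rewrite exprS.
have dk : differentiable (fun y : 'rV[R]_n => (enorm y)^-1 ^+ k) x.
  exact: ((C2_on_enormVX k (open_enorm_gt 0) (fun x h => h)).1 x x0).1.
rewrite (partialM i dv dk) IH partial_enormV// !exprS -[in RHS]natr1; ring.
Qed.

Lemma shell_gt0 e x : 0 <= e -> shell e x -> 0 < enorm x.
Proof. by move=> e0 /shellE/andP[h _]; exact: le_lt_trans h. Qed.

(* The field [x / |x| ^+ n] is divergence free. *)
Lemma null_radial e a b eta psi : 0 <= e -> e < a -> b < 1 -> (0 < n)%N ->
  cutoff a b eta psi ->
  null (fun x : 'rV[R]_n => psi (enorm x) * (enorm x)^-1 ^+ n.-1).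
Proof.
move=> e0 ea b1 n0 cut.
have C1P i : C1_on (shell e) (fun x : 'rV[R]_n => x 0 i * (enorm x)^-1 ^+ n).
  apply: (C1_onM (open_shell e) (@C1_on_coord _ _ _ i)).
  exact: (C2_on_enormVX n (open_shell e) (fun x => @shell_gt0 e x e0)).1.
apply: (eq_null _ (null_div e0 ea b1 cut C1P)) => x /=.
have [/cutoff_rtest[_ psi0] [_ _ eta0]] := (cut, cut).
have [x0|x0] := ltP 0 (enorm x); last first.
  have H : ~~ (a <= enorm x <= b) by rewrite negb_and -ltNge; apply/orP; left; lra.
  have -> : psi (enorm x) = 0 by apply/eqP; apply: contraNT H; exact: psi0.
  have -> : eta (enorm x) = 0 by apply/eqP; apply: contraNT H; exact: eta0.
  by rewrite !mul0r addr0.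
have x1 : enorm x != 0 by rewrite gt_eqF.
have dv : differentiable (fun y : 'rV[R]_n => (enorm y)^-1 ^+ n) x.
  exact: ((C2_on_enormVX n (open_enorm_gt 0) (fun x h => h)).1 x x0).1.
have pE i : partial i (fun y : 'rV[R]_n => y 0 i * (enorm y)^-1 ^+ n) x =
    (enorm x)^-1 ^+ n + - n%:R * (enorm x)^-1 ^+ n.+2 * (x 0 i * x 0 i).
  rewrite (partialM i (@differentiable_coord _ _ _ x _ i) dv) partial_coord eqxx mul1r.
  by rewrite partial_enormVX//; ring.
rewrite (eq_bigr _ (fun i _ => pE i)) big_split /= sumr_const card_ord -mulr_sumr.
rewrite (eq_bigr (fun i => (enorm x)^-1 ^+ n * (x 0 i * x 0 i))); last first.
  by move=> i _; rewrite mulrCA mulrA mulrC; ring.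
rewrite -mulr_sumr -/(dotv x x) -sqr_enorm.
have alg (m : nat) (v p h : R) : v != 0 ->
    p * v^-1 * (v^-1 ^+ m.+1 * v ^+ 2) + h * (v^-1 ^+ m.+1 *+ m.+1
      + - m.+1%:R * v^-1 ^+ m.+3 * v ^+ 2) = p * v^-1 ^+ m.
  by move=> v0; rewrite -mulr_natl !exprS; field.
by have := alg n.-1 _ (psi (enorm x)) (eta (enorm x)) x1; rewrite (prednK n0).
Qed.

End flux.

(** * Vanishing of the flux *)

Section flux_vanishing.
Context {R : realType} {n : nat}.
Implicit Types (x y : 'rV[R]_n) (a b e r : R) (psi eta : R -> R).

(** Subtracting [c] times a unit bump removes the mass [c] of [f], so that the primitive vanishes on
    both sides. *)
Lemma cutoff_sub a1 b1 a2 b2 c f F g G :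
  rtest a1 b1 f -> (forall r, is_derive r 1 F (f r)) ->
  (forall r, r <= a1 -> F r = 0) -> (forall r, b1 <= r -> F r = c) ->
  rtest a2 b2 g -> (forall r, is_derive r 1 G (g r)) ->
  (forall r, r <= a2 -> G r = 0) -> (forall r, b2 <= r -> G r = 1) ->
  cutoff (Num.min a1 a2) (Num.max b1 b2) (fun r => F r - c * G r)
    (fun r => f r - c * g r).
Proof.
move=> [cf f0] dF F0 Fc [cg g0] dG G0 G1; split.
- move=> r.
  have c1 : {for r, continuous (fun s => c * g s)}.
    have c2 : {for r, continuous (fun=> c : R)} by exact: cst_continuous.
    exact: (continuousM c2 (cg r)).
  exact: (continuousB (cf r) c1).
- move=> r; exact: (is_deriveB (dF r) (is_deriveZ c (dG r))).
- move=> r; apply: contraNT; rewrite negb_and -!ltNge lt_min gt_max.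
  case/orP => /andP[h1 h2]; first by rewrite F0 ?ltW// G0 ?ltW// mulr0 subrr.
  by rewrite Fc ?ltW// G1 ?ltW// mulr1 subrr.
Qed.

(* Two radial weights with the same mass see the same flux; moving the mass
   towards the end where [K] is small shows that the flux is zero. *)
Lemma flux_vanish e (K : 'rV[R]_n -> R) : 0 <= e -> (0 < n)%N ->
  (forall a b eta psi, e < a -> b < 1 -> cutoff a b eta psi ->
     null (fun x => psi (enorm x) * K x)) ->
  (forall del, 0 < del -> exists a b, [/\ e < a, a < b, b < 1 &
     forall x, a <= enorm x <= b -> `|K x| <= del * (enorm x)^-1 ^+ n.-1]) ->
  forall a b psi, e < a -> a <= b -> b < 1 -> rtest a b psi ->
  null (fun x => psi (enorm x) * K x).
Proof.
move=> e0 n0 H1 H2 a b psi ea ab b1 tpsi.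
have [eta [c [deta eta0 etac]]] := rtest_primitive ab tpsi.
have [a0 [b0 [ea0 ab0 b01 _]]] := H2 _ ltr01.
(* A reference bump chosen before the tolerance: its sums against [(enorm x)^-1 ^+ n.-1] are bounded
   by [B] once and for all. *)
have [rho0 [th0 [trho0 rho00 dth0 th00 th01]]] := bump_exists ab0.
have [M0 M0P] : exists M0, forall r, rho0 r <= M0.
  have [s _ sP] := @EVT_max R rho0 a0 b0 (ltW ab0) (continuous_subspaceT trho0.1).
  exists (rho0 s) => r; have [rab|rab] := boolP (r \in `[a0, b0]); first exact: sP.
  suff -> : rho0 r = 0 by exact: rho00.
  by apply/eqP; apply: contraNT rab => /trho0.2; rewrite in_itv.
have M0ge : 0 <= M0 by exact: le_trans (M0P 0).
have a0p : 0 < a0 by exact: le_lt_trans ea0.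
pose B : R := 3 ^+ n * (M0 * a0^-1 ^+ n.-1).
have B0 : 0 <= B.
  by rewrite mulr_ge0 ?exprn_ge0// mulr_ge0// exprn_ge0// invr_ge0 ltW.
have rho0B N : rsum N (fun x : 'rV[R]_n => rho0 (enorm x) * (enorm x)^-1 ^+ n.-1) <= B.
  apply: (le_trans (ler_norm _)); apply: ler_norm_rsum => x _.
  have [->|/trho0.2 /andP[ax xb]] := eqVneq (rho0 (enorm x)) 0.
    by rewrite mul0r normr0 mulr_ge0// exprn_ge0// invr_ge0 ltW.
  have x0 : 0 < enorm x by exact: lt_le_trans ax.
  rewrite ger0_norm ?mulr_ge0 ?exprn_ge0 ?invr_ge0 ?enorm_ge0//.
  apply: ler_pM => //; first by rewrite exprn_ge0 ?invr_ge0 ?enorm_ge0.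
  apply: lerXn2r; [by rewrite nnegrE invr_ge0 enorm_ge0|
    by rewrite nnegrE invr_ge0 ltW|by rewrite lef_pV2 ?posrE].
apply/cvgr0Pnorm_le => eps eps0.
pose C := (`|c| + 1) * (B + 1).
have C0 : 0 < C by rewrite mulr_gt0// ltr_wpDl.
have d0 : 0 < eps / 2 / C by rewrite !divr_gt0.
have [a' [b' [ea' ab' b'1 KP]]] := H2 _ d0.
(* This bump sits where [K] is small. Replacing [psi] by [c * rho] is free in the limit, and the
   same exchange between [rho] and [rho0] for the divergence-free radial field keeps the sums
   against [rho] below [B + 1]. *)
have [rho [th [trho rho_ge0 dth th0' th1]]] := bump_exists ab'.
have N1 := H1 _ _ _ _ _ _ (cutoff_sub tpsi deta eta0 etac trho dth th0' th1).
have {N1} N1 : null (fun x => (psi (enorm x) - c * rho (enorm x)) * K x).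
  by apply: N1; rewrite ?lt_min ?gt_max ?ea ?ea' ?b1 ?b'1.
have C2 := cutoff_sub trho dth th0' th1 trho0 dth0 th00 th01.
have N2 := null_radial (n := n) e0 _ _ n0 C2.
have {N2} N2 : null (fun x : 'rV[R]_n => (rho (enorm x) - 1 * rho0 (enorm x)) *
    (enorm x)^-1 ^+ n.-1).
  by apply: N2; rewrite ?lt_min ?gt_max ?ea0 ?ea' ?b01 ?b'1.
have e20 : 0 < eps / 2 by rewrite divr_gt0.
move/cvgr0Pnorm_le : N1 => /(_ _ e20) N1.
move/cvgr0Pnorm_le : N2 => /(_ _ ltr01) N2.
apply: filterS2 N1 N2 => N N1 N2.
have rrho : rsum N (fun x : 'rV[R]_n => rho (enorm x) * (enorm x)^-1 ^+ n.-1) <= B + 1.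
  move: N2; under eq_rsum do rewrite mul1r mulrBl.
  rewrite rsumB ler_norml => /andP[_]; have := rho0B N; lra.
have rK : `|rsum N (fun x => rho (enorm x) * K x)| <= eps / 2 / C * (B + 1).
  apply: (@le_trans _ _ (eps / 2 / C *
     rsum N (fun x : 'rV[R]_n => rho (enorm x) * (enorm x)^-1 ^+ n.-1))); last first.
    by rewrite ler_wpM2l// ltW.
  have H x : `|rho (enorm x) * K x| <=
      eps / 2 / C * (rho (enorm x) * (enorm x)^-1 ^+ n.-1).
    rewrite normrM (ger0_norm (rho_ge0 _)) mulrCA.
    have [->|/trho.2 xab] := eqVneq (rho (enorm x)) 0; first by rewrite !mul0r.
    by rewrite ler_wpM2l// KP.
  rewrite -rsumZ ler_norml; apply/andP; split.
    rewrite -mulN1r -rsumZ; apply: ler_rsum => x _.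
    by rewrite mulN1r; have := H x; rewrite ler_norml => /andP[].
  by apply: ler_rsum => x _; have := H x; rewrite ler_norml => /andP[].
have -> : rsum N (fun x => psi (enorm x) * K x) =
    rsum N (fun x => (psi (enorm x) - c * rho (enorm x)) * K x) +
    c * rsum N (fun x => rho (enorm x) * K x).
  by rewrite -rsumZ -rsumD; apply: eq_rsum => x; ring.
apply: le_trans (ler_normD _ _) _; rewrite [leRHS]splitr lerD//.
rewrite normrM; apply: (@le_trans _ _ (`|c| * (eps / 2 / C * (B + 1)))).
  by rewrite ler_wpM2l.
have -> : `|c| * (eps / 2 / C * (B + 1)) = eps / 2 * (`|c| / (`|c| + 1)).
  rewrite /C; field.
  by rewrite !gt_eqF// ltr_wpDl.
have c10 : 0 < `|c| + 1 by rewrite ltr_wpDl.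
apply: ler_piMr; first exact: ltW.
by rewrite ler_pdivrMr// mul1r lerDl.
Qed.

End flux_vanishing.

(** * Green's formula for radial multiples of homogeneous functions *)

Section green.
Context {R : realType} {n : nat}.
Implicit Types (x y : 'rV[R]_n) (a b e r : R) (psi eta : R -> R).
Implicit Types (f g u w q : 'rV[R]_n -> R) (U : set 'rV[R]_n).

(** The Euler operator: [enorm x] times the radial derivative. *)
Definition xgrad f x := \sum_i x 0 i * partial i f x.

Lemma partial_partialM U f g i x : open U -> C2_on U f -> C2_on U g -> U x ->
  partial i (partial i (fun y => f y * g y)) x =
  partial i (partial i f) x * g x + 2 * (partial i f x * partial i g x)
  + f x * partial i (partial i g) x.
Proof.
move=> oU [f1 f2] [g1 g2] Ux.
rewrite (@eq_partial _ _ U _ (fun y => partial i f y * g y + f y * partial i g y) x i oU _ Ux); last first.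
  by move=> y Uy; exact: (partialM i (f1 y Uy).1 (g1 y Uy).1).
rewrite (partialD i (C1_onM oU (f2 i) g1 Ux).1 (C1_onM oU f1 (g2 i) Ux).1).
rewrite (partialM i (f2 i x Ux).1 (g1 x Ux).1) (partialM i (f1 x Ux).1 (g2 i x Ux).1).
move: (partial i (partial i f) x) (partial i (partial i g) x) (partial i f x)
  (partial i g x) (f x) (g x) => A B C D E F.
ring.
Qed.

Lemma laplacianM U f g x : open U -> C2_on U f -> C2_on U g -> U x ->
  laplacian (fun y => f y * g y) x =
  laplacian f x * g x + 2 * (\sum_i partial i f x * partial i g x) + f x * laplacian g x.
Proof.
move=> oU f2 g2 Ux; rewrite /laplacian mulr_suml !mulr_sumr -!big_split /=.
by apply: eq_bigr => i _; exact: (partial_partialM i oU f2 g2 Ux).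
Qed.

(** This is [null_div] for the field u grad w - w grad u, in whose divergence the first-order terms
    cancel. *)
Lemma null_green e a b eta psi u w : 0 <= e -> e < a -> b < 1 ->
  cutoff a b eta psi -> C2_on (shell e) u -> C2_on (shell e) w ->
  null (fun x => psi (enorm x) * ((enorm x)^-1 * (u x * xgrad w x - w x * xgrad u x))
     + eta (enorm x) * (u x * laplacian w x - w x * laplacian u x)).
Proof.
move=> e0 ea b1 cut [u1 u2] [w1 w2]; have os := @open_shell R n e.
pose Phi i x := u x * partial i w x + (- 1 * (w x * partial i u x)).
have C1P i : C1_on (shell e) (Phi i).
  apply: (C1_onD os (C1_onM os u1 (w2 i))).
  apply: (@C1_onM _ _ _ (fun=> -1) (fun x => w x * partial i u x) os).
    exact: C1_on_cst.
  exact: (C1_onM os w1 (u2 i)).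
apply: (eq_null _ (null_div e0 ea b1 cut C1P)) => x.
congr (_ + _).
  rewrite -!mulrA; congr (_ * (_ * _)).
  rewrite /xgrad !mulr_sumr -sumrB; apply: eq_bigr => i _; rewrite /Phi.
  move: (partial i w x) (partial i u x) (u x) (w x) (x 0 i) => A B C D E; ring.
have [sx|nsx] := pselect (shell e x); last first.
  have H : ~~ (a <= enorm x <= b).
    by apply/negP => /andP[ax xb]; apply: nsx; apply/shellE/andP; split; lra.
  have -> : eta (enorm x) = 0.
    by case: cut => _ _ eta0; apply/eqP; apply: contraNT H; exact: eta0.
  by rewrite !mul0r.
congr (_ * _); rewrite /laplacian !mulr_sumr -sumrB; apply: eq_bigr => i _.
have [du dw] := ((u1 x sx).1, (w1 x sx).1).
have [du2 dw2] := ((u2 i x sx).1, (w2 i x sx).1).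
have d1 := (C1_onM os u1 (w2 i) sx).1; have d2 := (C1_onM os w1 (u2 i) sx).1.
have d3 : differentiable (fun x => -1 * (w x * partial i u x)) x.
  exact: (differentiableZ (-1) d2).
rewrite (partialD i d1 d3) (partialZ (-1) i d2) (partialM i du dw2) (partialM i dw du2).
move: (partial i (partial i u) x) (partial i (partial i w) x) (partial i u x)
  (partial i w x) (u x) (w x) => A B C D E F; ring.
Qed.

End green.

Section radial_times_homogeneous.
Context {R : realType} {n : nat}.
Variables (q : 'rV[R]_n -> R) (d : nat).
Hypothesis q2 : C2_on setT q.
Hypothesis q_euler : forall x, xgrad q x = d%:R * q x.
Implicit Types (x y : 'rV[R]_n) (U : set 'rV[R]_n).

(** When [M = n + 2d - 2] and [q] is a harmonic homogeneous polynomial of degree [d], these are the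
    combinations of [q] and its Kelvin transform. *)
Definition radmul (al be : R) M x := (al + be * (enorm x)^-1 ^+ M) * q x.

Let pos := [set x : 'rV[R]_n | 0 < enorm x].
Let opos : open pos. Proof. exact: (open_enorm_gt 0). Qed.

Lemma C2_on_radial_part (al be : R) M :
  C2_on pos (fun x => al + be * (enorm x)^-1 ^+ M).
Proof.
apply: (@C2_onD _ _ _ (fun=> al) (fun x => be * (enorm x)^-1 ^+ M) opos).
  exact: C2_on_cst.
apply: (@C2_onM _ _ _ (fun=> be) (fun x => (enorm x)^-1 ^+ M) opos).
  exact: C2_on_cst.
exact: (@C2_on_enormVX _ _ _ M opos (fun x h => h)).
Qed.

Lemma C2_on_radmul al be M U : U `<=` pos -> C2_on U (radmul al be M).
Proof.
move=> Upos; apply: (C2_on_sub Upos).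
apply: (C2_onM opos (C2_on_radial_part al be M)).
exact: (C2_on_sub _ q2).
Qed.

Lemma partial_radial_part (al be : R) M x i : pos x ->
  partial i (fun x => al + be * (enorm x)^-1 ^+ M) x =
  be * (- M%:R * (enorm x)^-1 ^+ M.+2 * x 0 i).
Proof.
move=> x0; have dM := ((@C2_on_enormVX _ _ _ M opos (fun x h => h)).1 x x0).1.
rewrite partialD; [|exact: differentiable_cst|exact: (differentiableZ be dM)].
by rewrite partial_cst add0r partialZ// partial_enormVX.
Qed.

Lemma partial_radmul al be M x i : pos x -> partial i (radmul al be M) x =
  be * (- M%:R * (enorm x)^-1 ^+ M.+2 * x 0 i) * q x +
  (al + be * (enorm x)^-1 ^+ M) * partial i q x.
Proof.
move=> x0.
rewrite (partialM i ((C2_on_radial_part al be M).1 x x0).1 (q2.1 x I).1).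
by rewrite partial_radial_part.
Qed.

Lemma xgrad_radmul al be M x : pos x -> xgrad (radmul al be M) x =
  (d%:R * al + (d%:R - M%:R) * be * (enorm x)^-1 ^+ M) * q x.
Proof.
move=> x0; have x1 : enorm x != 0 by rewrite gt_eqF.
rewrite /xgrad; under eq_bigr => i _ do rewrite partial_radmul//.
transitivity (be * (- M%:R * (enorm x)^-1 ^+ M.+2) * q x * dotv x x
   + (al + be * (enorm x)^-1 ^+ M) * xgrad q x).
  rewrite /dotv /xgrad !mulr_sumr -big_split /=; apply: eq_bigr => i _.
  move: (partial i q x) (q x) (x 0 i) ((enorm x)^-1) => A B C D; ring.
rewrite q_euler -sqr_enorm !exprS; move: (enorm x) (q x) x1 => v Q v0.
by field.
Qed.

(** The derivatives of the radial factor contribute be M (M + 2 - n - 2d) |x|^-(M+2) q, which this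
    choice of [M] cancels. *)
Lemma laplacian_radmul al be M x : pos x -> (M + 2 = n + 2 * d)%N ->
  laplacian (radmul al be M) x = (al + be * (enorm x)^-1 ^+ M) * laplacian q x.
Proof.
move=> x0 Md; have x1 : enorm x != 0 by rewrite gt_eqF.
have qpos := C2_on_sub (@subsetT _ pos) q2.
rewrite (laplacianM opos (C2_on_radial_part al be M) qpos x0).
have -> : \sum_i partial i (fun y => al + be * (enorm y)^-1 ^+ M) x * partial i q x =
    be * (- M%:R * (enorm x)^-1 ^+ M.+2) * xgrad q x.
  rewrite /xgrad mulr_sumr; apply: eq_bigr => i _; rewrite partial_radial_part//.
  by rewrite !mulrA.
have -> : laplacian (fun y => al + be * (enorm y)^-1 ^+ M) x =
    be * (- M%:R) * ((enorm x)^-1 ^+ M.+2 * n%:R - M.+2%:R * (enorm x)^-1 ^+ M.+4 * dotv x x).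
  rewrite /laplacian.
  have E i : partial i (partial i (fun y => al + be * (enorm y)^-1 ^+ M)) x =
     be * (- M%:R) * ((enorm x)^-1 ^+ M.+2 + - M.+2%:R * (enorm x)^-1 ^+ M.+4 * (x 0 i * x 0 i)).
    rewrite (@eq_partial _ _ pos _ (fun y => (be * (- M%:R)) * ((enorm y)^-1 ^+ M.+2 * y 0 i)) x i opos _ x0); last first.
      by move=> y y0; rewrite partial_radial_part// !mulrA.
    have d1 := ((@C2_on_enormVX _ _ _ M.+2 opos (fun x h => h)).1 x x0).1.
    have d2 := @differentiable_coord R _ _ x 0 i.
    rewrite (partialZ _ i (differentiableM d1 d2)) (partialM i d1 d2).
    rewrite partial_enormVX// partial_coord eqxx mulr1.
    move: (x 0 i) ((enorm x)^-1) => A B; ring.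
  rewrite (eq_bigr _ (fun i _ => E i)) -mulr_sumr big_split /= sumr_const card_ord.
  rewrite -mulr_sumr -/(dotv x x). by rewrite mulr_natr !mulNr.
have nE : n%:R = (M + 2)%:R - 2 * d%:R :> R by rewrite Md natrD natrM addrK.
rewrite q_euler -sqr_enorm nE natrD -!natr1 !exprS.
move: (enorm x) (q x) (laplacian q x) x1 => v Q L v0.
by field.
Qed.

End radial_times_homogeneous.

(** * Zonal functions *)

Section zonal.
Context {R : realType} {n : nat}.
Implicit Types (a x y : 'rV[R]_n).

Definition zonal a d x : R := dotv a x ^+ d.

Lemma C2_on_dotvl a : C2_on setT (fun x => dotv a x).
Proof.
apply: (C2_on_sum openT) => i.
apply: (@C2_onM _ _ _ (fun=> a 0 i) (fun x => x 0 i) openT).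
  exact: C2_on_cst.
exact: C2_on_coord.
Qed.

Lemma C2_on_zonal a d : C2_on setT (zonal a d).
Proof. exact: (C2_onX d openT (C2_on_dotvl a)). Qed.

Lemma partial_dotvl a x i : partial i (fun y => dotv a y) x = a 0 i.
Proof.
have dc j : differentiable (fun y : 'rV[R]_n => y 0 j) x by exact: differentiable_coord.
rewrite partial_sumr => [|j]; last exact: (differentiableZ (a 0 j) (dc j)).
rewrite (bigD1 i)//= big1 ?addr0 => [|j ji].
  by rewrite (partialZ _ i (dc i)) partial_coord eqxx mulr1.
by rewrite (partialZ _ i (dc j)) partial_coord eq_sym (negPf ji) mulr0.
Qed.

Lemma partial_zonal a d x i :
  partial i (zonal a d) x = d%:R * zonal a d.-1 x * a 0 i.
Proof.
elim: d => [|d IH].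
  rewrite (_ : zonal a 0 = fun=> 1); last by apply/funext => y; rewrite /zonal expr0.
  by rewrite partial_cst !mul0r.
rewrite (_ : zonal a d.+1 = fun y => dotv a y * zonal a d y); last first.
  by apply/funext => y; rewrite /zonal exprS.
rewrite (partialM i ((C2_on_dotvl a).1 x I).1 ((C2_on_zonal a d).1 x I).1).
rewrite partial_dotvl IH /=; case: d {IH} => [|d] /=.
  by rewrite /zonal !expr0; ring.
by rewrite /zonal exprS -[in RHS]natr1; ring.
Qed.

Lemma xgrad_zonal a d x : xgrad (zonal a d) x = d%:R * zonal a d x.
Proof.
rewrite /xgrad; under eq_bigr => i _ do rewrite partial_zonal mulrCA.
rewrite -mulr_sumr (eq_bigr (fun i => a 0 i * x 0 i)); last by move=> i _; rewrite mulrC.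
rewrite -/(dotv a x); case: d => [|d]; first by rewrite !mul0r.
by rewrite /zonal /= exprS -mulrA [_ * dotv a x]mulrC.
Qed.

Lemma laplacian_zonal a d x :
  laplacian (zonal a d) x = (d * d.-1)%:R * zonal a d.-2 x * dotv a a.
Proof.
rewrite /laplacian.
under eq_bigr => i _.
  rewrite (_ : partial i (zonal a d) = fun y => d%:R * a 0 i * zonal a d.-1 y); last first.
    by apply/funext => y; rewrite partial_zonal; ring.
  rewrite (partialZ _ i ((C2_on_zonal a d.-1).1 x I).1) partial_zonal.
  over.
rewrite /dotv mulr_sumr; apply: eq_bigr => i _; rewrite natrM; ring.
Qed.

End zonal.

(** * Orthogonality to zonal functions *)

Section vanishing.
Context {R : realType} {n : nat}.
Implicit Types (a x y : 'rV[R]_n) (u w q : 'rV[R]_n -> R).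

(** The radial component of the field u grad w - w grad u. *)
Definition flux (u w : 'rV[R]_n -> R) x :=
  (enorm x)^-1 * (u x * xgrad w x - w x * xgrad u x).

(** Smallness is measured against [(enorm x)^-1 ^+ n.-1], the flux density of the divergence-free
    radial field, on some annulus for each [del]. *)
Definition flux_small (e : R) (K : 'rV[R]_n -> R) := forall del : R, 0 < del ->
  exists r s : R, [/\ e < r, r < s, s < 1 &
    forall x, r <= enorm x <= s -> `|K x| <= del * (enorm x)^-1 ^+ n.-1].

(** [g] may be singular at 0: at radii below [a > 0] the product is locally zero. *)
Lemma rtestM (a b : R) (psi g : R -> R) : 0 < a -> rtest a b psi ->
  (forall r, 0 < r -> {for r, continuous g}) -> rtest a b (fun r => psi r * g r).
Proof.
move=> a0 [cpsi psi0] cg; split=> [r|r H].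
  have [ra|ar] := ltP r a.
    have E : \near r, psi r * g r = 0.
      near=> s; have sa : s < a by near: s; exact: lt_nbhsl.
      suff -> : psi s = 0 by rewrite mul0r.
      by apply/eqP; apply: contraTT sa => /psi0 /andP[]; rewrite leNgt.
    rewrite /continuous_at (nbhs_singleton E).
    apply: (cvg_trans _ (@cvg_cst _ (0 : R) _ (nbhs r) _)).
    by apply: near_eq_cvg; near=> s; apply/esym; near: s.
  have cgr := cg r (lt_le_trans a0 ar).
  exact: (continuousM (cpsi r) cgr).
by apply: psi0; apply: contraNN H => /eqP ->; rewrite mul0r.
Unshelve. all: by end_near. Qed.

Lemma continuous_radial_part (al be : R) (M : nat) (r : R) : 0 < r ->
  {for r, continuous (fun s : R => al + be * s^-1 ^+ M)}.
Proof.
move=> r0; have r1 : r != 0 by rewrite gt_eqF.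
have c1 : {for r, continuous (fun s : R => s^-1)} by exact: inv_continuous.
have c2 : {for r, continuous (fun s : R => s^-1 ^+ M)}.
  exact: (@continuous_comp _ _ _ (fun s : R => s^-1) (fun t => t ^+ M) r c1 (@exprn_continuous R M _)).
have c3 : {for r, continuous (fun _ : R => be)} by exact: cst_continuous.
have c4 : {for r, continuous (fun _ : R => al)} by exact: cst_continuous.
exact: (continuousD c4 (continuousM c3 c2)).
Qed.

(* Induction on the degree: the Laplacian of [zonal a d] is a multiple of
   [zonal a d.-2], so Green's formula sees it as harmonic.  The two radial
   factors have proportional Wronskian [|x| ^- (n + 2 d - 2)]. *)
Lemma null_zonal e u a (al1 be1 al2 be2 : nat -> R) : 0 <= e -> (2 < n)%N ->
  C2_on (shell e) u -> (forall x, shell e x -> laplacian u x = 0) ->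
  (forall d, al1 d * be2 d != al2 d * be1 d) ->
  (forall d, flux_small e (flux u (radmul (zonal a d) (al1 d) (be1 d) (n + 2 * d - 2)))) ->
  (forall d, flux_small e (flux u (radmul (zonal a d) (al2 d) (be2 d) (n + 2 * d - 2)))) ->
  forall d (a' b : R) (psi : R -> R), e < a' -> a' <= b -> b < 1 -> rtest a' b psi ->
  null (fun x => psi (enorm x) * (u x * zonal a d x)).
Proof.
move=> e0 n2 Cu Lu wr fl1 fl2; have n0 : (0 < n)%N by apply: leq_trans n2.
elim/ltn_ind => d IH.
set M := (n + 2 * d - 2)%N.
have M2 : (M + 2 = n + 2 * d)%N.
  by rewrite /M subnK// (leq_trans (ltnW n2))// leq_addr.
have M0 : (0 < M)%N by rewrite /M subn_gt0 (leq_trans n2)// leq_addr.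
have flux_null al be : flux_small e (flux u (radmul (zonal a d) al be M)) ->
    forall (a' b : R) (psi : R -> R), e < a' -> a' <= b -> b < 1 -> rtest a' b psi ->
    null (fun x => psi (enorm x) * flux u (radmul (zonal a d) al be M) x).
  move=> fl; apply: flux_vanish => // a' b eta psi ea b1 cut.
  have a'0 : 0 < a' by exact: le_lt_trans ea.
  have [cpsi deta eta0] := cut.
  (* An empty interval forces [psi = 0]; it is treated apart because [IH] assumes [a' <= b]. *)
  have [ab|ba] := leP a' b; last first.
    apply: (eq_null _ null0) => x; have [_ psi0] := cutoff_rtest cut.
    have [->|/psi0 /andP[h1 h2]] := eqVneq (psi (enorm x)) 0; first by rewrite mul0r.
    by have := le_lt_trans (le_trans h1 h2) ba; rewrite ltxx.
  have Cw : C2_on (shell e) (radmul (zonal a d) al be M).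
    by apply: C2_on_radmul; [exact: C2_on_zonal|move=> x; exact: shell_gt0].
  have G := null_green e0 ea b1 cut Cu Cw.
  have teta : rtest a' b eta.
    split => // r; apply: differentiable_continuous; apply/derivable1_diffP.
    exact: (@ex_derive _ _ _ _ _ _ _ (deta r)).
  have N2 : null (fun x => eta (enorm x) * (u x * laplacian (radmul (zonal a d) al be M) x)).
    have tg : rtest a' b (fun r => eta r * (al + be * r^-1 ^+ M)).
      apply: (rtestM a'0 teta) => r r0; exact: continuous_radial_part.
    have N : null (fun x => eta (enorm x) * (al + be * (enorm x)^-1 ^+ M) *
        (u x * laplacian (zonal a d) x)).
      have [d2|d2] := ltnP d 2.
        apply: (eq_null _ null0) => x; rewrite laplacian_zonal.
        have -> : (d * d.-1 = 0)%N by case: d d2 {IH M M2 M0 fl Cw G tg} => [|[]].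
        by rewrite !mul0r !mulr0.
      have d2d : (d.-2 < d)%N by case: d d2 {IH M M2 M0 fl Cw G tg} => [|[]].
      apply: (eq_null _ (nullZ ((d * d.-1)%:R * dotv a a) (IH _ d2d a' b _ ea ab b1 tg))).
      by move=> x; rewrite laplacian_zonal; ring.
    apply: (eq_null _ N) => x.
    have [E|/eta0 /andP[ax _]] := eqVneq (eta (enorm x)) 0.
      by rewrite E; move: (laplacian _ x) (laplacian _ x) => L1 L2; rewrite !mul0r.
    have x0 : 0 < enorm x by exact: lt_le_trans ax.
    rewrite (laplacian_radmul (C2_on_zonal a d) (xgrad_zonal a d) al be x0 M2).
    move: (laplacian _ x) (eta _) (al + _) (u x) => L1 L2 L3 L4; ring.
  apply: (eq_null _ (nullD G (nullZ (-1) N2))) => x.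
  rewrite /flux; have [E|/eta0 /andP[ax xb]] := eqVneq (eta (enorm x)) 0.
    rewrite E; move: (laplacian _ x) (laplacian u x) => L1 L2.
    by rewrite !mul0r mulr0 !addr0.
  rewrite Lu; last by apply/shellE/andP; split; lra.
  move: (laplacian _ x) (eta _) (psi _) (u x) (xgrad _ x) (xgrad _ x)
    (radmul _ _ _ _ _) ((enorm x)^-1) => L1 L2 L3 L4 L5 L6 L7 L8; ring.
move=> a' b psi ea ab b1 tpsi; have a'0 : 0 < a' by exact: le_lt_trans ea.
(* Crosswise multiplication by the radial factors eliminates [xgrad u] from the two flux identities
   and leaves W |x|^-(M+1) u times the zonal function; the multipliers [h] also divide by W
   |x|^-(M+1). *)
pose W : R := M%:R * (al1 d * be2 d - al2 d * be1 d).
have W0 : W != 0 by rewrite mulf_neq0// ?subr_eq0 ?wr// pnatr_eq0 -lt0n.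
pose h (al be r : R) := W^-1 * r ^+ M.+1 * (al + be * r^-1 ^+ M).
have ch al be r : 0 < r -> {for r, continuous (h al be)}.
  move=> r0; have c1 := @continuous_radial_part al be M r r0.
  have c2 : {for r, continuous (fun s : R => W^-1 * s ^+ M.+1)}.
    have c3 : {for r, continuous (fun _ : R => W^-1)} by exact: cst_continuous.
    exact: (continuousM c3 (@exprn_continuous R M.+1 r)).
  exact: (continuousM c2 c1).
have t2 := rtestM a'0 tpsi (ch (al2 d) (be2 d)).
have t1 := rtestM a'0 tpsi (ch (al1 d) (be1 d)).
have N1 := flux_null _ _ (fl1 d) a' b _ ea ab b1 t2.
have N2 := flux_null _ _ (fl2 d) a' b _ ea ab b1 t1.
apply: (eq_null _ (nullD N1 (nullZ (-1) N2))) => x.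
have [->|/tpsi.2 /andP[ax xb]] := eqVneq (psi (enorm x)) 0.
  by rewrite !mul0r mulr0 addr0.
have x0 : 0 < enorm x by exact: lt_le_trans ax.
rewrite /flux !(xgrad_radmul (C2_on_zonal a d) (xgrad_zonal a d))//.
rewrite /radmul /h /W; move: W0; rewrite /W.
have : (M%:R : R) != 0 by rewrite pnatr_eq0 -lt0n.
move: (xgrad u x) (u x) (zonal a d x) (psi (enorm x)) (al1 d) (al2 d) (be1 d) (be2 d).
have : enorm x != 0 by rewrite gt_eqF.
rewrite !exprS exprVn; move: (enorm x) => r r1.
have : r ^+ M != 0 by rewrite expf_neq0.
move: (r ^+ M) (M%:R) => rM m rM0 X U Z P A1 A2 B1 B2 m0.
rewrite mulf_eq0 negb_or => /andP[_ w0].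
by field; rewrite rM0 r1 w0 m0.
Qed.

End vanishing.

(** * Recovering a function from its zonal moments *)

Section peak.
Context {R : realType} {n : nat}.
Implicit Types (c x y : 'rV[R]_n) (u : 'rV[R]_n -> R).

Lemma normr_le_enorm x : `|x| <= enorm x.
Proof.
rewrite [leLHS]/Num.Def.normr/= mx_normrE bigmax_le ?enorm_ge0// => -[i j] _ /=.
by rewrite (ord1 i); exact: coord_le_enorm.
Qed.

Lemma dotvDl c x y : dotv (c + x) y = dotv c y + dotv x y.
Proof. by rewrite -big_split; apply: eq_bigr => i _; rewrite mxE mulrDl. Qed.

Lemma dotvZl (k : R) x y : dotv (k *: x) y = k * dotv x y.
Proof. by rewrite /dotv mulr_sumr; apply: eq_bigr => i _; rewrite mxE mulrA. Qed.

Lemma dotvNl x y : dotv (- x) y = - dotv x y.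
Proof. by rewrite -scaleN1r dotvZl mulN1r. Qed.

Lemma dotvDr c x y : dotv y (c + x) = dotv y c + dotv y x.
Proof. by rewrite dotvC dotvDl !(dotvC y). Qed.

Lemma dotvZr (k : R) x y : dotv y (k *: x) = k * dotv y x.
Proof. by rewrite dotvC dotvZl dotvC. Qed.

Lemma dotvNr x y : dotv y (- x) = - dotv y x.
Proof. by rewrite dotvC dotvNl dotvC. Qed.

Unset Implicit Arguments.
Lemma compact_annulus (r s : R) : compact [set x : 'rV[R]_n | r <= enorm x <= s].
Proof.
apply: bounded_closed_compact.
  exists s; split; first exact: num_real.
  move=> t st x /= /andP[_ xs].
  by apply: le_trans (normr_le_enorm x) _; apply: le_trans xs _; exact: ltW.
have -> : [set x : 'rV[R]_n | r <= enorm x <= s] =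
    ~` ([set x | enorm x < r] `|` [set x | s < enorm x]).
  apply/seteqP; split => x /=.
    by move=> /andP[h1 h2] [/=|/=]; rewrite ltNge ?h1 ?h2.
  by move=> /not_orP[] /= /negP; rewrite -leNgt => -> /negP; rewrite -leNgt => ->.
by apply: open_closedC; apply: openU; [exact: open_enorm_lt|exact: open_enorm_gt].
Qed.
Set Implicit Arguments.

(** For a unit vector [c] this is (1 + cos) / 2 of the angle between [c] and [x]: away from the
    origin it lies in [[0, 1]] and equals 1 only on the ray through [c]. *)
Definition cap c x : R := (1 + dotv c x * (enorm x)^-1) / 2.

(** Binomial expansion of the power; the factors [(enorm x)^-1 ^+ i] are absorbed into the radial
    weight. *)
Lemma null_cap u c (e : R) m : 0 <= e ->
  (forall d (a b : R) psi, e < a -> a <= b -> b < 1 -> rtest a b psi ->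
    null (fun x => psi (enorm x) * (u x * zonal c d x))) ->
  forall (a b : R) psi, e < a -> a <= b -> b < 1 -> rtest a b psi ->
    null (fun x => psi (enorm x) * u x * cap c x ^+ m).
Proof.
move=> e0 H a b psi ea ab b1 tpsi; have a0 : 0 < a by exact: le_lt_trans ea.
have N (i : 'I_m.+1) : null (fun x => 2^-1 ^+ m * 'C(m, i)%:R *
    (psi (enorm x) * (0 + 1 * (enorm x)^-1 ^+ i) * (u x * zonal c i x))).
  apply: nullZ; apply: (H i a b (fun r => psi r * (0 + 1 * r^-1 ^+ i)) ea ab b1).
  apply: (rtestM a0 tpsi) => r r0; exact: continuous_radial_part.
apply: (eq_null _ (null_sum N)) => x.
rewrite /cap exprMn exprDn mulr_suml mulr_sumr; apply: eq_bigr => i _.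
rewrite expr1n mul1r exprMn /zonal -mulr_natr; ring.
Qed.

(** Law of cosines. It converts bounds on [1 - cap] and on the difference of the norms into a bound
    on the distance, and conversely. *)
Lemma cap_dist x y : 0 < enorm x -> 0 < enorm y ->
  dotv (x - y) (x - y) = (enorm x - enorm y) ^+ 2
    + 4 * (enorm x * enorm y) * (1 - cap ((enorm y)^-1 *: y) x).
Proof.
move=> x0 y0; rewrite /cap dotvZl !(dotvDl, dotvDr, dotvNl, dotvNr) -!sqr_enorm.
rewrite (dotvC x y); field; by rewrite !gt_eqF.
Qed.

Lemma enorm_unit x : 0 < enorm x -> dotv ((enorm x)^-1 *: x) ((enorm x)^-1 *: x) = 1.
Proof. by move=> x0; rewrite dotvZl dotvZr -sqr_enorm; field; rewrite gt_eqF. Qed.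

Lemma cap_itv x y : 0 < enorm x -> 0 < enorm y ->
  0 <= cap ((enorm y)^-1 *: y) x <= 1.
Proof.
move=> x0 y0; pose c := (enorm y)^-1 *: y; pose d := (enorm x)^-1 *: x.
have cc : dotv c c = 1 by exact: enorm_unit.
have dd : dotv d d = 1 by exact: enorm_unit.
have -> : cap c x = (1 + dotv c d) / 2 by rewrite /cap dotvZr [_^-1 * _]mulrC.
have := dotv_ge0 (c - d); have := dotv_ge0 (c + d).
rewrite !(dotvDl, dotvDr, dotvNl, dotvNr) cc dd (dotvC d c).
by move=> h1 h2; apply/andP; split; lra.
Qed.

Lemma enorm0_eq x : enorm x = 0 -> x = 0.
Proof.
move=> xe; apply/rowP => i; rewrite mxE; apply/eqP; rewrite -normr_le0 -xe.
exact: coord_le_enorm.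
Qed.

(** A box is used because its lattice points can be counted. The factor [enorm x0] in its size turns
    distance into angle through [cap_dist], and the division by [n] pays for passing from
    coordinates to the Euclidean norm. *)
Lemma in_box_cap x0 x (del : R) : (0 < n)%N -> 0 < enorm x0 -> enorm x0 < 1 ->
  0 < del -> del <= enorm x0 -> in_box x0 (enorm x0 * del / (4 * n%:R)) x ->
  [/\ 0 < enorm x, `|enorm x - enorm x0| <= del / 4, enorm (x - x0) <= del / 4
    & 1 - del ^+ 2 / 32 <= cap ((enorm x0)^-1 *: x0) x].
Proof.
move=> n0 r0p r01 del0 delr /forallP bx; set c0 := _ *: x0.
have dx : dotv (x - x0) (x - x0) <= enorm x0 ^+ 2 * del ^+ 2 / 16.
  have nR : 1 <= n%:R :> R by rewrite ler1n.
  set rho := enorm x0 * del / _ in bx.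
  have rho0 : 0 <= rho by rewrite divr_ge0 ?mulr_ge0// ltW.
  apply: (@le_trans _ _ (\sum_(i < n) rho ^+ 2)).
    apply: ler_sum => i _; rewrite !mxE -expr2 -[_ ^+ 2]real_normK ?num_real//.
    by rewrite lerXn2r ?nnegrE.
  rewrite sumr_const card_ord.
  have -> : rho ^+ 2 *+ n = enorm x0 ^+ 2 * del ^+ 2 / 16 / n%:R.
    by rewrite -[LHS]mulr_natr /rho; field; rewrite gt_eqF// ltr0n.
  rewrite ler_pdivrMr ?ltr0n//.
  by rewrite ler_peMr// divr_ge0// mulr_ge0// exprn_ge0// ltW.
move: bx => _.
have dx1 : dotv (x - x0) (x - x0) <= (del / 4) ^+ 2.
  apply: le_trans dx _.
  have -> : (del / 4) ^+ 2 = 1 * del ^+ 2 / 16 by field.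
  by rewrite ler_pM2r// ler_pM2r ?exprn_gt0// expr_le1// ltW.
have d4 : 0 <= del / 4 by rewrite divr_ge0// ltW.
have exx : enorm (x - x0) <= del / 4.
  by rewrite -ler_sqr ?nnegrE ?enorm_ge0// sqr_enorm.
have xp : 0 < enorm x.
  rewrite lt_neqAle enorm_ge0 andbT; apply: contraTneq dx1 => /esym/enorm0_eq ->.
  rewrite sub0r dotvNl dotvNr opprK -sqr_enorm -ltNge.
  by rewrite ltr_sqr ?nnegrE ?enorm_ge0//; lra.
have /andP[cp0 cp1] := cap_itv xp r0p.
have dE := cap_dist xp r0p; rewrite -/c0 in cp0 cp1 dE.
have q0 : 0 <= 4 * (enorm x * enorm x0) * (1 - cap c0 x).
  by rewrite mulr_ge0 ?subr_ge0// mulr_ge0// mulr_ge0 ?enorm_ge0.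
have rr : `|enorm x - enorm x0| <= del / 4.
  by rewrite -ler_sqr ?nnegrE// real_normK ?num_real//; lra.
split=> //.
have xr : enorm x0 <= 2 * enorm x by move: rr; rewrite ler_norml => /andP[]; lra.
have h1 : 2 * enorm x0 ^+ 2 * (1 - cap c0 x) <= 4 * (enorm x * enorm x0) * (1 - cap c0 x).
  apply: ler_wpM2r; first by rewrite subr_ge0.
  rewrite (_ : 4 * _ = 2 * (2 * enorm x) * enorm x0); last by ring.
  by rewrite expr2 mulrA ler_pM2r// ler_pM2l.
have sq : 0 <= (enorm x - enorm x0) ^+ 2 by exact: sqr_ge0.
have h2 : enorm x0 ^+ 2 * (2 * (1 - cap c0 x)) <= enorm x0 ^+ 2 * (del ^+ 2 / 16).
  rewrite mulrCA !mulrA in dx *; lra.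
by rewrite ler_pM2l ?exprn_gt0// in h2; lra.
Qed.

Lemma cap_near x0 x (del : R) : 0 < enorm x0 -> enorm x0 < 1 -> 0 < enorm x ->
  enorm x < 1 -> 0 < del -> `|enorm x - enorm x0| <= del / 2 ->
  1 - del ^+ 2 / 16 <= cap ((enorm x0)^-1 *: x0) x -> enorm (x - x0) < del.
Proof.
move=> r0p r01 xp x1 del0 rr; have /andP[cp0 cp1] := cap_itv xp r0p.
have dE := cap_dist xp r0p; set c0 := _ *: x0 in cp0 cp1 dE * => cx.
rewrite -ltr_sqr ?nnegrE ?enorm_ge0 ?(ltW del0)// sqr_enorm dE.
have h1 : (enorm x - enorm x0) ^+ 2 <= (del / 2) ^+ 2.
  by rewrite -[leLHS]real_normK ?num_real// ler_sqr ?nnegrE// divr_ge0// ltW.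
have h2 : 4 * (enorm x * enorm x0) * (1 - cap c0 x) <= 4 * (1 * 1) * (del ^+ 2 / 16).
  apply: ler_pM; rewrite ?subr_ge0//; last lra.
    by rewrite mulr_ge0// mulr_ge0 ?enorm_ge0.
  by rewrite ler_pM2l//; apply: ler_pM; rewrite ?enorm_ge0 ?ltW.
have -> : del ^+ 2 = (del / 2) ^+ 2 + 4 * (1 * 1) * (del ^+ 2 / 16) + del ^+ 2 / 2.
  by field.
have d2 : 0 < del ^+ 2 by rewrite exprn_gt0.
lra.
Qed.

Lemma geometric_domination (th0 th1 B K : R) : 0 < th0 -> th0 < th1 -> 0 <= B ->
  0 < K -> exists m, B * th0 ^+ m <= K * th1 ^+ m.
Proof.
move=> th00 th01 B0 K0; have th1p : 0 < th1 by exact: lt_trans th01.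
have q1 : `|th0 / th1| < 1.
  by rewrite ger0_norm ?divr_ge0 ?ltW// ltr_pdivrMr// mul1r.
have B1 : 0 < B + 1 by rewrite ltr_wpDl.
have /cvgr0Pnorm_le/(_ _ (divr_gt0 K0 B1))/filter_ex[m] := cvg_expr q1.
rewrite ger0_norm; last by rewrite exprn_ge0// divr_ge0// ltW.
rewrite ler_pdivlMr// exprMn exprVn mulrAC ler_pdivrMr ?exprn_gt0// => hm.
exists m; apply: le_trans hm; rewrite mulrC ler_wpM2l ?exprn_ge0 ?lerDl// ltW//.
Qed.

(* Powers of [cap c] peak at the points of the ray through [c]; with a radial
   weight supported near |x0| they isolate a neighbourhood of x0. *)
Lemma zonal_dense u (e : R) : 0 <= e ->
  (forall x, shell e x -> {for x, continuous u}) ->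
  (forall c d (a b : R) psi, e < a -> a <= b -> b < 1 -> rtest a b psi ->
    null (fun x => psi (enorm x) * (u x * zonal c d x))) ->
  forall x, shell e x -> u x = 0.
Proof.
move=> e0 cu H x0 sx0; apply/eqP; apply: contraT => ux0.
(* The constant factor [u x0] makes the value at [x0] positive whatever the sign of [u x0]. *)
pose v x := u x0 * u x; have vx0 : 0 < v x0 by rewrite /v -expr2 exprn_even_gt0.
have cv x : shell e x -> {for x, continuous v}.
  move=> /cu cux; have cc : {for x, continuous (fun=> u x0)} by exact: cst_continuous.
  exact: (continuousM cc cux).
have /shellE/andP[er r1] := sx0; set r0 := enorm x0 in er r1.
have r0p : 0 < r0 by exact: le_lt_trans er.
have [del [del0 delr dele del1 Hdel]] : exists del : R, [/\ 0 < del, del <= r0,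
    e < r0 - del, r0 + del < 1 &
    forall x, enorm (x - x0) < del -> v x0 / 2 <= v x].
  have /cvgrPdist_le/(_ (v x0 / 2)) := cv _ sx0.
  rewrite divr_gt0// => /(_ isT) /nbhs_ballP[d1 /= d10 Hd].
  pose d := Num.min d1 (Num.min ((r0 - e) / 2) ((1 - r0) / 2)).
  have dd1 : d <= d1 by rewrite ge_min lexx.
  have dd2 : d <= (r0 - e) / 2 by rewrite !ge_min lexx orbT.
  have dd3 : d <= (1 - r0) / 2 by rewrite !ge_min lexx !orbT.
  exists d; split; [|lra..|].
    by rewrite !lt_min d10; apply/andP; split; lra.
  move=> x xd; have /Hd : ball x0 d1 x.
    rewrite -ball_normE /= -normrN opprB.
    by apply: le_lt_trans (normr_le_enorm _) _; exact: lt_le_trans dd1.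
  by rewrite /= ler_norml => /andP[_]; lra.
pose a := r0 - del / 2; pose b := r0 + del / 2.
have [ea [ab b1]] : e < a /\ a < b /\ b < 1 by rewrite /a /b; split; [|split]; lra.
have a0 : 0 < a by exact: le_lt_trans ea.
pose psi := hat a b; have tpsi : rtest a b psi by exact: rtest_hat (ltW ab).
have [Bd Bd0 HBd] : exists2 Bd, 0 <= Bd & forall x, `|psi (enorm x) * v x| <= Bd.
  pose A := [set x : 'rV[R]_n | a <= enorm x <= b].
  have Ax0 : A x0 by rewrite /A /= -/r0 /a /b; apply/andP; split; lra.
  have cf : {within A, continuous (fun x => `|psi (enorm x) * v x|)}.
    apply: continuous_in_subspaceT => x; rewrite inE => /andP[ax xb].
    have sx : shell e x by apply/shellE/andP; split; lra.
    have c1 := continuous_comp (@enorm_continuous R n x) (tpsi.1 (enorm x)).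
    have c2 := continuousM c1 (cv x sx).
    exact: (continuous_comp c2 (@norm_continuous _ R _)).
  have [c _ cP] := @EVT_max_rV R n _ A (ex_intro _ x0 Ax0) (compact_annulus a b) cf.
  exists `|psi (enorm c) * v c|; first exact: normr_ge0.
  move=> x; have [->|/tpsi.2 xab] := eqVneq (psi (enorm x)) 0.
    by rewrite mul0r normr0.
  by apply: cP; rewrite inE.
pose c0 := r0^-1 *: x0.
(* On the support of [psi], [cap >= th0] forces [x] into the ball of radius [del], where [v] is
   positive; on the small box, [cap >= th1]. Large powers amplify the gap between [th0] and
   [th1]. *)
pose th0 : R := 1 - del ^+ 2 / 16; pose th1 : R := 1 - del ^+ 2 / 32.
have dd : del ^+ 2 <= 1.
  by rewrite expr_le1//; lra.
have d2 : 0 < del ^+ 2 by rewrite exprn_gt0.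
have th00 : 0 < th0 by rewrite /th0; lra.
have th01 : th0 < th1 by rewrite /th0 /th1; lra.
have n0 : (0 < n)%N.
  rewrite lt0n; apply: contraTneq vx0 => n0; rewrite -leNgt.
  suff : r0 = 0 by move: r0p => /[swap] ->; rewrite ltxx.
  rewrite /r0 /enorm /dotv big1 ?sqrtr0// => i _.
  by have := ltn_ord i; rewrite {2}n0.
pose rho := r0 * del / (4 * n%:R).
have rho0 : 0 < rho by rewrite divr_gt0 ?mulr_gt0// ltr0n.
have rho_le : rho <= del / 4.
  rewrite /rho ler_pdivrMr ?mulr_gt0 ?ltr0n//.
  have -> : del / 4 * (4 * n%:R) = del * n%:R by field.
  rewrite [r0 * _]mulrC ler_pM2l//; apply: le_trans (ltW r1) _; by rewrite ler1n.
pose kap := (del / 4) ^+ 2 * (v x0 / 2).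
have kap0 : 0 < kap by rewrite mulr_gt0 ?exprn_gt0// divr_gt0.
have th1p : 0 < th1 by exact: lt_trans th01.
(* A guaranteed gain on the box, and at worst a loss of [Bd * th0 ^+ m] elsewhere. *)
have lower m x : kap * th1 ^+ m * (in_box x0 rho x)%:R - Bd * th0 ^+ m <=
    psi (enorm x) * v x * cap c0 x ^+ m.
  have Bm : 0 <= Bd * th0 ^+ m by rewrite mulr_ge0// exprn_ge0// ltW.
  have [xb|xb] := boolP (in_box x0 rho x).
    have [xp rr exx capx] := in_box_cap n0 r0p r1 del0 delr xb.
    have vx : v x0 / 2 <= v x.
      by apply: Hdel; apply: le_lt_trans exx _; rewrite ltr_pdivrMr// ltr_pMr// ltr1n.
    have psix : (del / 4) ^+ 2 <= psi (enorm x).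
      apply: hat_ge; first by rewrite divr_ge0// ltW.
      move: rr; rewrite ler_norml /a /b -/r0 => /andP[rr1 rr2].
      by clear -rr1 rr2; apply/andP; split; lra.
    apply: (@le_trans _ _ (kap * th1 ^+ m)); first by rewrite mulr1 gerBl.
    apply: ler_pM; [exact: ltW|by rewrite exprn_ge0// ltW| |].
      by apply: ler_pM; rewrite ?exprn_ge0 ?divr_ge0// ltW.
    by rewrite lerXn2r ?nnegrE ?(ltW th1p)//; apply: le_trans capx; exact: ltW.
  rewrite mulr0 sub0r; have [->|/tpsi.2 /andP[ax xb']] := eqVneq (psi (enorm x)) 0.
    by rewrite !mul0r oppr_le0.
  have xp : 0 < enorm x by exact: lt_le_trans ax.
  have /andP[cp0 cp1] := cap_itv xp r0p; rewrite -/r0 -/c0 in cp0 cp1.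
  have [cx|cx] := leP th0 (cap c0 x).
    have vx : v x0 / 2 <= v x.
      apply: Hdel; apply: cap_near => //; first exact: le_lt_trans b1.
      rewrite ler_norml -/r0; move: ax xb'; rewrite /a /b; clear => ax xb.
      by apply/andP; split; lra.
    have vx1 : 0 <= v x by apply: le_trans vx; rewrite divr_ge0// ltW.
    apply: (@le_trans _ _ 0); first by rewrite oppr_le0.
    by rewrite mulr_ge0 ?exprn_ge0// mulr_ge0 ?hat_ge0.
  rewrite -[leRHS]opprK lerN2; apply: le_trans (ler_norm _) _.
  rewrite normrN normrM; apply: ler_pM => //.
  by rewrite ger0_norm ?exprn_ge0// lerXn2r ?nnegrE// ltW.
have C0 : 0 < kap * rho ^+ n / 2 by rewrite divr_gt0// mulr_gt0// exprn_gt0.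
have B0 : 0 <= Bd * 3 ^+ n by rewrite mulr_ge0// exprn_ge0.
(* The power is fixed so that the total loss is at most half of the gain; only afterwards is the
   mesh made small. *)
have [m Hm] := geometric_domination th00 th01 B0 C0.
have k0 : 0 < kap * rho ^+ n / 2 * th1 ^+ m by rewrite mulr_gt0// exprn_gt0.
have N0 : null (fun x => psi (enorm x) * v x * cap c0 x ^+ m).
  apply: (eq_null _ (nullZ (u x0) (null_cap m e0 (H c0) ea (ltW ab) b1 tpsi))) => x.
  by rewrite /v; ring.
have /cvgr0Pnorm_lt/(_ _ k0) N1 := N0.
have /cvgr0Pnorm_le/(_ _ rho0) N2 := @mesh_cvg0 R.
have [N [Nlt Nm]] := filter_ex (filterI N1 N2).
have {}Nm : mesh N <= rho by apply: le_trans Nm; exact: ler_norm.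
suff : kap * rho ^+ n / 2 * th1 ^+ m <=
    rsum N (fun x => psi (enorm x) * v x * cap c0 x ^+ m).
  move=> h; have := lt_le_trans Nlt h.
  by rewrite ltNge ler_norm.
apply: (@le_trans _ _ (rsum N (fun x => kap * th1 ^+ m * (in_box x0 rho x)%:R
    - Bd * th0 ^+ m))); last by apply: ler_rsum => x _; exact: lower.
rewrite rsumB rsumZ.
have R1 : rho ^+ n <= rsum N (fun x => (in_box x0 rho x)%:R).
  apply: rsum_box_ge => // k; apply: le_trans (lerD (coord_le_enorm x0 k) rho_le) _.
  rewrite -/r0; clear -del1 del0; lra.
have R2 : rsum N (fun _ : 'rV[R]_n => Bd * th0 ^+ m) <= Bd * 3 ^+ n * th0 ^+ m.
  apply: le_trans (ler_norm _) _; rewrite mulrAC [leRHS]mulrC.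
  by apply: ler_norm_rsum => x _; rewrite ger0_norm// mulr_ge0// exprn_ge0// ltW.
have R3 : kap * th1 ^+ m * rho ^+ n <= kap * th1 ^+ m * rsum N (fun x => (in_box x0 rho x)%:R).
  by rewrite ler_pM2l// mulr_gt0// exprn_gt0.
have R4 : kap * th1 ^+ m * rho ^+ n = kap * rho ^+ n / 2 * th1 ^+ m +
  kap * rho ^+ n / 2 * th1 ^+ m by field.
clear -R2 R3 R4 Hm; lra.
Qed.

End peak.

(** * Boundaries and normals *)

Section boundaries.
Context {R : realType} {n : nat}.
Implicit Types (x y v p nu : 'rV[R]_n) (e s t : R).

Lemma enormZ t x : enorm (t *: x) = `|t| * enorm x.
Proof.
by rewrite /enorm dotvZl dotvZr mulrA -expr2 sqrtrM ?sqr_ge0// sqrtr_sqr.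
Qed.

Lemma enormN x : enorm (- x) = enorm x.
Proof. by rewrite /enorm dotvNl dotvNr opprK. Qed.

Lemma enorm0 : enorm (0 : 'rV[R]_n) = 0.
Proof. by rewrite -(scale0r 0) enormZ normr0 mul0r. Qed.

Lemma scale_cvg x t0 : (t *: x) @[t --> t0] --> t0 *: x.
Proof. exact: cvgZr_tmp. Qed.

Lemma closure_ray (A : set 'rV[R]_n) x (F : set_system R) {FF : ProperFilter F} :
  (F --> (1 : R)) -> (\forall t \near F, A (t *: x)) -> closure A x.
Proof.
move=> F1 FA B Bx.
have : \forall t \near F, B (t *: x).
  by apply: F1; have := @scale_cvg x 1; rewrite scale1r; apply.
by move=> FB; have [t [tA tB]] := filter_ex (filterI FA FB); exists (t *: x).
Qed.

Lemma closed_enorm_le s : closed [set x : 'rV[R]_n | enorm x <= s].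
Proof.
rewrite (_ : mkset _ = ~` [set x | s < enorm x]).
  by apply: open_closedC; exact: open_enorm_gt.
by apply/seteqP; split=> x /=; [move=> h; apply/negP; rewrite -leNgt|
  move=> /negP; rewrite -leNgt].
Qed.

Lemma closed_enorm_ge s : closed [set x : 'rV[R]_n | s <= enorm x].
Proof.
rewrite (_ : mkset _ = ~` [set x | enorm x < s]).
  by apply: open_closedC; exact: open_enorm_lt.
by apply/seteqP; split=> x /=; [move=> h; apply/negP; rewrite -leNgt|
  move=> /negP; rewrite -leNgt].
Qed.

Lemma at_left_1 : (1 : R)^'- --> (1 : R).
Proof. exact: cvg_at_left_filter cvg_id. Qed.

Lemma at_right_1 : (1 : R)^'+ --> (1 : R).
Proof. exact: cvg_at_right_filter cvg_id. Qed.

Lemma closure_eball : closure (@eball R n 1) = [set x | enorm x <= 1].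
Proof.
apply/seteqP; split => x /=.
  move=> xcl; have := @closed_enorm_le 1 x; apply.
  by apply: closure_subset xcl => y; exact: ltW.
move=> x1; apply: (closure_ray at_left_1); near=> t.
have t0 : 0 < t by near: t; exact: nbhs_left_gt.
have t1 : t < 1 by near: t; exact: nbhs_left_lt.
rewrite /eball /= enormZ gtr0_norm//.
by apply: le_lt_trans t1; rewrite ler_piMr// ltW.
Unshelve. all: by end_near. Qed.

Lemma closure_shell e : 0 < e < 1 ->
  closure (@shell R n e) = [set x | e <= enorm x <= 1].
Proof.
move=> /andP[e0 e1]; apply/seteqP; split => x /=.
  move=> xcl; apply/andP; split.
    have := @closed_enorm_ge e x; apply; apply: closure_subset xcl.
    by move=> y /shellE/andP[/ltW].
  have := @closed_enorm_le 1 x; apply; apply: closure_subset xcl.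
  by move=> y /shellE/andP[_ /ltW].
move=> /andP[]; rewrite le_eqVlt => /predU1P[ex _|ex x1].
  apply: (closure_ray at_right_1); near=> t.
  have t1 : 1 < t by near: t; exact: nbhs_right_gt.
  have t2 : t < e^-1 by near: t; apply: nbhs_right_lt; rewrite invf_gt1.
  apply/shellE; rewrite enormZ -ex gtr0_norm ?(lt_trans ltr01 t1)//.
  by rewrite ltr_pMl// t1 /= -ltr_pdivlMr// mul1r.
have xp : 0 < enorm x by exact: lt_trans ex.
have h : e / enorm x < 1 by rewrite ltr_pdivrMr// mul1r.
apply: (closure_ray at_left_1); near=> t.
have t0 : 0 < t by near: t; exact: nbhs_left_gt.
have t1 : t < 1 by near: t; exact: nbhs_left_lt.
have t2 : e / enorm x < t by near: t; exact: nbhs_left_gt.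
apply/shellE; rewrite enormZ gtr0_norm// -ltr_pdivrMr// t2 /=.
by apply: lt_le_trans x1; rewrite gtr_pMl.
Unshelve. all: by end_near. Qed.

Lemma boundary_eball : boundary (@eball R n 1) = [set x | enorm x = 1].
Proof.
rewrite /boundary closure_eball ((interior_id _).1 (open_enorm_lt 1)).
apply/seteqP; split => x /=.
  by move=> [x1 /negP]; rewrite /eball /= -leNgt => x2; apply/le_anti/andP.
by move=> ->; split=> //; rewrite /eball /= ltxx.
Qed.

Lemma boundary_shell e : 0 < e < 1 -> boundary (@shell R n e) =
  [set x | enorm x = 1] `|` [set x | enorm x = e].
Proof.
move=> e01; have /andP[e0 e1] := e01.
rewrite /boundary closure_shell// ((interior_id _).1 (open_shell e)).
apply/seteqP; split => x /=.
  move=> [/andP[h1 h2] /shellE/negP]; rewrite negb_and -!leNgt => /orP[h|h].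
    by right; apply/le_anti/andP.
  by left; apply/le_anti/andP.
move=> [xe|xe]; (split; first by rewrite xe lexx ?andbT /= ltW).
  by move/shellE; rewrite xe ltxx andbF.
by move/shellE; rewrite xe ltxx.
Qed.

End boundaries.

(** * Outward unit normals *)

Section normals.
Context {R : realType} {n : nat}.
Implicit Types (x y v p nu : 'rV[R]_n) (e s t : R) (Om : set 'rV[R]_n).

(* [p] is orthogonal to the half-space of directions entering [Om], so it is a
   positive multiple of the gradient of any defining function. *)
Lemma normal_unique Om x nu p : outward_unit_normal Om x nu -> 0 < enorm p ->
  (forall v, (\forall t \near (0 : R)^'+, Om (x + t *: v)) -> dotv p v <= 0) ->
  nu = (enorm p)^-1 *: p.
Proof.
move=> [U [phi [[oU Ux] C1 Omphi [phix gx] ->]]] p0 Hp.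
set g := grad phi x in gx *.
have g0 : 0 < enorm g.
  rewrite lt_neqAle enorm_ge0 andbT eq_sym; apply: contraNneq gx => /enorm0_eq ->.
  exact: eqxx.
have dphi := (C1 x Ux).1.
have half v : dotv g v < 0 -> dotv p v <= 0.
  move=> gv; apply: Hp.
  have Dv : 'D_v phi x = dotv g v.
    rewrite D_partial//; apply: eq_bigr => i _.
    by rewrite mulrC /g mxE.
  have : (fun h : R => h^-1 *: ((phi \o shift x) (h *: v) - phi x)) @ 0^' --> dotv g v.
    rewrite -Dv; exact: (@diff_derivable _ _ _ phi x v dphi).
  move=> /cvgr_lt/(_ _ gv) H1.
  have H2 : \forall t \near (0 : R), U (x + t *: v).
    have : (x + t *: v) @[t --> (0 : R)] --> x + 0 *: v.
      by apply: cvgD; [exact: cvg_cst|exact: scale_cvg].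
    by rewrite scale0r addr0; apply; exact: open_nbhs_nbhs.
  rewrite /dnbhs near_withinE in H1.
  near=> t.
  have t0 : 0 < t by near: t; exact: nbhs_right_gt.
  have Ut : U (x + t *: v) by near: t; exact: (@cvg_within R (nbhs (0 : R)) _ _ _ H2).
  apply/(Omphi _ Ut).
  have : t != 0 -> t^-1 *: ((phi \o shift x) (t *: v) - phi x) < 0.
    by near: t; exact: (@cvg_within R (nbhs (0 : R)) _ _ _ H1).
  rewrite gt_eqF// => /(_ isT).
  by rewrite /= phix subr0 [_ + x]addrC /GRing.scale /= pmulr_rlt0 ?invr_gt0.
have gg : 0 < dotv g g by rewrite -sqr_enorm exprn_gt0.
(* [w] is the component of [p] orthogonal to [g]. Every direction [- g + s *: w] enters [Om], so
   taking [s] large forces [w = 0]. *)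
pose c := dotv p g / dotv g g; pose w := p - c *: g.
have gw : dotv g w = 0.
  rewrite /w dotvDr dotvNr dotvZr /c (dotvC g p) divfK ?subrr// gt_eqF//.
have pw : dotv p w = dotv w w.
  by rewrite {2}/w dotvDl dotvNl dotvZl gw mulr0 subr0.
have hs (s : R) : dotv p (- g + s *: w) <= 0.
  apply: half; rewrite dotvDr dotvNr dotvZr gw mulr0 addr0; lra.
have pg : 0 <= dotv p g.
  by have := hs 0; rewrite scale0r addr0 dotvNr; lra.
have ww : dotv w w = 0.
  apply/eqP; apply: contraT => ww0.
  have wp : 0 < dotv w w by rewrite lt_neqAle eq_sym ww0 dotv_ge0.
  have := hs ((dotv p g + 1) / dotv w w).
  by rewrite dotvDr dotvNr dotvZr pw divfK//; lra.
have w0 : w = 0 by apply: enorm0_eq; rewrite /enorm ww sqrtr0.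
have pE : p = c *: g by apply/eqP; rewrite -subr_eq0 -/w w0.
have c0 : 0 < c.
  rewrite lt_neqAle divr_ge0 ?dotv_ge0// andbT; apply: contraTneq p0 => c0.
  by rewrite pE -c0 scale0r enorm0 ltxx.
rewrite pE enormZ gtr0_norm// scalerA; congr (_ *: _).
by field; rewrite !gt_eqF.
Unshelve. all: by end_near. Qed.

Lemma sqr_enormD x v t :
  enorm (x + t *: v) ^+ 2 = enorm x ^+ 2 + 2 * t * dotv x v + t ^+ 2 * dotv v v.
Proof. rewrite !sqr_enorm !(dotvDl, dotvDr, dotvZl, dotvZr) (dotvC v x); ring. Qed.

(** A direction with [dotv x v > 0] raises the norm above 1 at once, so it cannot enter [Om];
    [normal_unique] then applies with [p = x]. *)
Lemma normal_outer_unique Om x nu : (forall y, Om y -> enorm y < 1) ->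
  enorm x = 1 -> outward_unit_normal Om x nu -> nu = x.
Proof.
move=> Om1 x1 nuP; rewrite (normal_unique nuP (p := x)) ?x1 ?invr1 ?scale1r// => v Ht.
have [t [t0 xt]] := filter_ex (filterI (nbhs_right_gt (0 : R)) Ht).
move/Om1 : xt; rewrite -ltr_sqr ?nnegrE ?enorm_ge0//.
rewrite sqr_enormD x1 => h.
have h2 : 0 <= t ^+ 2 * dotv v v by rewrite mulr_ge0 ?dotv_ge0 ?sqr_ge0.
rewrite leNgt; apply/negP => xv.
have : 0 < 2 * t * dotv x v by rewrite !mulr_gt0.
clear -h h2; lra.
Qed.

Lemma normal_inner_unique Om e x nu : (forall y, Om y -> e < enorm y) -> 0 < e ->
  enorm x = e -> outward_unit_normal Om x nu -> nu = - (e^-1 *: x).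
Proof.
move=> Ome e0 xe nuP; rewrite (normal_unique nuP (p := - x)) ?enormN ?xe ?scalerN// => v Ht.
rewrite dotvNl oppr_le0 leNgt; apply/negP => xv.
(* Below this bound on [t], [2 * dotv x v + t * dotv v v] is negative; the [+ 1] keeps the
   denominator positive. *)
have c0 : 0 < - dotv x v / (dotv v v + 1).
  by rewrite divr_gt0 ?oppr_gt0// ltr_wpDl ?dotv_ge0.
have [t [[t0 t1] xt]] := filter_ex (filterI (filterI (nbhs_right_gt (0 : R))
  (nbhs_right_lt c0)) Ht).
have v1 : 0 < dotv v v + 1 by rewrite ltr_wpDl ?dotv_ge0.
rewrite ltr_pdivlMr// in t1.
move/Ome : xt; rewrite -ltr_sqr ?nnegrE ?enorm_ge0 ?(ltW e0)//.
rewrite sqr_enormD xe => h.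
have : 0 < t * (2 * dotv x v + t * dotv v v).
  have -> : t * (2 * dotv x v + t * dotv v v) = 2 * t * dotv x v + t ^+ 2 * dotv v v by ring.
  by clear -h; lra.
rewrite pmulr_rgt0// => h3; clear -h3 t1 xv t0; lra.
Qed.

Lemma grad_dotv x : grad (fun y => dotv y y) x = 2 *: x.
Proof. by apply/rowP => i; rewrite !mxE partial_dotv. Qed.

Lemma normal_outer_exists Om (U : set 'rV[R]_n) x : open U -> U x -> enorm x = 1 ->
  (forall y, U y -> (Om y <-> enorm y < 1)) -> outward_unit_normal Om x x.
Proof.
move=> oU Ux x1 OmU; pose phi y : R := dotv y y + (-1).
have Cphi : C1_on U phi.
  apply: (@C1_onD _ _ U (fun y => dotv y y) (fun=> -1) oU); last exact: C1_on_cst.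
  exact: (C2_on_dotv oU).1.
have gphi : grad phi x = 2 *: x.
  rewrite -grad_dotv; apply/rowP => i; rewrite !mxE.
  rewrite (partialD i (differentiable_dotv x) (@differentiable_cst R 'rV[R]_n R (-1) x)).
  by rewrite partial_cst addr0.
exists U, phi; split=> //.
- move=> y Uy; rewrite (OmU y Uy) /phi subr_lt0 -sqr_enorm.
  by rewrite expr_lt1// enorm_ge0.
- split; first by rewrite /phi -sqr_enorm x1 expr1n subrr.
  rewrite gphi scaler_eq0 negb_or pnatr_eq0 /=.
  by apply: contra_eqN x1 => /eqP ->; rewrite enorm0 eq_sym oner_eq0.
by rewrite gphi enormZ x1 mulr1 ger0_norm// scalerA mulVf// scale1r.
Qed.

Lemma normal_inner_exists Om (U : set 'rV[R]_n) e x : open U -> U x -> 0 < e ->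
  enorm x = e -> (forall y, U y -> (Om y <-> e < enorm y)) ->
  outward_unit_normal Om x (- (e^-1 *: x)).
Proof.
move=> oU Ux e0 xe OmU; pose phi y : R := -1 * dotv y y + e ^+ 2.
have Cphi : C1_on U phi.
  apply: (@C1_onD _ _ U (fun y => -1 * dotv y y) (fun=> e ^+ 2) oU); last exact: C1_on_cst.
  apply: (@C1_onM _ _ U (fun=> -1) (fun y => dotv y y) oU); first exact: C1_on_cst.
  exact: (C2_on_dotv oU).1.
have gphi : grad phi x = - (2 *: x).
  rewrite -grad_dotv; apply/rowP => i; rewrite !mxE.
  have dx := differentiable_dotv x.
  rewrite (partialD i (differentiableZ (-1) dx) (@differentiable_cst R 'rV[R]_n R (e ^+ 2) x)).
  by rewrite partial_cst addr0 (partialZ _ i dx) mulN1r.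
exists U, phi; split=> //.
- move=> y Uy; rewrite (OmU y Uy) /phi mulN1r addrC subr_lt0 -sqr_enorm.
  by rewrite ltr_sqr// nnegrE ?enorm_ge0 ?ltW.
- split; first by rewrite /phi -sqr_enorm xe mulN1r addNr.
  rewrite gphi oppr_eq0 scaler_eq0 negb_or pnatr_eq0 /=.
  by apply: contraTneq e0 => x0; rewrite -xe x0 enorm0 ltxx.
rewrite gphi enormN enormZ xe ger0_norm// scalerN scalerA.
by congr (- (_ *: _)); field; rewrite gt_eqF.
Qed.

End normals.

(** * Eigenvalues are roots *)

Section boundary_flux.
Context {R : realType} {n : nat}.
Implicit Types (x y : 'rV[R]_n) (k u : 'rV[R]_n -> R) (A : set 'rV[R]_n).

(** [k] is continuous only relative to [A], so compactness is used on the fixed sphere of radius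
    [rho], nearby spheres being reached by the scaling [s / rho]. *)
Lemma uniform_near_sphere A k (rho : R) : 0 < rho -> {within A, continuous k} ->
  (forall x, enorm x = rho -> A x) -> (forall x, enorm x = rho -> k x = 0) ->
  forall del, 0 < del ->
  \forall s \near rho, forall x, enorm x = s -> A x -> `|k x| <= del.
Proof.
move=> rho0 /subspace_continuousP ck Arho k0 del del0.
have /compact_near_coveringP cov := @compact_annulus R n rho rho.
have H : forall y : 'rV[R]_n, rho <= enorm y <= rho ->
    \forall y' \near y & s \near rho, A ((s / rho) *: y') -> `|k ((s / rho) *: y')| <= del.
  move=> y /le_anti/esym yr.
  have /cvgr0Pnorm_le/(_ _ del0) : k z @[z --> within A (nbhs y)] --> 0.
    by rewrite -(k0 y yr); exact: ck (Arho y yr).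
  rewrite near_withinE => Hk.
  have c1 : (z.2 / rho) *: z.1 @[z --> (y, rho)] --> y.
    have -> : nbhs y = nbhs ((rho / rho) *: y) by rewrite divff ?scale1r ?gt_eqF.
    apply: cvgZ; last exact: cvg_fst.
    by apply: cvgMr_tmp; exact: cvg_snd.
  exact: c1 Hk.
have h := cov R (nbhs rho) (fun s y => A ((s / rho) *: y) -> `|k ((s / rho) *: y)| <= del)
  (nbhs_filter _) H.
have sp : \forall s \near rho, 0 < s by exact: lt_nbhsr.
apply: filterS2 sp h => s s0 Hs x xs Ax.
have xE : x = (s / rho) *: ((rho / s) *: x).
  by rewrite scalerA mulrA divfK ?gt_eqF// divff ?gt_eqF// scale1r.
rewrite xE; apply: Hs => /=; last by rewrite -xE.
have -> : enorm ((rho / s) *: x) = rho.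
  by rewrite enormZ xs ger0_norm ?divfK ?gt_eqF// divr_ge0 ?(ltW s0) ?(ltW rho0).
by rewrite lexx.
Qed.

Definition bflux u (G : 'rV[R]_n -> 'rV[R]_n) a d (al be : R) M x : R :=
  u x * ((d%:R * al + (d%:R - M%:R) * be * (enorm x)^-1 ^+ M) * zonal a d x)
  - (al + be * (enorm x)^-1 ^+ M) * zonal a d x * dotv x (G x).

Lemma flux_bflux u G a d al be M x : 0 < enorm x -> G x = grad u x ->
  flux u (radmul (zonal a d) al be M) x = (enorm x)^-1 * bflux u G a d al be M x.
Proof.
move=> x0 Gx; rewrite /flux (xgrad_radmul (C2_on_zonal a d) (xgrad_zonal a d))//.
congr (_ * (_ - _ * _)); rewrite Gx; apply: eq_bigr => i _; by rewrite mxE.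
Qed.

Lemma within_continuousM A (f g : 'rV[R]_n -> R) : {within A, continuous f} ->
  {within A, continuous g} -> {within A, continuous (fun x => f x * g x)}.
Proof. by move=> cf cg x; exact: (continuousM (cf x) (cg x)). Qed.

Lemma within_continuousD A (f g : 'rV[R]_n -> R) : {within A, continuous f} ->
  {within A, continuous g} -> {within A, continuous (fun x => f x + g x)}.
Proof. by move=> cf cg x; exact: (continuousD (cf x) (cg x)). Qed.

Lemma within_continuous_sum A (I : finType) (f : I -> 'rV[R]_n -> R) :
  (forall i, {within A, continuous (f i)}) ->
  {within A, continuous (fun x => \sum_i f i x)}.
Proof.
move=> cf; elim: (index_enum I) => [|i s IH].
  under eq_fun do rewrite big_nil; apply: continuous_subspaceT; exact: cst_continuous.
under eq_fun do rewrite big_cons; exact: within_continuousD.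
Qed.

Lemma continuous_sumr (I : finType) (f : I -> 'rV[R]_n -> R) x :
  (forall i, {for x, continuous (f i)}) ->
  {for x, continuous (fun y => \sum_i f i y)}.
Proof.
move=> cf; elim: (index_enum I) => [|i s IH].
  have -> : (fun y => \sum_(i <- [::]) f i y) = fun=> 0.
    by apply/funext => y; rewrite big_nil.
  exact: cst_continuous.
have -> : (fun y => \sum_(j <- i :: s) f j y) = fun y => f i y + \sum_(j <- s) f j y.
  by apply/funext => y; rewrite big_cons.
exact: (continuousD (cf i) IH).
Qed.

Lemma C2_continuous (U : set 'rV[R]_n) u x : C2_on U u -> U x -> {for x, continuous u}.
Proof. by move=> [C1 _] Ux; exact: (differentiable_continuous (C1 x Ux).1). Qed.

Lemma within_C2 A (U : set 'rV[R]_n) (f : 'rV[R]_n -> R) : C2_on U f -> A `<=` U ->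
  {within A, continuous f}.
Proof.
move=> Cf AU; apply: continuous_in_subspaceT => x; rewrite inE => /AU Ux.
exact: C2_continuous Cf Ux.
Qed.

Lemma within_bflux A u G a d al be M : (forall x, A x -> 0 < enorm x) ->
  {within A, continuous u} -> {within A, continuous G} ->
  {within A, continuous (bflux u G a d al be M)}.
Proof.
move=> A0 cu cG.
have Az : {within A, continuous (zonal a d)}.
  by apply: (within_C2 (C2_on_zonal a d)).
have Ar al' be' : {within A, continuous (fun x => al' + be' * (enorm x)^-1 ^+ M)}.
  exact: (within_C2 (C2_on_radial_part al' be' M)).
have AG : {within A, continuous (fun x => -1 * dotv x (G x))}.
  apply: within_continuousM; first by apply: continuous_subspaceT; exact: cst_continuous.
  apply: within_continuous_sum => i; apply: within_continuousM.
    by apply: continuous_subspaceT; exact: coord_continuous.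
  move=> x; exact: (@continuous_comp (subspace A) _ _ G (fun y : 'rV[R]_n => y 0 i)
    x (cG x) (@coord_continuous R 1 n 0 i _)).
have -> : bflux u G a d al be M = fun x =>
  u x * ((d%:R * al + (d%:R - M%:R) * be * (enorm x)^-1 ^+ M) * zonal a d x)
  + ((al + be * (enorm x)^-1 ^+ M) * zonal a d x) * (-1 * dotv x (G x)).
  by apply/funext => x; rewrite /bflux; ring.
apply: within_continuousD; first exact: within_continuousM cu (within_continuousM (Ar _ _) Az).
exact: within_continuousM (within_continuousM (Ar _ _) Az) AG.
Qed.

(** Continuity keeps [bflux] small on an annulus close to the sphere where it vanishes, and |x|^-1
    <= |x|^-(n-1) because |x| < 1. *)
Lemma flux_small_sphere (e rho : R) A u G a d al be M : (1 < n)%N ->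
  0 <= e -> e < 1 -> 0 < rho -> e <= rho -> rho <= 1 ->
  (forall x, A x -> 0 < enorm x) -> (forall x, enorm x = rho -> A x) ->
  (\forall s \near rho, forall x, enorm x = s -> e < s < 1 -> A x) ->
  (forall x, shell e x -> G x = grad u x) ->
  {within A, continuous u} -> {within A, continuous G} ->
  (forall x, enorm x = rho -> bflux u G a d al be M x = 0) ->
  flux_small e (flux u (radmul (zonal a d) al be M)).
Proof.
move=> n1 e0 e1 rho0 erho rho1 A0 Arho Anear Gu cu cG k0 del del0.
have H := uniform_near_sphere rho0 (within_bflux (al := al) (be := be) A0 cu cG) Arho k0 del0.
have [eta /= eta0 He] := (nbhs_ballP _ _).1 (@filterI _ (nbhs rho) (nbhs_filter _) _ _ Anear H).
pose lo := Num.max e (rho - eta / 2); pose hi := Num.min 1 (rho + eta / 2).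
(* The annulus is the middle third of the radii that are close to [rho] and between [e] and 1, so
   one argument serves a sphere at either end. *)
have lohi : lo < hi.
  by rewrite /lo /hi gt_max !lt_min e1 /=; apply/andP; split; [lra|apply/andP; split; lra].
have [lo1 lo2] : e <= lo /\ rho - eta / 2 <= lo by rewrite /lo !le_max !lexx orbT.
have [hi1 hi2] : hi <= 1 /\ hi <= rho + eta / 2 by rewrite /hi !ge_min !lexx orbT.
move: lo hi lohi lo1 lo2 hi1 hi2 => lo hi lohi lo1 lo2 hi1 hi2.
exists ((2 * lo + hi) / 3), ((lo + 2 * hi) / 3).
clear H Anear; split; [lra|lra|lra|] => x /andP[h1 h2].
have ex : e < enorm x < 1 by apply/andP; split; lra.
have xp : 0 < enorm x by case/andP: ex => ? _; exact: le_lt_trans e0 _.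
have [|An Hn] := He (enorm x).
  by rewrite -ball_normE /= ltr_norml; apply/andP; split; lra.
rewrite (@flux_bflux u G a d al be M x xp (Gu x ((shellE e x).2 ex))).
rewrite normrM ger0_norm ?invr_ge0 ?(ltW xp)// mulrC.
apply: ler_pM; rewrite ?invr_ge0 ?(ltW xp) ?normr_ge0//.
  by apply: Hn => //; exact: An.
rewrite -[leLHS]expr1; apply: ler_weXn2l.
  by rewrite invf_ge1//; case/andP: ex => _ /ltW.
by rewrite -ltnS (prednK (ltnW n1)).
Qed.

End boundary_flux.

Section spectrum_upper.
Context {R : realType} {n : nat}.
Implicit Types (x y : 'rV[R]_n) (u : 'rV[R]_n -> R) (e sigma : R).

(* Its roots in [sigma] are the eigenvalues of the shell carried by spherical
   harmonics of degree [d]. *)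
Definition steklov_poly (e : R) (d : nat) (sigma : R) : R :=
  (d%:R - sigma) * ((n + d)%:R - 2 - sigma * e)
  - e ^+ (n + 2 * d - 2) * (d%:R + sigma * e) * ((n + d)%:R - 2 + sigma).

Lemma degreeM d : (2 < n)%N -> (n + 2 * d - 2)%:R = (n + d)%:R - 2 + d%:R :> R.
Proof.
move=> n2; rewrite natrB; last by rewrite (leq_trans (ltnW n2))// leq_addr.
by rewrite mul2n -addnn !natrD; ring.
Qed.

Lemma shell_eigenvalue_root e sigma : (2 < n)%N -> 0 < e < 1 ->
  steklov_eigenvalue (@shell R n e) sigma -> exists d, steklov_poly e d sigma = 0.
Proof.
move=> n2 e01; have /andP[e0 e1] := e01.
move=> [u [Cu cu [x0 sx0 ux0] Lu [G [cG Gu Gnu]]]].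
apply: contrapT => /forallNP nroot; move/eqP: ux0; apply.
rewrite closure_shell// in cu cG; rewrite boundary_shell// in Gnu.
set A := [set x | e <= enorm x <= 1] in cu cG.
have A0 x : A x -> 0 < enorm x by move=> /andP[h _]; exact: lt_le_trans h.
pose nd d : R := (n + d)%:R - 2.
(* [al1] and [be1] satisfy the Steklov condition on the unit sphere, [al2] and [be2] on the sphere
   of radius [e]; the determinant [al1 d * be2 d - al2 d * be1 d] is [- steklov_poly e d sigma]. *)
pose al1 d := nd d + sigma; pose be1 d := d%:R - sigma.
pose al2 d := nd d - sigma * e.
pose be2 d := e ^+ (n + 2 * d - 2) * (d%:R + sigma * e).
have Anear (rho : R) : \forall s \near rho, forall x, enorm x = s -> e < s < 1 -> A x.
  by near=> s => x xs /andP[h1 h2]; rewrite /A /= xs !ltW.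
have det d : al1 d * be2 d != al2 d * be1 d.
  apply/negP => /eqP h; apply: (nroot d); rewrite /steklov_poly -/(nd d).
  transitivity (al2 d * be1 d - al1 d * be2 d); first by rewrite /al1 /al2 /be1 /be2; ring.
  by rewrite h subrr.
have n1 := ltnW n2.
apply: (zonal_dense (ltW e0) _ _ sx0) => [x sx|c d a b psi ea ab b1 tpsi].
  exact: C2_continuous Cu sx.
apply: (null_zonal (al1 := al1) (be1 := be1) (al2 := al2) (be2 := be2) (ltW e0) n2 Cu Lu det _ _ d ea ab b1 tpsi) => {a b psi ea ab b1 tpsi} {}d.
  apply: (flux_small_sphere (rho := 1) n1 (ltW e0) e1 ltr01 (ltW e1) (lexx _)
    A0 _ (Anear 1) Gu cu cG).
    by move=> x x1; rewrite /A /= x1 lexx ltW.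
  move=> x x1; have [nu nuP] := Gnu x (or_introl x1).
  have -> : nu = x by apply: normal_outer_unique nuP => // y /shellE/andP[].
  rewrite /bflux dotvC => ->; rewrite x1 invr1 expr1n degreeM// -/(nd d).
  by rewrite /al1 /be1; ring.
apply: (flux_small_sphere (rho := e) n1 (ltW e0) e1 e0 (lexx _) (ltW e1)
  A0 _ (Anear e) Gu cu cG).
  by move=> x x1; rewrite /A /= x1 lexx ltW.
move=> x xe; have [nu nuP] := Gnu x (or_intror xe).
have -> : nu = - (e^-1 *: x).
  by apply: normal_inner_unique xe nuP => // y /shellE/andP[].
rewrite dotvC dotvNl dotvZl => hG.
have -> : bflux u G c d (al2 d) (be2 d) (n + 2 * d - 2) x =
  u x * ((d%:R * al2 d + (d%:R - (n + 2 * d - 2)%:R) * be2 d * (enorm x)^-1 ^+ (n + 2 * d - 2))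
     * zonal c d x)
  + (al2 d + be2 d * (enorm x)^-1 ^+ (n + 2 * d - 2)) * zonal c d x * (e * - (e^-1 * dotv x (G x))).
  by rewrite /bflux; field; rewrite gt_eqF.
rewrite hG xe degreeM// /al2 /be2 exprVn -/(nd d).
have : e ^+ (n + 2 * d - 2) != 0 by rewrite expf_neq0// gt_eqF.
move: (e ^+ _) (nd d) (zonal _ _ _) (u x) => eM N Z U eM0.
by field.
Unshelve. all: by end_near. Qed.

(** The inner condition is replaced by regularity at the origin, that is [al2 = 1] and [be2 = 0];
    the determinant becomes [sigma - d]. *)
Lemma ball_eigenvalue_nat sigma : (2 < n)%N ->
  steklov_eigenvalue (@eball R n 1) sigma -> exists d : nat, sigma = d%:R.
Proof.
move=> n2 [u [Cu cu [x0 sx0 ux0] Lu [G [cG Gu Gnu]]]].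
apply: contrapT => /forallNP nroot.
rewrite closure_eball in cu cG; rewrite boundary_eball in Gnu.
have sB x : shell 0 x -> eball 1 x by move=> /shellE/andP[].
have u0 x : shell 0 x -> u x = 0.
  (* A neighbourhood of the unit sphere in the closed ball that stays away from the origin, where
     the radial factors are singular. *)
  move=> sx; pose A := [set x : 'rV[R]_n | 2^-1 <= enorm x <= 1].
  have AB : A `<=` [set x | enorm x <= 1] by move=> y /andP[].
  have cuA := continuous_subspaceW AB cu; have cGA := continuous_subspaceW AB cG.
  have A0 y : A y -> 0 < enorm y by move=> /andP[h _]; apply: lt_le_trans h.
  pose nd d : R := (n + d)%:R - 2.
  pose al1 d := nd d + sigma; pose be1 d := d%:R - sigma.
  have det d : al1 d * 0 != 1 * be1 d.
    by rewrite mulr0 mul1r eq_sym subr_eq0; apply/eqP => h; apply: (nroot d).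
  have n1 := ltnW n2.
  have Cu0 := C2_on_sub sB Cu; have Lu0 y (sy : shell 0 y) := Lu y (sB y sy).
  apply: (zonal_dense (lexx 0) _ _ sx) => [y sy|c d a b psi ea ab b1 tpsi].
    exact: C2_continuous Cu0 sy.
  apply: (null_zonal (al1 := al1) (be1 := be1) (al2 := fun=> 1) (be2 := fun=> 0) (lexx 0) n2 Cu0 Lu0 det
    _ _ d ea ab b1 tpsi) => {a b psi ea ab b1 tpsi} {}d.
    apply: (flux_small_sphere (rho := 1) n1 (lexx 0) ltr01 ltr01 ler01 (lexx _)
      A0 _ _ (fun y sy => Gu y (sB y sy)) cuA cGA).
    - by move=> y y1; rewrite /A /= y1 lexx invf_le1// ler1n.
    - near=> s => y ys /andP[_ s1]; rewrite /A /= ys (ltW s1) andbT ltW//.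
      by near: s; apply: lt_nbhsr; rewrite invf_lt1// ltr1n.
    - move=> y y1; have [nu nuP] := Gnu y y1.
      have -> : nu = y by apply: normal_outer_unique nuP.
      rewrite /bflux dotvC => ->; rewrite y1 invr1 expr1n degreeM// -/(nd d).
      by rewrite /al1 /be1; ring.
  move=> del del0.
  (* [u] and its gradient are continuous at the origin, so the positive power of [enorm y], from
     [n > 2], makes [F] tend to 0. As [be = 0], the exponent [M] may be replaced by 0. *)
  pose F y := enorm y ^+ n.-2 * bflux u (grad u) c d 1 0 0 y.
  have F0 : F 0 = 0.
    rewrite /F enorm0 expr0n; have -> : (n.-2 == 0)%N = false by case: n n2 => [|[|[]]].
    by rewrite mul0r.
  have B0 : eball 1 (0 : 'rV[R]_n) by rewrite /eball /= enorm0.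
  have cF : {for 0, continuous F}.
    have c1 := differentiable_continuous (Cu.1 _ B0).1.
    have c2 := (Cu.1 _ B0).2.
    have c3 := differentiable_continuous ((C2_on_zonal c d).1 0 I).1.
    have c4 : {for 0, continuous (fun y : 'rV[R]_n => enorm y ^+ n.-2)}.
      exact: (continuous_comp (@enorm_continuous R n 0) (@exprn_continuous R n.-2 _)).
    have c5 : {for (0 : 'rV[R]_n), continuous (fun y => dotv y (grad u y))}.
      apply: continuous_sumr => i.
      apply: (@cvgM _ _ (nbhs (0 : 'rV[R]_n)) _ (fun y : 'rV[R]_n => y 0 i)
        (fun y => grad u y 0 i)); first exact: coord_continuous.
      exact: (continuous_comp c2 (@coord_continuous R 1 n 0 i _)).
    have cst1 (k : R) : {for (0 : 'rV[R]_n), continuous (fun=> k)} by exact: cst_continuous.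
    have -> : F = fun y => enorm y ^+ n.-2 * (d%:R * (u y * zonal c d y)
        + -1 * (zonal c d y * dotv y (grad u y))).
      apply/funext => y; rewrite /F /bflux expr0; ring.
    have c6 := continuousM (cst1 d%:R) (continuousM c1 c3).
    have c7 := continuousM (cst1 (-1)) (continuousM c3 c5).
    exact: (continuousM c4 (continuousD c6 c7)).
  have : F y @[y --> (0 : 'rV[R]_n)] --> 0 by rewrite -F0.
  move=> /cvgr0Pnorm_le/(_ _ del0)/nbhs_ballP[r /= r0 Hr].
  pose s := Num.min r 1.
  have [s0 sr s1] : [/\ 0 < s, s <= r & s <= 1].
    by rewrite /s lt_min r0 ltr01 !ge_min !lexx orbT.
  move: s s0 sr s1 => s s0 sr s1.
  exists (s / 3), (s / 2); split; [lra|lra|lra|] => y /andP[y1 y2].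
  have yp : 0 < enorm y by lra.
  have sy : shell 0 y by apply/shellE/andP; split; lra.
  have Fy : `|F y| <= del.
    apply: Hr; rewrite -ball_normE /= sub0r normrN.
    by apply: le_lt_trans (normr_le_enorm y) _; lra.
  rewrite (@flux_bflux _ _ u (grad u) c d 1 0 _ y yp erefl).
  have -> : bflux u (grad u) c d 1 0 (n + 2 * d - 2) y = bflux u (grad u) c d 1 0 0 y.
    by rewrite /bflux !mulr0 !mul0r.
  have -> : (enorm y)^-1 * bflux u (grad u) c d 1 0 0 y = F y * (enorm y)^-1 ^+ n.-1.
    have -> : n.-1 = n.-2.+1 by case: n n2 => [|[|]].
    by rewrite /F exprS exprVn; field; rewrite expf_neq0 gt_eqF.
  rewrite normrM [X in _ * X]ger0_norm ?exprn_ge0 ?invr_ge0 ?(ltW yp)//.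
  by rewrite ler_wpM2r// exprn_ge0 ?invr_ge0 ?(ltW yp).
have [x00|x00] := eqVneq (enorm x0) 0; last first.
  move: ux0; rewrite u0 ?eqxx//; apply/shellE.
  by rewrite lt_neqAle eq_sym x00 enorm_ge0 /=; exact: sx0.
have {}x00 := enorm0_eq x00; subst x0.
(* [u] vanishes off the origin, hence at the origin by continuity. *)
have e1 : enorm (delta_mx 0 (Ordinal (ltnW (ltnW n2))) : 'rV[R]_n) = 1.
  rewrite /enorm /dotv (bigD1 (Ordinal (ltnW (ltnW n2))))//= big1 => [|i ik].
    by rewrite !mxE !eqxx mulr1 addr0 sqrtr1.
  by rewrite !mxE (negPf ik) andbF mulr0.
set v : 'rV[R]_n := delta_mx _ _ in e1.
have : u (t *: v) @[t --> (0 : R)^'+] --> u 0.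
  have h0 : {for (0 : R), continuous (fun t : R => u (t *: v))}.
    apply: (@continuous_comp _ _ _ (fun t : R => t *: v) u); first exact: scale_cvg.
    by rewrite scale0r; exact: C2_continuous Cu sx0.
  have := cvg_at_right_filter h0; by rewrite scale0r.
move=> h; move: ux0; apply/negP; rewrite negbK; apply/eqP.
apply: (@cvg_unique _ (@Rhausdorff R) _ _ _ _ h).
apply: (cvg_trans _ (@cvg_cst _ (0 : R) _ ((0 : R)^'+) _)).
apply: near_eq_cvg; near=> t; rewrite u0//; apply/shellE.
have t0 : 0 < t by near: t; exact: nbhs_right_gt.
have t1 : t < 1 by near: t; exact: nbhs_right_lt.
by rewrite enormZ e1 mulr1 ger0_norm ?(ltW t0)// t0.
Unshelve. all: by end_near. Qed.

End spectrum_upper.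

(** * Roots are eigenvalues *)

Section planar_harmonics.
Context {R : realType} {n : nat}.
Variables i0 i1 : 'I_n.
Hypothesis i01 : i0 != i1.
Implicit Types (x y : 'rV[R]_n) (e sigma : R).

(* Real and imaginary parts of [(x_i0 + i x_i1) ^ d]. *)
Fixpoint planar d : ('rV[R]_n -> R) * ('rV[R]_n -> R) :=
  if d is d'.+1 then
    (fun x => x 0 i0 * (planar d').1 x + -1 * (x 0 i1 * (planar d').2 x),
     fun x => x 0 i0 * (planar d').2 x + x 0 i1 * (planar d').1 x)
  else (fun=> 1, fun=> 0).

Lemma C2_on_planar d : C2_on setT (planar d).1 /\ C2_on setT (planar d).2.
Proof.
have c0 := C2_on_coord (R := R) setT i0; have c1 := C2_on_coord (R := R) setT i1.
elim: d => [|d [IH1 IH2]]; first by split; exact: C2_on_cst.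
split; last exact: (C2_onD openT (C2_onM openT c0 IH2) (C2_onM openT c1 IH1)).
apply: (C2_onD openT (C2_onM openT c0 IH1)).
exact: (C2_onM openT (C2_on_cst _ (-1)) (C2_onM openT c1 IH2)).
Qed.

Let dpl1 d x := ((C2_on_planar d).1.1 x I).1.
Let dpl2 d x := ((C2_on_planar d).2.1 x I).1.

Lemma partial_planar d x i :
  partial i (planar d).1 x =
    d%:R * ((i == i0)%:R * (planar d.-1).1 x - (i == i1)%:R * (planar d.-1).2 x) /\
  partial i (planar d).2 x =
    d%:R * ((i == i0)%:R * (planar d.-1).2 x + (i == i1)%:R * (planar d.-1).1 x).
Proof.
elim: d => [|d [IH1 IH2]]; first by rewrite /= !partial_cst !mul0r.
have d0 := @differentiable_coord R _ _ x 0 i0.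
have d1 := @differentiable_coord R _ _ x 0 i1.
have p1 := dpl1 d x; have p2 := dpl2 d x.
have m1 := differentiableM d0 p1; have m2 := differentiableM d1 p2.
have m3 := differentiableM d0 p2; have m4 := differentiableM d1 p1.
rewrite /= (partialD i m1 (differentiableZ (-1) m2)) (partialZ _ i m2) (partialD i m3 m4).
rewrite (partialM i d0 p1) (partialM i d1 p2) (partialM i d0 p2) (partialM i d1 p1).
rewrite !partial_coord IH1 IH2; case: d {IH1 IH2 p1 p2 m1 m2 m3 m4} => [|d] /=.
  by rewrite !mul0r !mulr0; split; ring.
rewrite -!natr1; move: ((planar d).1 x) ((planar d).2 x) (x 0 i0) (x 0 i1)
  ((i == i0)%:R) ((i == i1)%:R) (d%:R) => A B C D E F G.
by split; ring.
Qed.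

Lemma sum_pick (F : 'I_n -> R) j : \sum_i F i * (i == j)%:R = F j.
Proof.
rewrite (bigD1 j)//= eqxx mulr1 big1 ?addr0// => i ij.
by rewrite (negPf ij) mulr0.
Qed.

Lemma xgrad_planar d x : xgrad (planar d).1 x = d%:R * (planar d).1 x.
Proof.
rewrite /xgrad.
under eq_bigr => i _ do rewrite (partial_planar d x i).1.
transitivity (d%:R * ((planar d.-1).1 x * (\sum_i x 0 i * (i == i0)%:R)
   - (planar d.-1).2 x * (\sum_i x 0 i * (i == i1)%:R))).
  rewrite !mulr_sumr -sumrB mulr_sumr; apply: eq_bigr => i _.
  by move: ((planar _).1 x) ((planar _).2 x) => A B; ring.
rewrite !sum_pick; case: d => [|d] /=; first by rewrite !mul0r.
by move: ((planar _).1 x) ((planar _).2 x) => A B; ring.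
Qed.

Lemma laplacian_planar d x : laplacian (planar d).1 x = 0.
Proof.
rewrite /laplacian.
have E i : partial i (partial i (planar d).1) x = d%:R * d.-1%:R *
    ((planar d.-1.-1).1 x * ((i == i0)%:R * (i == i0)%:R)
     - 2 * (planar d.-1.-1).2 x * ((i == i1)%:R * (i == i0)%:R)
     - (planar d.-1.-1).1 x * ((i == i1)%:R * (i == i1)%:R)).
  have -> : partial i (planar d).1 = fun y => d%:R * (i == i0)%:R * (planar d.-1).1 y
      + - (d%:R * (i == i1)%:R) * (planar d.-1).2 y.
    by apply/funext => y; rewrite (partial_planar d y i).1; ring.
  have p1 := dpl1 d.-1 x; have p2 := dpl2 d.-1 x.
  rewrite (partialD i (differentiableZ _ p1) (differentiableZ _ p2)).
  rewrite (partialZ _ i p1) (partialZ _ i p2).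
  rewrite (partial_planar d.-1 x i).1 (partial_planar d.-1 x i).2.
  move: ((planar d.-1.-1).1 x) ((planar d.-1.-1).2 x) ((i == i0)%:R) ((i == i1)%:R)
    (d%:R) (d.-1%:R) => A B C D E F; ring.
rewrite (eq_bigr _ (fun i _ => E i)) -mulr_sumr !sumrB -!mulr_sumr !sum_pick.
by rewrite !eqxx (negPf i01) mulr0 subr0 subrr mulr0.
Qed.

Lemma planar_axis d (t : R) : (planar d).1 (t *: delta_mx 0 i0) = t ^+ d.
Proof.
have a0 : (t *: delta_mx 0 i0 : 'rV[R]_n) 0 i0 = t by rewrite !mxE !eqxx mulr1.
have a1 : (t *: delta_mx 0 i0 : 'rV[R]_n) 0 i1 = 0.
  by rewrite !mxE eq_sym (negPf i01) andbF mulr0.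
suff [] : (planar d).1 (t *: delta_mx 0 i0) = t ^+ d /\
  (planar d).2 (t *: delta_mx 0 i0) = 0 by [].
elim: d => [|d [IH1 IH2]] //=.
by rewrite IH1 IH2 a0 a1 !mul0r !mulr0 !addr0 exprS.
Qed.

Lemma enorm_axis (t : R) : enorm (t *: (delta_mx 0 i0 : 'rV[R]_n)) = `|t|.
Proof.
rewrite enormZ /enorm /dotv (bigD1 i0)//= big1 => [|i ik].
  by rewrite !mxE !eqxx mulr1 addr0 sqrtr1 mulr1.
by rewrite !mxE (negPf ik) andbF mulr0.
Qed.

Lemma dotv_grad (w : 'rV[R]_n -> R) x : dotv (grad w x) x = xgrad w x.
Proof. by apply: eq_bigr => i _; rewrite mxE mulrC. Qed.

Lemma within_grad (A U : set 'rV[R]_n) (w : 'rV[R]_n -> R) : C2_on U w -> A `<=` U ->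
  {within A, continuous (grad w)}.
Proof.
move=> Cw AU; apply: continuous_in_subspaceT => x; rewrite inE => /AU Ux.
exact: (Cw.1 x Ux).2.
Qed.

Lemma ball_eigenvalue d : steklov_eigenvalue (@eball R n 1) d%:R.
Proof.
have Cp := (C2_on_planar d).1.
exists (planar d).1; split.
- exact: C2_on_sub (@subsetT _ _) Cp.
- exact: within_C2 Cp (@subsetT _ _).
- exists ((1 / 2) *: delta_mx 0 i0); first by rewrite /eball /= enorm_axis ger0_norm//; lra.
  by rewrite planar_axis expf_neq0// divr1 ?invr_eq0 ?mul1r ?invr_eq0 pnatr_eq0.
- by move=> x _; exact: laplacian_planar.
exists (grad (planar d).1); split=> //.
  exact: within_grad Cp (@subsetT _ _).
rewrite boundary_eball => x x1; exists x.
  exact: (normal_outer_exists openT).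
by rewrite dotv_grad xgrad_planar.
Qed.

(** The coefficients satisfy the condition on the unit sphere identically, and the condition on the
    inner sphere is then the root equation. From [0 < sigma < d] both are positive, so the function
    does not vanish on the half-axis of [i0]. *)
Lemma shell_eigenvalue e d sigma : (2 < n)%N -> 0 < e < 1 -> 0 < sigma < d%:R ->
  @steklov_poly R n e d sigma = 0 -> steklov_eigenvalue (@shell R n e) sigma.
Proof.
move=> n2 e01 /andP[s0 sd] root; have /andP[e0 e1] := e01.
have Cp := (C2_on_planar d).1.
pose nd : R := (n + d)%:R - 2.
have nd0 : 0 <= nd.
  by rewrite subr_ge0 ler_nat (leq_trans (ltnW n2))// leq_addr.
pose M := (n + 2 * d - 2)%N.
pose al := nd + sigma; pose be := d%:R - sigma.
have al0 : 0 < al by rewrite ltr_wpDl.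
have be0 : 0 < be by rewrite subr_gt0.
pose w := radmul (planar d).1 al be M.
have Cw : C2_on [set x | 0 < enorm x] w by exact: C2_on_radmul.
have xg x (x0 : 0 < enorm x) := xgrad_radmul Cp (xgrad_planar d) al be M x0.
have MR : M%:R = nd + d%:R :> R by exact: degreeM.
have spos : @shell R n e `<=` [set x | 0 < enorm x].
  by move=> x; apply: shell_gt0; exact: ltW.
have cpos : [set x : 'rV[R]_n | e <= enorm x <= 1] `<=` [set x | 0 < enorm x].
  by move=> x /andP[h _]; exact: lt_le_trans h.
exists w; split.
- exact: C2_on_sub spos Cw.
- by rewrite closure_shell//; exact: within_C2 Cw cpos.
- have h : 0 < (e + 1) / 2 by rewrite divr_gt0// addr_gt0.
  exists (((e + 1) / 2) *: delta_mx 0 i0).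
    by apply/shellE; rewrite enorm_axis gtr0_norm//; apply/andP; split; lra.
  rewrite /w /radmul planar_axis enorm_axis gtr0_norm// mulf_neq0// gt_eqF//.
    by rewrite addr_gt0// mulr_gt0// exprn_gt0// invr_gt0.
  by rewrite exprn_gt0.
- move=> x /spos x0.
  rewrite (laplacian_radmul Cp (xgrad_planar d))//; last first.
    by rewrite /M subnK// (leq_trans (ltnW n2))// leq_addr.
  by rewrite laplacian_planar mulr0.
exists (grad w); split=> //.
  by rewrite closure_shell//; exact: within_grad Cw cpos.
rewrite boundary_shell// => x [/= x1|/= xe].
  exists x.
    apply: (normal_outer_exists (open_enorm_gt e)) => //=; first by rewrite x1.
    by move=> y ey; rewrite shellE ey.
  rewrite dotv_grad /w xg ?x1// /radmul x1 invr1 expr1n MR /al /be; ring.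
exists (- (e^-1 *: x)).
  apply: (normal_inner_exists (open_enorm_lt 1)) => //=; first by rewrite xe.
  by move=> y y1; rewrite shellE y1 andbT.
rewrite dotvC dotvNl dotvZl dotvC dotv_grad /w xg ?xe// /radmul xe exprVn MR /al /be.
have eM0 : e ^+ M != 0 by rewrite expf_neq0// gt_eqF.
move: root; rewrite /steklov_poly -/nd -/M.
have e10 : e != 0 by rewrite gt_eqF.
move: (e ^+ M) eM0 ((planar d).1 x) => E E0 P root.
apply/eqP; rewrite -subr_eq0; apply/eqP.
transitivity (e^-1 * E^-1 * P * ((d%:R - sigma) * (nd - sigma * e)
  - E * (d%:R + sigma * e) * (nd + sigma))); first by field; rewrite e10 E0.
by rewrite root mulr0.
Qed.

End planar_harmonics.

(** * Location of the roots *)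

Section roots.
Context {R : realType}.
Implicit Types (d nd e E t K : R).

(** [steklov_poly] with [nd = n + d - 2] and [E = e ^+ (n + 2 * d - 2)] turned into independent real
    parameters. *)
Definition shell_poly d nd e E t : R :=
  (d - t) * (nd - t * e) - E * (d + t * e) * (nd + t).

Lemma continuous_shell_poly d nd e E : continuous (shell_poly d nd e E).
Proof.
have -> : shell_poly d nd e E = horner
    ((d%:P - 'X) * (nd%:P - 'X * e%:P) - E%:P * (d%:P + 'X * e%:P) * (nd%:P + 'X)).
  by apply/funext => t; rewrite /shell_poly !hornerE.
exact: continuous_horner.
Qed.

(* Substituting t = d - del, the terms of order E cancel when
   del = E d (nd + d) / nd. *)
Lemma shell_poly_root d nd : 1 <= d -> 1 <= nd -> exists C e0, 0 < e0 /\
  forall e E, 0 < e -> e < e0 -> 0 < E -> E <= e ->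
  exists t, [/\ shell_poly d nd e E t = 0, d - 2^-1 < t, t < d
    & `|t - (d - d * (nd + d) / nd * E)| <= C * (e * E)].
Proof.
move=> d1 n1; pose c := d * (nd + d) / nd.
have nd0 : 0 < nd by lra.
have c1 : 1 <= c.
  rewrite /c ler_pdivlMr// mul1r; apply: le_trans (_ : 1 * nd <= _); first by rewrite mul1r.
  by apply: ler_pM; lra.
have cE : c * nd = d * (nd + d) by rewrite /c divfK// gt_eqF.
(* [C] dominates the remaining terms, each bounded by a multiple of [e * E]; the summand 1 makes the
   signs strict. *)
pose C := (c + 1) * d + d * (nd + d) + 1.
have p1 : 0 <= (c + 1) * d by rewrite mulr_ge0; lra.
have p2 : 0 <= d * (nd + d) by rewrite mulr_ge0; lra.
have C0 : 1 <= C by rewrite /C; lra.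
pose e0 := ((c + 1) * 4)^-1 * C^-1.
have c4 : 0 < (c + 1) * 4 by rewrite mulr_gt0; lra.
have C00 : 0 < C by lra.
exists C, e0; split; first by rewrite mulr_gt0 ?invr_gt0.
move=> e E ep ee0 E0 Ee.
have Ce : C * e < 1 /\ (c + 1) * e < 4^-1.
  have h : e * ((c + 1) * 4) * C < 1.
    rewrite -mulrA -ltr_pdivlMr; last by rewrite mulr_gt0.
    by rewrite div1r invfM.
  have h2 : 0 <= e * ((c + 1) * 4) by rewrite mulr_ge0; lra.
  have h3 : 0 <= e * C by rewrite mulr_ge0; lra.
  split.
    apply: le_lt_trans h; rewrite (_ : C * e = e * C * 1); last by ring.
    rewrite (_ : e * _ * C = e * C * ((c + 1) * 4)); last by ring.
    by apply: ler_wpM2l => //; lra.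
  suff : e * ((c + 1) * 4) < 1 by clear; lra.
  by apply: le_lt_trans h; rewrite ler_peMr.
case: Ce => Ce ce.
have eE : 0 < e * E by rewrite mulr_gt0.
(* [del 1] and [del (-1)] bracket the expected displacement [c * E]; at [d - del s] the polynomial
   has the sign of [s], which prepares the intermediate value theorem. *)
pose del s := c * E + s * (C * (e * E)).
have CeE : C * (e * E) <= E by rewrite mulrA ler_piMl; lra.
have key s : (s == 1) || (s == -1) ->
    0 < s * shell_poly d nd e E (d - del s) /\ 0 <= del s <= 4^-1.
  move=> s1.
  have sa : `|s| = 1 by case/orP: s1 => /eqP ->; rewrite ?normrN normr1.
  have ss : s * s = 1 by case/orP: s1 => /eqP ->; rewrite ?mulrNN mulr1.
  have cEE : E <= c * E by rewrite ler_peMl; lra.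
  have sC : - E <= s * (C * (e * E)) <= E.
    rewrite -ler_norml normrM sa mul1r ger0_norm//; apply: mulr_ge0; lra.
  have cEe : (c + 1) * E <= (c + 1) * e by rewrite ler_pM2l; lra.
  have [dl0 dlE] : 0 <= del s /\ del s <= (c + 1) * E.
    case/andP: sC => h1 h2; rewrite /del; clear -h1 h2 cEE; split; lra.
  have dl1 : del s <= 4^-1 by clear -dlE cEe ce; lra.
  split; last by rewrite dl0.
  have -> : shell_poly d nd e E (d - del s) = s * (C * nd * (e * E))
      + (E * d * del s - (del s * (d - del s) * e + E * ((d - del s) * e * (nd + d - del s)))).
    have h : c * E * nd = E * (d * (nd + d)) by rewrite mulrAC cE mulrC.
    rewrite /shell_poly.
    have -> : (d - (d - del s)) * (nd - (d - del s) * e) =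
       c * E * nd + s * (C * (e * E)) * nd - del s * (d - del s) * e.
      by rewrite /del; ring.
    by rewrite h; ring.
  rewrite mulrDr mulrA ss mul1r.
  set D := del s in dl0 dlE dl1 *.
  have dD : 0 <= d - D <= d by apply/andP; split; lra.
  case/andP: dD => dD0 dD1.
  have b1 : 0 <= E * d * D by rewrite mulr_ge0// mulr_ge0; lra.
  have b2 : E * d * D <= (c + 1) * d * (e * E).
    apply: (@le_trans _ _ (E * d * ((c + 1) * e))).
      apply: ler_wpM2l; first by rewrite mulr_ge0; lra.
      exact: le_trans dlE cEe.
    by rewrite le_eqVlt; apply/orP; left; apply/eqP; ring.
  have b3 : 0 <= D * (d - D) * e by rewrite mulr_ge0 ?mulr_ge0//; lra.
  have b4 : D * (d - D) * e <= (c + 1) * d * (e * E).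
    rewrite (_ : _ * (e * E) = (c + 1) * E * d * e); last by ring.
    by rewrite ler_pM2r//; apply: ler_pM.
  have b5 : 0 <= E * ((d - D) * e * (nd + d - D)).
    by rewrite mulr_ge0 ?mulr_ge0//; lra.
  have b6 : E * ((d - D) * e * (nd + d - D)) <= d * (nd + d) * (e * E).
    rewrite (_ : _ * (e * E) = E * (d * e * (nd + d))); last by ring.
    rewrite ler_pM2l//; apply: ler_pM; rewrite ?mulr_ge0//; try lra.
    by rewrite ler_pM2r.
  have Cnd : C * (e * E) <= C * nd * (e * E).
    by rewrite ler_pM2r// ler_peMr//; lra.
  have CE : C * (e * E) = (c + 1) * d * (e * E) + d * (nd + d) * (e * E) + e * E.
    by rewrite /C; ring.
  move: b1 b2 b3 b4 b5 b6 Cnd CE eE; clear -s1.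
  move: (E * d * D) (D * (d - D) * e) (E * ((d - D) * e * (nd + d - D))) (C * (e * E))
    (C * nd * (e * E)) ((c + 1) * d * (e * E)) (d * (nd + d) * (e * E)) (e * E).
  by case/orP: s1 => /eqP -> *; lra.
have [] := key 1; first by rewrite eqxx.
rewrite mul1r => f1 /andP[a1 a2].
have [] := key (-1); first by rewrite eqxx orbT.
rewrite mulN1r oppr_gt0 => f2 /andP[a3 a4].
have CeE0 : 0 <= C * (e * E) by rewrite mulr_ge0; lra.
have dd : d - del 1 <= d - del (-1) by rewrite /del; clear -CeE0; lra.
have [] := @IVT R (shell_poly d nd e E) _ _ 0 dd (continuous_subspaceT (@continuous_shell_poly d nd e E)).
  by rewrite ge_min le_max (ltW f1) (ltW f2) orbT.
move=> t; rewrite in_itv /= => /andP[t1 t2] t0.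
exists t; split=> //.
- by clear -t1 a2; lra.
- rewrite lt_neqAle; apply/andP; split; last by clear -t2 a3; lra.
  apply/eqP => td; move: t0; rewrite td /shell_poly subrr mul0r sub0r.
  move/eqP; rewrite oppr_eq0 !mulf_eq0; apply/negP; rewrite !negb_or.
  have h : 0 < d * e by rewrite mulr_gt0; lra.
  by rewrite !gt_eqF//; clear -h d1 n1; lra.
- move: t1 t2; rewrite -/c /del mul1r mulN1r; clear => t1 t2.
  by rewrite ler_norml; apply/andP; split; lra.
Qed.

(** Divided by [t' - t], the difference of the two equations leaves a factor that is positive
    because [(t + t') * e < 1 <= nd]: any second positive root lies beyond [K]. *)
Lemma shell_poly_inj d nd e E K t t' : 0 <= d -> 1 <= nd -> 0 < e -> 0 < E ->
  2 * K * e < 1 -> 0 < t <= K -> 0 < t' <= K ->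
  shell_poly d nd e E t = 0 -> shell_poly d nd e E t' = 0 -> t = t'.
Proof.
wlog tt : t t' / t < t'.
  move=> H *; case: (ltgtP t t') => [h|h|//]; first exact: H.
  by apply/esym; apply: H.
move=> d0 n1 e0 E0 Ke /andP[t0 tK] /andP[t'0 t'K] r1 r2.
have : (t' - t) * ((nd + d * e) - (t + t') * e + E * (d + nd * e) + E * ((t + t') * e)) = 0.
  by rewrite -[RHS](subrr 0) -{1}r1 -{1}r2 /shell_poly; ring.
move/eqP; rewrite mulf_eq0 subr_eq0 gt_eqF//= => /eqP.
have h1 : (t + t') * e <= 2 * K * e by rewrite ler_pM2r//; lra.
have h2 : 0 <= d * e by rewrite mulr_ge0// ltW.
have h3 : 0 <= E * (d + nd * e).
  by rewrite mulr_ge0 ?ltW// ltr_wpDl// mulr_gt0//; lra.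
have h4 : 0 <= E * ((t + t') * e).
  by rewrite mulr_ge0 ?ltW// mulr_gt0//; lra.
move: h1 h2 h3 h4 Ke n1; clear.
move: ((t + t') * e) (E * (d + nd * e)) (E * _) (d * e) => *; lra.
Qed.

(** Both terms are negative: degree 0 carries no positive eigenvalue up to [K]. *)
Lemma shell_poly_neg nd e E K t : 1 <= nd -> 0 < e -> 0 < E ->
  2 * K * e < 1 -> 0 < t <= K -> shell_poly 0 nd e E t != 0.
Proof.
move=> n1 e0 E0 Ke /andP[t0 tK]; rewrite /shell_poly !add0r.
have te : t * e <= K * e by rewrite ler_pM2r.
have h : 0 < t * (nd - t * e) by rewrite mulr_gt0//; lra.
have h2 : 0 < E * (t * e) * (nd + t) by rewrite !mulr_gt0//; lra.
by rewrite lt_eqF// mulNr; clear -h h2; lra.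
Qed.

Lemma shell_poly_pos d nd e E K t : 1 <= K -> K + 1 <= d -> d <= nd -> 0 < e ->
  0 < E -> E <= e -> 8 * (K + 1) * e < 1 -> 0 < t <= K ->
  shell_poly d nd e E t != 0.
Proof.
move=> K1 Kd dn e0 E0 Ee Ke /andP[t0 tK]; rewrite /shell_poly subr_eq0.
have Ke0 : 0 < K * e by rewrite mulr_gt0; lra.
have te : t * e <= K * e by rewrite ler_pM2r.
have te1 : t * e <= 8^-1 by clear -te Ke e0; lra.
have h1 : d <= (d - t) * (K + 1).
  have : 0 <= (d - (K + 1)) * K by rewrite mulr_ge0; lra.
  have : 0 <= (K - t) * (K + 1) by rewrite mulr_ge0; lra.
  clear; lra.
have h2 : nd <= 2 * (nd - t * e) by clear -te1 K1 Kd dn; lra.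
have h3 : d * nd <= 2 * (K + 1) * ((d - t) * (nd - t * e)).
  rewrite (_ : _ * ((d - t) * _) = ((d - t) * (K + 1)) * (2 * (nd - t * e))); last by ring.
  by apply: ler_pM => //; lra.
have h4 : E * (d + t * e) * (nd + t) <= 4 * e * (d * nd).
  rewrite (_ : 4 * e * _ = e * (2 * d) * (2 * nd)); last by ring.
  apply: ler_pM; [|lra| |lra].
    by rewrite mulr_ge0 ?ltW// addr_gt0 ?mulr_gt0//; lra.
  apply: ler_pM; [exact: ltW|by rewrite ltW// addr_gt0 ?mulr_gt0//; lra|exact: Ee|].
  by clear -te1 Kd K1; lra.
have dn0 : 0 < d * nd by rewrite mulr_gt0; lra.
rewrite gt_eqF//; apply: le_lt_trans h4 _.
have h5 : 8 * (K + 1) * e * (d * nd) < d * nd by rewrite gtr_pMl.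
rewrite -(ltr_pM2l (_ : 0 < 2 * (K + 1))); last by lra.
apply: lt_le_trans h3; apply: le_lt_trans h5.
by rewrite le_eqVlt; apply/orP; left; apply/eqP; ring.
Qed.

End roots.

(** * The k-th eigenvalue *)

Section kth_eigenvalue.
Context {R : realType} {n : nat}.
Implicit Types (Om : set 'rV[R]_n) (s t : R) (k d : nat).

(** The smaller of two candidates counts a proper subset of what the larger one counts, while both
    finite sets have [k] elements. *)
Lemma is_kth_steklov_unique Om k s t :
  is_kth_steklov Om k s -> is_kth_steklov Om k t -> s = t.
Proof.
wlog st : s t / s < t.
  move=> H hs ht; case: (ltgtP s t) => [h|h|//]; first exact: H h hs ht.
  by apply/esym; exact: H h ht hs.
move=> [s0 es cs] [t0 et ct]; exfalso.
set As := [set _ | _] in cs; set At := [set _ | _] in ct.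
have fs : finite_set As by exists k.
have ft : finite_set At by exists k.
have sub : (fset_set As `<` fset_set At)%fset.
  rewrite fproperEneq; apply/andP; split.
    apply/eqP => E; have : t \in fset_set As.
      by rewrite E in_fset_set// in_setE; split=> //; rewrite t0 lexx.
    by rewrite in_fset_set// in_setE => -[_ /andP[_]]; rewrite leNgt st.
  apply/fsubsetP => x; rewrite !in_fset_set// !in_setE => -[ex /andP[x0 xs]].
  by split=> //; rewrite x0 (le_trans xs (ltW st)).
have := fproper_ltn_card sub.
by rewrite (card_fset_set cs) (card_fset_set ct) ltnn.
Qed.

Lemma steklov_eq Om k s : is_kth_steklov Om k s -> steklov k Om = s.
Proof.
by move=> h; apply: xget_unique => // t ht; exact: is_kth_steklov_unique ht h.
Qed.

Lemma is_kth_steklovI Om k (sig : nat -> R) : (0 < k)%N ->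
  (forall d, (0 < d <= k)%N -> 0 < sig d /\ steklov_eigenvalue Om (sig d)) ->
  (forall d d', (0 < d)%N -> (d < d')%N -> (d' <= k)%N -> sig d < sig d') ->
  (forall t, steklov_eigenvalue Om t -> 0 < t -> t <= sig k ->
     exists2 d, (0 < d <= k)%N & t = sig d) ->
  is_kth_steklov Om k (sig k).
Proof.
move=> k0 ev inc all; have kk : (0 < k <= k)%N by rewrite k0 leqnn.
have [sk ek] := ev k kk; split=> //.
have -> : [set t | steklov_eigenvalue Om t /\ 0 < t <= sig k] =
    [set sig i.+1 | i in `I_k].
  apply/seteqP; split => t /=.
    move=> [et /andP[t0 tk]]; have [d /andP[d0 dk] ->] := all t et t0 tk.
    by exists d.-1; rewrite ?prednK.
  move=> [i ik <-]; have [s0 es] := ev i.+1 ik; split=> //; rewrite s0 /=.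
  have := ik; rewrite leq_eqVlt => /predU1P[->//|ik'].
  by apply: ltW; apply: inc.
apply: inj_card_eq => i j; rewrite !in_setE /= => ik jk ij.
case: (ltngtP i j) => // h.
  by have := inc i.+1 j.+1 isT h jk; rewrite ij ltxx.
by have := inc j.+1 i.+1 isT h ik; rewrite ij ltxx.
Qed.

Lemma steklov_ball k : (2 < n)%N -> (0 < k)%N -> steklov k (@eball R n 1) = k%:R.
Proof.
move=> n2 k0; apply: steklov_eq.
apply: (is_kth_steklovI (sig := fun d => d%:R)) => //.
- move=> d /andP[d0 _]; rewrite ltr0n; split=> //.
  apply: (@ball_eigenvalue _ _ (Ordinal (ltnW (ltnW n2))) (Ordinal (ltnW n2))).
  by [].
- by move=> d d' _ dd _; rewrite ltr_nat.
move=> t et t0 tk; have [d td] := ball_eigenvalue_nat n2 et.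
by exists d => //; rewrite -(ltr0n R) -(ler_nat R) -td t0.
Qed.

Lemma shell_root_near d : (2 < n)%N -> (0 < d)%N -> exists C : R,
  \forall e \near (0 : R)^'+, exists t, [/\ @steklov_poly R n e d t = 0,
     d%:R - 2^-1 < t, t < d%:R
   & `|t - (d%:R - d%:R * ((n + d)%:R - 2 + d%:R) / ((n + d)%:R - 2)
        * e ^+ (n + 2 * d - 2))| <= C * (e * e ^+ (n + 2 * d - 2))].
Proof.
move=> n2 d0; have d1 : 1 <= d%:R :> R by rewrite ler1n.
have nd1 : 1 <= (n + d)%:R - 2 :> R.
  rewrite lerBrDr -[1 + 2]/(1 + 2%:R) -[1]/(1%:R) -natrD ler_nat.
  by rewrite -[(1 + 2)%N]addn0 leq_add.
have [C [e0 [e00 He]]] := shell_poly_root d1 nd1.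
exists C; near=> e.
have ep : 0 < e by near: e; exact: nbhs_right_gt.
have e1 : e < 1 by near: e; exact: nbhs_right_lt.
have ee : e < e0 by near: e; exact: nbhs_right_lt.
apply: (He e _ ep ee); first by rewrite exprn_gt0.
rewrite -[leRHS]expr1; apply: ler_wiXn2l; rewrite ?ltW//.
by rewrite subn_gt0 (leq_trans n2)// leq_addr.
Unshelve. all: by end_near. Qed.

(** The lower bound [k - 1/2] is recorded to give positivity of the eigenvalue in the comparison of
    volumes. *)
Lemma steklov_shell k : (2 < n)%N -> (0 < k)%N -> exists C : R,
  \forall e \near (0 : R)^'+,
   k%:R - 2^-1 < steklov k (@shell R n e) /\
   `|steklov k (@shell R n e) -
      (k%:R - k%:R * ((n + k)%:R - 2 + k%:R) / ((n + k)%:R - 2)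
        * e ^+ (n + 2 * k - 2))| <= C * (e * e ^+ (n + 2 * k - 2)).
Proof.
move=> n2 k0; have [C HC] := shell_root_near n2 k0; exists C.
(* Only finitely many degrees occur, so their thresholds on [e] combine. *)
have all_roots : \forall e \near (0 : R)^'+, forall i : 'I_k.+1, (0 < i)%N ->
    exists t, [/\ @steklov_poly R n e i t = 0, i%:R - 2^-1 < t & t < i%:R].
  apply: filter_forall => i; have [i0|i0] := posnP i; first by near=> e; rewrite i0.
  have [C' H] := shell_root_near n2 i0; apply: filterS H => e [t [h1 h2 h3 _]] _.
  by exists t.
near=> e.
have ep : 0 < e by near: e; exact: nbhs_right_gt.
have e1 : e < 1 by near: e; exact: nbhs_right_lt.
have eK : e < (8 * (k%:R + 1))^-1.
  by near: e; apply: nbhs_right_lt; rewrite invr_gt0 mulr_gt0// ltr_wpDl.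
have roots : forall i : 'I_k.+1, (0 < i)%N ->
    exists t, [/\ @steklov_poly R n e i t = 0, i%:R - 2^-1 < t & t < i%:R].
  by near: e.
have [tk [rk tk1 tk2 tkC]] : exists t, [/\ @steklov_poly R n e k t = 0,
     k%:R - 2^-1 < t, t < k%:R
   & `|t - (k%:R - k%:R * ((n + k)%:R - 2 + k%:R) / ((n + k)%:R - 2)
        * e ^+ (n + 2 * k - 2))| <= C * (e * e ^+ (n + 2 * k - 2))] by near: e.
have k1 : 1 <= k%:R :> R by rewrite ler1n.
have K8 : 8 * (k%:R + 1) * e < 1.
  by rewrite mulrC -ltr_pdivlMr ?div1r// mulr_gt0// ltr_wpDl.
have K2 : 2 * k%:R * e < 1.
  apply: le_lt_trans K8; rewrite ler_pM2r//; clear -k1; lra.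
have e01 : 0 < e < 1 by rewrite ep e1.
have E0 d : 0 < e ^+ (n + 2 * d - 2) by rewrite exprn_gt0.
have Ee d : e ^+ (n + 2 * d - 2) <= e.
  rewrite -[leRHS]expr1; apply: ler_wiXn2l; rewrite ?ltW//.
  by rewrite subn_gt0 (leq_trans n2)// leq_addr.
have nd d : 1 <= (n + d)%:R - 2 :> R.
  rewrite lerBrDr -[1 + 2]/(1 + 2%:R) -[1]/(1%:R) -natrD ler_nat.
  by rewrite -[(1 + 2)%N]addn0 leq_add.
have sel (d : nat) : exists t, (0 < d <= k)%N ->
    [/\ @steklov_poly R n e d t = 0, d%:R - 2^-1 < t & t < d%:R].
  have [/andP[d0 dk]|dk] := boolP (0 < d <= k)%N; last by exists 0.
  have [t Ht] := roots (Ordinal (dk : (d < k.+1)%N)) d0.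
  by exists t.
have [sig Hsig] := choice sel.
have pos d : (0 < d <= k)%N -> 0 < sig d.
  move=> dk; have [_ h _] := Hsig d dk; apply: lt_trans h.
  have : 1 <= d%:R :> R by rewrite ler1n; case/andP: dk.
  by clear; lra.
have kk : (0 < k <= k)%N by rewrite k0 leqnn.
have [rs s1 s2] := Hsig k kk.
(* The root selected for degree [k] is identified, by uniqueness, with the one known to satisfy the
   asymptotics. *)
have sk : sig k = tk.
  apply: (@shell_poly_inj R _ _ e _ k%:R _ _ _ (nd k) ep (E0 k) K2 _ _ rs rk) => //.
    by rewrite pos//= ltW.
  by rewrite (ltW tk2) andbT; apply: lt_trans tk1; clear -k1; lra.
suff -> : steklov k (@shell R n e) = tk by [].
rewrite -sk; apply: steklov_eq; apply: is_kth_steklovI => //.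
- move=> d dk; split; first exact: pos.
  have [rd d1 d2] := Hsig d dk.
  have i01 : Ordinal (ltnW (ltnW n2)) != Ordinal (ltnW n2) by [].
  by apply: (shell_eigenvalue i01 n2 e01 _ rd); rewrite pos.
- move=> d d' d0 dd d'k.
  have [_ _ h1] := Hsig d (introT andP (conj d0 (leq_trans (ltnW dd) d'k))).
  have [_ h2 _] := Hsig d' (introT andP (conj (leq_trans d0 (ltnW dd)) d'k)).
  have : d%:R + 1 <= d'%:R :> R by rewrite natr1 ler_nat.
  by clear -h1 h2; lra.
move=> t et t0 tk'.
have tK : t <= k%:R by apply: le_trans tk' _; rewrite sk ltW.
(* Degree 0 and degrees above [k] have no root in this range; for the others the root is unique. *)
have [d rd] := shell_eigenvalue_root n2 e01 et.
have t0K : 0 < t <= k%:R by rewrite t0.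
have d0 : (0 < d)%N.
  rewrite lt0n; apply/eqP => d0; move: rd; rewrite d0 => /eqP; apply/negP.
  exact: (shell_poly_neg (nd 0%N) ep (E0 0%N) K2 t0K).
have dk : (d <= k)%N.
  rewrite leqNgt; apply/negP => kd; move: rd => /eqP; apply/negP.
  apply: (shell_poly_pos k1 _ _ ep (E0 d) (Ee d) K8 t0K).
    by rewrite natr1 ler_nat.
  by rewrite lerBrDr -[2]/(2%:R) -natrD ler_nat addnC leq_add2r ltnW.
have dkk : (0 < d <= k)%N by rewrite d0 dk.
exists d => //; have [rd' d1 d2] := Hsig d dkk.
apply: (@shell_poly_inj R _ _ e _ k%:R _ _ _ (nd d) ep (E0 d) K2 t0K _ rd rd') => //.
by rewrite pos//= ltW// (lt_le_trans d2)// ler_nat.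
Unshelve. all: by end_near. Qed.

End kth_eigenvalue.

(** * Hausdorff measure of spheres *)

Section hausdorff_basics.
Context {R : realType} {n : nat}.
Implicit Types (x y : 'rV[R]_n) (A B : set 'rV[R]_n) (m : nat) (t D : R).
Local Open Scope ereal_scope.

Lemma unit_ball_volume_gt0 m : (0 < unit_ball_volume R m)%R.
Proof.
suff H : (0 < unit_ball_volume R m /\ 0 < unit_ball_volume R m.+1)%R by exact: H.1.
elim: m => [|m [IH1 IH2]]; first by rewrite /= ltr01 ltr0n.
by split=> //=; rewrite mulr_gt0// divr_gt0 ?mulr_gt0 ?pi_gt0 ?ltr0n.
Qed.

Definition gauge_cst m : R := (unit_ball_volume R m / 2 ^+ m)%R.

Lemma gauge_cst_gt0 m : (0 < gauge_cst m)%R.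
Proof. by rewrite divr_gt0 ?unit_ball_volume_gt0// exprn_gt0. Qed.

Lemma expe_le (x y : \bar R) m : 0 <= x -> x <= y -> x ^+ m <= y ^+ m.
Proof.
move=> x0 xy; elim: m => [|m IH]; first by rewrite !expe0.
rewrite !expeS; apply: lee_pmul => //; exact: expe_ge0.
Qed.

Lemma EFin_expe t m : t%:E ^+ m = (t ^+ m)%:E.
Proof.
elim: m => [|m IH]; first by rewrite expe0.
by rewrite expeS IH exprS EFinM.
Qed.

Lemma ediam_ge A x y : A x -> A y -> (enorm (x - y)%R)%:E <= ediam A.
Proof. by move=> Ax Ay; apply: ereal_sup_ubound; exists (x, y). Qed.

Lemma ediam_ge0 A : A !=set0 -> 0 <= ediam A.
Proof.
move=> [x Ax]; apply: le_trans (ediam_ge Ax Ax).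
by rewrite lee_fin enorm_ge0.
Qed.

Lemma ediam_le A (D : \bar R) :
  (forall x y, A x -> A y -> (enorm (x - y)%R)%:E <= D) -> ediam A <= D.
Proof. by move=> h; apply: ge_ereal_sup => _ [[x y] /= [Ax Ay] <-]; exact: h. Qed.

Lemma ediam_sub A B : A `<=` B -> ediam A <= ediam B.
Proof. by move=> AB; apply: ediam_le => x y /AB Bx /AB By; exact: ediam_ge. Qed.

Lemma gaugeE m A : A !=set0 -> hausdorff_gauge m A = (gauge_cst m)%:E * ediam A ^+ m.
Proof. by move=> A0; rewrite /hausdorff_gauge asboolT. Qed.

Lemma gauge0 m A : ~ (A !=set0) -> hausdorff_gauge m A = 0.
Proof. by move=> A0; rewrite /hausdorff_gauge asboolF. Qed.

Lemma gauge_ge0 m A : 0 <= hausdorff_gauge m A.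
Proof.
have [A0|A0] := pselect (A !=set0); last by rewrite gauge0.
by rewrite gaugeE// mule_ge0 ?expe_ge0 ?ediam_ge0// lee_fin ltW// gauge_cst_gt0.
Qed.

Lemma gauge_le m A D : (0 <= D)%R ->
  (forall x y, A x -> A y -> (enorm (x - y) <= D)%R) ->
  hausdorff_gauge m A <= (gauge_cst m * D ^+ m)%:E.
Proof.
move=> D0 AD; have [A0|A0] := pselect (A !=set0); last first.
  by rewrite gauge0// lee_fin mulr_ge0 ?exprn_ge0// ltW// gauge_cst_gt0.
rewrite gaugeE// [leRHS]EFinM -EFin_expe lee_wpmul2l ?lee_fin ?(ltW (gauge_cst_gt0 m))//.
apply: expe_le; first exact: ediam_ge0.
by apply: ediam_le => x y Ax Ay; rewrite lee_fin AD.
Qed.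

Lemma gauge_sub m A B : A `<=` B -> hausdorff_gauge m A <= hausdorff_gauge m B.
Proof.
move=> AB; have [A0|A0] := pselect (A !=set0); last by rewrite gauge0// gauge_ge0.
have B0 : B !=set0 by case: A0 => x /AB; exists x.
rewrite !gaugeE// lee_wpmul2l ?lee_fin ?(ltW (gauge_cst_gt0 m))//.
by apply: expe_le; [exact: ediam_ge0|exact: ediam_sub].
Qed.

Lemma ediam_scale t A : (0 < t)%R -> ediam [set (t *: x)%R | x in A] <= t%:E * ediam A.
Proof.
move=> t0; apply: ediam_le => _ _ [x Ax <-] [y Ay <-].
rewrite -scalerBr enormZ gtr0_norm// EFinM lee_wpmul2l ?lee_fin ?(ltW t0)//.
exact: ediam_ge.
Qed.

Lemma gauge_scale m t A : (0 < t)%R ->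
  hausdorff_gauge m [set (t *: x)%R | x in A] <= (t ^+ m)%:E * hausdorff_gauge m A.
Proof.
move=> t0; have [A0|A0] := pselect (A !=set0); last first.
  rewrite !gauge0 ?mule0//; move=> [_ [x Ax _]]; apply: A0; by exists x.
have A0' : [set (t *: x)%R | x in A] !=set0 by case: A0 => x Ax; exists (t *: x)%R, x.
rewrite !gaugeE// muleCA lee_wpmul2l ?lee_fin ?(ltW (gauge_cst_gt0 m))//.
have H : (t%:E * ediam A) ^+ m = (t ^+ m)%:E * ediam A ^+ m.
  rewrite -EFin_expe; elim: m => [|m IH]; first by rewrite !expe0 mule1.
  by rewrite !expeS IH muleACA.
by rewrite -H; apply: expe_le; [exact: ediam_ge0|exact: ediam_scale].
Qed.

Definition usphere (r : R) : set 'rV[R]_n := [set x | enorm x = r].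

(** A set of small diameter meets at most one of the spheres. The traces on the small sphere,
    rescaled by [e^-1], cover the unit sphere with gauges at most [e^-1 ^+ m] times as large, so the
    bound holds cover by cover. *)
Lemma hausdorff_two_spheres m e : (0 < e < 1)%R ->
  (1 + e ^+ m)%:E * hausdorff_measure m (usphere 1) <=
  hausdorff_measure m (usphere 1 `|` usphere e).
Proof.
move=> /andP[e0 e1].
have em0 : (0 < 1 + e ^+ m)%R by rewrite ltr_wpDr// exprn_ge0// ltW.
rewrite -lee_pdivlMl//; apply: ge_ereal_sup => _ [del /= del0 <-].
rewrite lee_pdivlMl//.
(* [del * e] keeps the rescaled traces within diameter [del]; [(1 - e) / 2] is less than the
   distance between the spheres. *)
pose del' := Num.min (del * e)%R ((1 - e) / 2)%R.
have del'0 : (0 < del')%R by rewrite lt_min mulr_gt0//= divr_gt0// subr_gt0.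
have d1 : (del' <= del * e)%R by rewrite ge_min lexx.
have d2 : (del' <= (1 - e) / 2)%R by rewrite ge_min lexx orbT.
apply: (@le_trans _ _ (hausdorff_content m del' (usphere 1 `|` usphere e))); last first.
  by apply: ereal_sup_ubound; exists del'.
apply: le_ereal_inf_tmp => _ [F [Fcov Fdiam] <-].
pose F1 i := F i `&` usphere 1; pose F2 i := F i `&` usphere e.
pose F3 i := [set (e^-1 *: x)%R | x in F2 i].
have c1 : hausdorff_content m del (usphere 1) <= \sum_(i <oo) hausdorff_gauge m (F1 i).
  apply: ereal_inf_lbound; exists F1 => //; split.
    by move=> x x1; have [i _ Fx] := Fcov x (or_introl x1); exists i.
  move=> i; apply: le_trans (ediam_sub (@subIsetl _ _ _)) _.
  apply: le_trans (Fdiam i) _; rewrite lee_fin; apply: le_trans d1 _.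
  by rewrite ler_piMr// ltW.
have c2 : hausdorff_content m del (usphere 1) <= \sum_(i <oo) hausdorff_gauge m (F3 i).
  apply: ereal_inf_lbound; exists F3 => //; split.
    move=> x x1; have xe : usphere e (e *: x)%R.
      by rewrite /usphere /= enormZ x1 mulr1 gtr0_norm.
    have [i _ Fx] := Fcov _ (or_intror xe); exists i => //; exists (e *: x)%R => //.
    by rewrite scalerA mulVf ?scale1r// gt_eqF.
  move=> i; apply: le_trans (ediam_scale _ _) _; first by rewrite invr_gt0.
  rewrite muleC lee_pdivrMr//; apply: le_trans (ediam_sub (@subIsetl _ _ _)) _.
  by apply: le_trans (Fdiam i) _; rewrite -EFinM lee_fin.
have g i : hausdorff_gauge m (F1 i) + (e ^+ m)%:E * hausdorff_gauge m (F3 i) <=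
    hausdorff_gauge m (F i).
  apply: (@le_trans _ _ (hausdorff_gauge m (F1 i) + hausdorff_gauge m (F2 i))).
    apply: leeD => //.
    apply: (@le_trans _ _ ((e ^+ m)%:E * ((e^-1 ^+ m)%:E * hausdorff_gauge m (F2 i)))).
      rewrite lee_wpmul2l ?lee_fin ?exprn_ge0 ?(ltW e0)//.
      by apply: gauge_scale; rewrite invr_gt0.
    by rewrite muleA -EFinM exprVn divff ?mul1e// expf_neq0// gt_eqF.
  have [[x [Fx x1]]|E] := pselect (F1 i !=set0); last first.
    by rewrite gauge0// add0e; apply: gauge_sub; exact: subIsetl.
  rewrite [X in _ + X]gauge0 ?adde0; first by apply: gauge_sub; exact: subIsetl.
  move=> [y [Fy ye]].
  have := le_trans (ediam_ge Fx Fy) (Fdiam i).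
  rewrite lee_fin leNgt => /negP; apply; apply: (le_lt_trans d2).
  rewrite /usphere /= in x1 ye.
  have dE := @sqr_enormD R n x y (-1); rewrite scaleN1r in dE.
  (* Positivity of |e x - y|^2, with |x| = 1 and |y| = e, yields |x - y| >= 1 - e. *)
  have h : (2 * dotv x y <= dotv x x * e + dotv y y * e^-1)%R.
    have := dotv_ge0 ((e *: x) - y)%R.
    rewrite !(dotvDl, dotvDr, dotvNl, dotvNr, dotvZl, dotvZr) (dotvC y x) => h.
    have -> : (dotv x x * e + dotv y y * e^-1 = e^-1 * (e * (e * dotv x x) + dotv y y))%R.
      by field; rewrite gt_eqF.
    by rewrite -ler_pdivrMl ?invr_gt0// invrK; lra.
  rewrite -!sqr_enorm x1 ye in h dE.
  have e2 : (1 ^+ 2 * e + e ^+ 2 * e^-1 = 2 * e)%R by field; rewrite gt_eqF.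
  rewrite e2 in h.
  rewrite -ltr_sqr ?nnegrE ?enorm_ge0//; last by rewrite divr_ge0// subr_ge0 ltW.
  have s0 : (0 < (1 - e) ^+ 2)%R by rewrite exprn_gt0// subr_gt0.
  apply: (@lt_le_trans _ _ ((1 - e) ^+ 2)%R); last by rewrite dE; lra.
  by rewrite exprMn gtr_pMr// exprVn invf_lt1// exprn_egt1// ltr1n.
apply: (@le_trans _ _ (\sum_(i <oo) (hausdorff_gauge m (F1 i) +
    (e ^+ m)%:E * hausdorff_gauge m (F3 i)))).
  rewrite nneseriesD; last 2 first.
  - by move=> i _ _; exact: gauge_ge0.
  - by move=> i _ _; rewrite mule_ge0 ?gauge_ge0// lee_fin exprn_ge0// ltW.
  rewrite nneseriesZl; last by move=> i _; exact: gauge_ge0.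
  rewrite EFinD ge0_muleDl ?lee_fin ?exprn_ge0 ?(ltW e0)// mul1e.
  by apply: leeD => //; rewrite lee_wpmul2l// lee_fin exprn_ge0// ltW.
apply: lee_nneseries => // i _.
by rewrite adde_ge0 ?gauge_ge0// mule_ge0 ?gauge_ge0// lee_fin exprn_ge0// ltW.
Qed.

End hausdorff_basics.

(** * Finiteness of the measure of the sphere *)

Section sphere_measure_finite.
Context {R : realType} {m : nat}.
Implicit Types (x y : 'rV[R]_m.+1).

(** Central projection to the faces of a cube: [c] records a coordinate of largest modulus, its
    sign, and a lattice cell for the other coordinates divided by that modulus. *)
Definition face_cell N (c : 'I_m.+1 * bool * {ffun 'I_m -> 'I_(grid_size N)}) :
    set 'rV[R]_m.+1 :=
  [set x | [/\ enorm x = 1,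
     (if c.1.2 then 0 < x 0 c.1.1 else x 0 c.1.1 < 0),
     (forall k, `|x 0 k| <= `|x 0 c.1.1|)
   & forall k : 'I_m, `|x 0 (lift c.1.1 k) / `|x 0 c.1.1| - ((c.2 k)%:R * mesh N - 1)|
        <= mesh N]].

Definition cell_cst : R := m.+1%:R * (2 + 2 * m.+1%:R ^+ 2).

(** Write x = a Y with [a] the largest modulus of a coordinate. The cell fixes [Y] up to
    [2 * mesh N], and [enorm x = 1] determines [a] from [Y] in a Lipschitz way since a >= 1 / (m +
    1). *)
Lemma face_cell_diam N c x y : @face_cell N c x -> face_cell c y ->
  enorm (x - y) <= cell_cst * mesh N.
Proof.
move: c => [[i b] j] [/= x1 sx mx cx] [/= y1 sy my cy].
have h0 := @mesh_gt0 R N; set h := mesh N in h0 cx cy *.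
set a := `|x 0 i| in mx cx; set a' := `|y 0 i| in my cy.
have x0 : x 0 i != 0 by move: sx; case: (b) => sx; [rewrite gt_eqF|rewrite lt_eqF].
have y0 : y 0 i != 0 by move: sy; case: (b) => sy; [rewrite gt_eqF|rewrite lt_eqF].
have a0 : 0 < a by rewrite normr_gt0.
have a'0 : 0 < a' by rewrite normr_gt0.
pose Y k := x 0 k / a; pose Y' k := y 0 k / a'.
have xY k : x 0 k = a * Y k by rewrite /Y mulrC divfK// gt_eqF.
have yY k : y 0 k = a' * Y' k by rewrite /Y' mulrC divfK// gt_eqF.
have Y1 k : `|Y k| <= 1 by rewrite normrM normfV (gtr0_norm a0) ler_pdivrMr// mul1r.
have Y'1 k : `|Y' k| <= 1 by rewrite normrM normfV (gtr0_norm a'0) ler_pdivrMr// mul1r.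
have YY k : `|Y k - Y' k| <= 2 * h.
  have [k'|] := unliftP i k.
    move=> ->; have := cx k'; have := cy k'.
    rewrite -/(Y (lift i k')) -/(Y' (lift i k')) !ler_norml.
    by clear => /andP[? ?] /andP[? ?]; apply/andP; split; lra.
  move=> ->; have -> : Y i = Y' i.
    rewrite /Y /Y' /a /a'; move: sx sy; case: (b) => sx sy.
      by rewrite !gtr0_norm// !divff// gt_eqF.
    by rewrite !ltr0_norm// !invrN !mulrN !divff// lt_eqF.
  by rewrite subrr normr0 mulr_ge0// ltW.
have m0 : 1 <= m.+1%:R :> R by rewrite ler1n.
have nrm (z : 'rV[R]_m.+1) (al : R) Z : enorm z = 1 -> (forall k, z 0 k = al * Z k) ->
    al ^+ 2 * (\sum_k Z k ^+ 2) = 1.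
  move=> z1 zZ; rewrite -[RHS](expr1n R 2) -z1 sqr_enorm /dotv mulr_sumr.
  by apply: eq_bigr => k _; rewrite zZ; ring.
have nx := nrm x a Y x1 xY; have ny := nrm y a' Y' y1 yY.
have a1 : a <= 1 by rewrite -x1; exact: coord_le_enorm.
have a'1 : a' <= 1 by rewrite -y1; exact: coord_le_enorm.
have lower (al : R) Z : 0 < al -> al <= 1 -> (forall k : 'I_m.+1, `|Z k| <= 1) ->
    al ^+ 2 * (\sum_k Z k ^+ 2) = 1 -> m.+1%:R^-1 <= al.
  move=> al0 al1 Z1 E; have S1 : \sum_k Z k ^+ 2 <= m.+1%:R.
    apply: (@le_trans _ _ (\sum_(k < m.+1) 1)); last by rewrite sumr_const card_ord.
    by apply: ler_sum => k _; rewrite -[Z k ^+ 2]real_normK ?num_real// expr_le1.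
  apply: (@le_trans _ _ (al ^+ 2)); last by rewrite expr2 ler_piMr// ltW.
  by rewrite -div1r ler_pdivrMr ?ltr0n// -[leLHS]E ler_pM2l ?exprn_gt0.
have la := lower a Y a0 a1 Y1 nx; have la' := lower a' Y' a'0 a'1 Y'1 ny.
have dS : `|\sum_k Y k ^+ 2 - \sum_k Y' k ^+ 2| <= m.+1%:R * (4 * h).
  rewrite -sumrB; apply: (le_trans (ler_norm_sum _ _ _)).
  apply: (@le_trans _ _ (\sum_(k < m.+1) (4 * h))); last first.
    by rewrite sumr_const card_ord -[leLHS]mulr_natl.
  apply: ler_sum => k _; rewrite subr_sqr normrM (_ : 4 * h = 2 * h * 2); last by ring.
  apply: ler_pM => //; apply: (le_trans (ler_normD _ _)).
  by have := Y1 k; have := Y'1 k; clear; lra.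
have da : `|a - a'| <= 2 * m.+1%:R ^+ 2 * h.
  have E : (a - a') * (a + a') =
      a ^+ 2 * a' ^+ 2 * (\sum_k Y' k ^+ 2 - \sum_k Y k ^+ 2).
    rewrite mulrBr -mulrA ny mulr1 mulrAC nx mul1r; ring.
  have h1 : `|a - a'| * (a + a') <= 1 * (m.+1%:R * (4 * h)).
    rewrite -[X in _ * X](@gtr0_norm _ (a + a')) ?addr_gt0// -normrM E normrM.
    apply: ler_pM => //; last by rewrite distrC.
    have aa : 0 <= a * a' by rewrite mulr_ge0// ltW.
    rewrite -exprMn ger0_norm ?sqr_ge0// expr_le1//.
    by rewrite mulr_ile1// ltW.
  have h2 : `|a - a'| * (2 * m.+1%:R^-1) <= m.+1%:R * (4 * h).
    rewrite -[leRHS]mul1r; apply: le_trans h1; rewrite ler_wpM2l//; by rewrite mulr_natl mulr2n lerD.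
  have -> : 2 * m.+1%:R ^+ 2 * h = m.+1%:R * (4 * h) / (2 * m.+1%:R^-1).
    by field; rewrite nat1r pnatr_eq0.
  by rewrite ler_pdivlMr// mulr_gt0// invr_gt0 ltr0n.
have dk k : `|(x - y) 0 k| <= (2 + 2 * m.+1%:R ^+ 2) * h.
  rewrite !mxE xY yY.
  have -> : a * Y k - a' * Y' k = a * (Y k - Y' k) + (a - a') * Y' k by ring.
  apply: (le_trans (ler_normD _ _)); rewrite [leRHS]mulrDl !normrM (gtr0_norm a0).
  apply: lerD; first by rewrite -[leRHS]mul1r; apply: ler_pM => //; exact: ltW.
  by rewrite -[leRHS]mulr1; apply: ler_pM => //; rewrite -normrM; exact: (Y'1 k).
have B0 : 0 <= (2 + 2 * m.+1%:R ^+ 2) * h.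
  by rewrite mulr_ge0 ?(ltW h0)// addr_ge0// mulr_ge0// sqr_ge0.
rewrite -ler_sqr ?nnegrE ?enorm_ge0//; last by rewrite /cell_cst -mulrA mulr_ge0.
rewrite sqr_enorm /dotv.
apply: (@le_trans _ _ (\sum_(k < m.+1) ((2 + 2 * m.+1%:R ^+ 2) * h) ^+ 2)).
  apply: ler_sum => k _; rewrite -expr2 -[leLHS]real_normK ?num_real//.
  by rewrite lerXn2r ?nnegrE.
rewrite sumr_const card_ord /cell_cst -mulrA [leRHS]exprMn -[leLHS]mulr_natl.
by rewrite ler_wpM2r ?sqr_ge0// expr2 ler_peMl.
Qed.

Lemma face_cell_cover N x : enorm x = 1 -> exists c, @face_cell N c x.
Proof.
move=> x1; have h0 := @mesh_gt0 R N.
have [i _ imax] := @Order.TotalTheory.arg_maxP _ _ 'I_m.+1 ord0 predT (fun k => `|x 0 k|) isT.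
have xi0 : 0 < `|x 0 i|.
  rewrite normr_gt0; apply/eqP => xi; have : x = 0.
    apply/rowP => k; rewrite mxE; apply/eqP; rewrite -normr_le0.
    by rewrite -[leRHS](normr0 R) -xi; exact: imax.
  by move=> x0; move: x1; rewrite x0 enorm0 => /esym/eqP; rewrite oner_eq0.
pose y k := x 0 (lift i k) / `|x 0 i|.
have y1 k : `|y k| <= 1.
  by rewrite normrM normfV normr_id ler_pdivrMr// mul1r; exact: imax.
have cell k : exists j : 'I_(grid_size N), `|y k - (j%:R * mesh N - 1)| <= mesh N.
  have yk := y1 k; rewrite ler_norml in yk; case/andP: yk => yk1 yk2.
  have q0 : 0 <= (y k + 1) / mesh N by rewrite divr_ge0 ?(ltW h0)//; lra.
  have /andP[tl tu] := truncn_itv q0.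
  have lt : (Num.truncn ((y k + 1) / mesh N) < grid_size N)%N.
    rewrite /grid_size ltnS -(ler_nat R) natrM; apply: le_trans tl _.
    rewrite ler_pdivrMr// /mesh -mulrA divff ?pnatr_eq0//; lra.
  exists (Ordinal lt) => /=.
  rewrite ler_pdivlMr// in tl; rewrite ltr_pdivrMr// -natr1 mulrDl mul1r in tu.
  rewrite ler_norml; apply/andP; split; lra.
have [j Hj] := choice cell.
exists (i, 0 < x 0 i, [ffun k => j k]); split=> //=.
- by case: ltP => // h; rewrite lt_neqAle h andbT -normr_gt0.
- by move=> k; exact: imax.
- by move=> k; rewrite ffunE; exact: Hj.
Qed.

(** The number of cells grows like [(mesh N)^-1 ^+ m] and each gauge is at most a constant times
    [mesh N ^+ m], so the total stays bounded. *)
Lemma sphere_measure_finite : exists B : R,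
  (hausdorff_measure m (@usphere R m.+1 1) <= B%:E)%E.
Proof.
have D0 : 0 < cell_cst.
  by rewrite mulr_gt0 ?ltr0n// addr_gt0// mulr_gt0// exprn_gt0// ltr0n.
have k0 := @gauge_cst_gt0 R m.
pose B := (m.+1 * 2)%:R * (gauge_cst m * (3 * cell_cst) ^+ m) : R.
exists B; apply: ge_ereal_sup => _ [del /= del0 <-].
have [N HN] : exists N, cell_cst * mesh N <= del.
  have d1 : 0 < del / cell_cst by rewrite divr_gt0.
  have /cvgr0Pnorm_le/(_ _ d1)/filter_ex[N HN] := @mesh_cvg0 R.
  exists N; rewrite mulrC -ler_pdivlMr//; apply: le_trans HN; exact: ler_norm.
pose T : finType := ('I_m.+1 * bool * {ffun 'I_m -> 'I_(grid_size N)})%type.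
(* Covers are infinite sequences; past the number of cells the sets are empty and have gauge 0. *)
pose F t : set 'rV[R]_m.+1 := if insub t is Some o then
  face_cell (enum_val (A := {: T}) (o : 'I_#|{: T}|)) else set0.
apply: (@le_trans _ _ (\sum_(i <oo) hausdorff_gauge m (F i))%E).
  apply: ereal_inf_lbound; exists F => //; split.
    move=> x x1; have [c cx] := face_cell_cover N x1.
    exists (enum_rank (c : T)) => //=; rewrite /F.
    rewrite insubT => [|lt]; first exact: ltn_ord.
    by rewrite (_ : Sub _ _ = enum_rank (c : T)) ?enum_rankK//; exact: val_inj.
  move=> i; apply: ediam_le => x y; rewrite /F; case: insubP => // o _ _ cx cy.
  rewrite lee_fin; apply: le_trans HN; exact: face_cell_diam cx cy.
have h0 := @mesh_gt0 R N.
have g i : (hausdorff_gauge m (F i) <= (gauge_cst m * (cell_cst * mesh N) ^+ m)%:E)%E.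
  apply: gauge_le; first by rewrite mulr_ge0// ltW.
  by move=> x y; rewrite /F; case: insubP => // o _ _ cx cy; exact: face_cell_diam cx cy.
rewrite (nneseries_split 0 #|{: T}|); last by move=> i _; exact: gauge_ge0.
rewrite add0n [X in (_ + X)%E]eseries0 ?adde0; last first.
  move=> i Ti _; rewrite /F insubF ?gauge0//; last by rewrite ltnNge Ti.
  by move=> [].
apply: (@le_trans _ _ (\sum_(0 <= i < #|{: T}|)
    (gauge_cst m * (cell_cst * mesh N) ^+ m)%:E)%E); first exact: lee_sum.
rewrite sumEFin lee_fin sumr_const_nat subn0 -[leLHS]mulr_natl.
rewrite !card_prod card_bool card_ffun !card_ord natrM -mulrA /B ler_wpM2l//.
rewrite mulrCA ler_wpM2l ?(ltW k0)// natrX -exprMn lerXn2r ?nnegrE//.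
- by rewrite mulr_ge0// mulr_ge0// ltW.
- by rewrite mulr_ge0// ltW.
rewrite mulrCA [leRHS]mulrC ler_wpM2l ?(ltW D0)//.
rewrite /grid_size -natr1 natrM mulrDl mul1r /mesh -mulrA divff ?pnatr_eq0//.
rewrite mulr1 (_ : 3 = 2 + 1 :> R); last by ring.
by rewrite lerD2l; exact: (mesh_le1 N).
Qed.

End sphere_measure_finite.

(** * Positivity of the measure of the sphere *)

Section sphere_measure_positive.
Context {R : realType} {m : nat}.
Implicit Types (y : 'rV[R]_m) (x : 'rV[R]_m.+1) (A : set 'rV[R]_m.+1).

(** Forgetting the first coordinate does not increase distances. The radius slightly exceeds the
    diameter so that the box is open, as the compactness argument requires; [eta] pays for this. *)
Lemma projection_box A (eta : R) : (0 < m)%N -> (ediam A <= 1)%E -> 0 < eta ->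
  exists pa : 'rV[R]_m * R, [/\ 0 <= pa.2,
    ((gauge_cst m * pa.2 ^+ m)%:E <= hausdorff_gauge m A + (gauge_cst m * eta)%:E)%E
  & forall x, A x -> forall k, `|x 0 (lift ord0 k) - pa.1 0 k| < pa.2].
Proof.
move=> m0 A1 eta0; have k0 := @gauge_cst_gt0 R m.
have enlarge (s : R) : 0 <= s -> exists a, s < a /\ a ^+ m <= s ^+ m + eta.
  move=> s0; have c : t ^+ m @[t --> s] --> s ^+ m by exact: exprn_continuous.
  have H : \forall t \near s^'+, t ^+ m <= s ^+ m + eta.
    have /cvgrPdist_le/(_ _ eta0) h := cvg_at_right_filter c.
    by apply: filterS h => t; rewrite ler_norml => /andP[h _]; lra.
  have [a [sa ha]] := filter_ex (filterI (nbhs_right_gt s) H).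
  by exists a.
have [[z Az]|A0] := pselect (A !=set0); last first.
  have [a [a0 aE]] := enlarge 0 (lexx 0).
  exists (0, a); split => /=; [exact: ltW| |by move=> x Ax; case: A0; exists x].
  rewrite gauge0// add0e lee_fin ler_pM2l//; apply: le_trans aE _.
  by rewrite expr0n eqn0Ngt m0 add0r.
have d0 := ediam_ge0 (ex_intro _ z Az).
have fin : ediam A \is a fin_num.
  by rewrite ge0_fin_numE//; apply: le_lt_trans A1 _; exact: ltry.
pose s := fine (ediam A); have sE : ediam A = s%:E by rewrite fineK.
have s0 : 0 <= s by rewrite fine_ge0.
have [a [sa aE]] := enlarge s s0.
exists (\row_k z 0 (lift ord0 k), a); split => /=; first by rewrite ltW// (le_lt_trans s0).
  rewrite gaugeE; last by exists z.
  by rewrite sE EFin_expe -!EFinM -EFinD lee_fin -mulrDr ler_pM2l.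
move=> x Ax k; rewrite mxE; apply: le_lt_trans sa.
have := ediam_ge Ax Az; rewrite sE lee_fin; apply: le_trans.
by have := coord_le_enorm (x - z) (lift ord0 k); rewrite !mxE.
Qed.

Lemma cvg_sum_mesh (a : nat -> R) K :
  (\sum_(i < K) (2 * a i + mesh N) ^+ m) @[N --> \oo] --> \sum_(i < K) (2 * a i) ^+ m.
Proof.
elim: K => [|K IH].
  under eq_fun do rewrite big_ord0; rewrite big_ord0; exact: cvg_cst.
under eq_fun do rewrite big_ord_recr /=; rewrite big_ord_recr /=.
apply: (@cvgD _ _ _ _ _ (fun N => \sum_(i < K) (2 * a i + mesh N) ^+ m)); first exact: IH.
apply: (@continuous_cvg _ _ _ _ _ (fun N => 2 * a K + mesh N) (fun t => t ^+ m)).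
  exact: exprn_continuous.
rewrite -[X in _ --> X]addr0; apply: cvgD; [exact: cvg_cst|exact: mesh_cvg0].
Qed.

Lemma rsum_sumr N K (f : nat -> 'rV[R]_m -> R) :
  rsum N (fun y => \sum_(i < K) f i y) = \sum_(i < K) rsum N (f i).
Proof. by rewrite /rsum exchange_big /= mulr_sumr. Qed.

(* A cube covered by finitely many boxes: compare the numbers of lattice points
   and let the mesh tend to zero. *)
Lemma cube_cover_volume (L : R) (p : nat -> 'rV[R]_m) (a : nat -> R) K :
  0 < L -> L <= 1 -> (forall i, 0 <= a i) ->
  (forall y, (forall k, `|y 0 k| <= L) ->
     exists2 i, (i < K)%N & forall k, `|y 0 k - p i 0 k| < a i) ->
  L ^+ m <= \sum_(i < K) (2 * a i) ^+ m.
Proof.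
move=> L0 L1 a0 cov; apply: (@cvgr_to_ge _ (nbhs \oo) _ _ _ _ _ (@cvg_sum_mesh a K)).
have /cvgr0Pnorm_le/(_ _ L0) := @mesh_cvg0 R; apply: filterS => N hN.
have {}hN : mesh N <= L by apply: le_trans hN; exact: ler_norm.
have h1 : L ^+ m <= rsum N (fun y => (in_box 0 L y)%:R).
  by apply: rsum_box_ge => // k; rewrite mxE normr0 add0r.
apply: (le_trans h1).
apply: (@le_trans _ _ (rsum N (fun y => \sum_(i < K) (in_box (p i) (a i) y)%:R))).
  apply: ler_rsum => y _; have [/forallP yL|_] := boolP (in_box 0 L y); last first.
    by apply: sumr_ge0.
  have [|i iK yi] := cov y; first by move=> k; have := yL k; rewrite mxE subr0.
  rewrite (bigD1 (Ordinal iK))//= (_ : in_box (p i) (a i) y).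
    by rewrite lerDl; apply: sumr_ge0.
  by apply/forallP => k; exact: ltW.
rewrite (@rsum_sumr N K (fun i y => (in_box (p i) (a i) y)%:R)).
by apply: ler_sum => i _; exact: rsum_box_le.
Qed.

Lemma sphere_graph y : dotv y y <= 1 -> exists2 x : 'rV[R]_m.+1, enorm x = 1 &
  forall k, x 0 (lift ord0 k) = y 0 k.
Proof.
move=> y1; pose x : 'rV[R]_m.+1 :=
  \row_k (if unlift ord0 k is Some k' then y 0 k' else Num.sqrt (1 - dotv y y)).
exists x; last by move=> k; rewrite mxE liftK.
rewrite /enorm /dotv big_ord_recl /x !mxE unlift_none -expr2 sqr_sqrtr ?subr_ge0//.
rewrite (eq_bigr (fun k => y 0 k * y 0 k)); last by move=> k _; rewrite mxE liftK.
by rewrite -/(dotv y y) subrK sqrtr1.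
Qed.

Lemma half_sum (eta : R) K : 0 <= eta -> \sum_(i < K) eta * 2^-1 ^+ i.+1 <= eta.
Proof.
move=> e0; have -> : \sum_(i < K) eta * 2^-1 ^+ i.+1 = eta * (1 - 2^-1 ^+ K).
  elim: K => [|K IH]; first by rewrite big_ord0 expr0 subrr mulr0.
  by rewrite big_ord_recr /= IH exprS; field.
by rewrite ler_piMr// gerBl exprn_ge0.
Qed.

(** The projection of the sphere contains a cube. The boxes coming from a cover of the sphere cover
    this cube, and compactness leaves finitely many of them. *)
Lemma sphere_measure_positive : (0 < m)%N -> exists2 c : R, 0 < c &
  (c%:E <= hausdorff_measure m (@usphere R m.+1 1))%E.
Proof.
move=> m0; have k0 := @gauge_cst_gt0 R m.
(* [m * L ^+ 2 <= 1] puts the cube inside the unit ball. *)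
pose L : R := m%:R^-1.
have mR : 1 <= m%:R :> R by rewrite ler1n.
have L0 : 0 < L by rewrite invr_gt0 ltr0n.
have L1 : L <= 1 by rewrite invf_le1// ltr0n.
(* Half of the bound given by the cube; the other half absorbs the enlargements [eta * 2^-1 ^+ i.+1]
   of the boxes. *)
pose eta := L ^+ m / 2 ^+ m / 2.
have eta0 : 0 < eta by rewrite !divr_gt0 ?exprn_gt0.
exists (gauge_cst m * eta); first exact: mulr_gt0.
apply: (@le_trans _ _ (hausdorff_content m 1 (@usphere R m.+1 1))); last first.
  by apply: ereal_sup_ubound; exists 1 => //=.
apply: le_ereal_inf_tmp => _ [F [Fcov Fdiam] <-].
have eta_i i : 0 < eta * 2^-1 ^+ i.+1 by rewrite mulr_gt0// exprn_gt0.
have [pa Hpa] := choice (fun i => projection_box m0 (Fdiam i) (eta_i i)).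
pose p i := (pa i).1; pose a i := (pa i).2.
have a0 i : 0 <= a i by have [] := Hpa i.
have cK : compact [set y : 'rV[R]_m | forall k, `[- L, L]%classic (y ord0 k)].
  by apply: (@rV_compact _ _ (fun=> `[- L, L]%classic)) => _; exact: segment_compact.
have /compact_near_coveringP cov := cK.
have loc : forall y : 'rV[R]_m, (forall k, `[- L, L]%classic (y ord0 k)) ->
    \forall y' \near y & K \near \oo, exists2 i, (i < K)%N &
      forall k, `|(y' : 'rV[R]_m) 0 k - p i 0 k| < a i.
  move=> y yL.
  have y1 : dotv y y <= 1.
    apply: (@le_trans _ _ (\sum_(k < m) L ^+ 2)).
      apply: ler_sum => k _; rewrite -expr2 -[leLHS]real_normK ?num_real//.
      rewrite lerXn2r ?nnegrE ?(ltW L0)// ler_norml.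
      by have := yL k; rewrite /= in_itv.
    rewrite sumr_const card_ord -[leLHS]mulr_natl expr2 mulrA divff ?mul1r//.
    by rewrite pnatr_eq0 -lt0n.
  have [x x1 xy] := sphere_graph y1.
  have [i _ Fx] := Fcov x x1.
  have [_ _ /(_ x Fx) xi] := Hpa i.
  have H : \forall y' \near y, forall k, `|(y' : 'rV[R]_m) 0 k - p i 0 k| < a i.
    apply: (@filter_forall _ 'I_m (fun k y' => `|(y' : 'rV[R]_m) 0 k - p i 0 k| < a i)
      (nbhs y) _) => k.
    have c : {for y, continuous (fun y' : 'rV[R]_m => `|y' 0 k - p i 0 k|)}.
      apply: (@continuous_comp _ _ _ (fun y' : 'rV[R]_m => y' 0 k - p i 0 k) Num.norm).
        by apply: (@cvgB _ _ _ (nbhs y) _ (fun y' : 'rV[R]_m => y' 0 k) (cst (p i 0 k)));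
          [exact: coord_continuous|exact: cvg_cst].
      exact: norm_continuous.
    have yi : `|y 0 k - p i 0 k| < a i by rewrite -xy; exact: xi.
    by move/cvgr_lt : c => /(_ _ yi).
  exists ([set y' : 'rV[R]_m | forall k, `|y' 0 k - p i 0 k| < a i], [set K | (i < K)%N]).
    by split => //=; exact: nbhs_infty_gt.
  by move=> [y' K] /= [h1 h2]; exists i.
have [K HK] : exists K, forall y, (forall k, `|y 0 k| <= L) ->
     exists2 i, (i < K)%N & forall k, `|y 0 k - p i 0 k| < a i.
  have h := cov nat \oo (fun K y => exists2 i, (i < K)%N &
      forall k, `|y 0 k - p i 0 k| < a i) eventually_filter loc.
  have [K HK] := filter_ex h; exists K => y yL; apply: HK => k /=.
  by rewrite in_itv /= -ler_norml.
have vol := cube_cover_volume L0 L1 a0 HK.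
have step : (gauge_cst m * (eta + eta) <= \sum_(i < K) gauge_cst m * a i ^+ m).
  rewrite -mulr_sumr ler_pM2l//.
  have -> : eta + eta = L ^+ m / 2 ^+ m by rewrite /eta; field; rewrite expf_neq0.
  rewrite ler_pdivrMr ?exprn_gt0//; apply: le_trans vol _.
  rewrite mulr_suml; apply: ler_sum => i _; by rewrite exprMn mulrC.
have bound : ((\sum_(i < K) gauge_cst m * a i ^+ m)%:E <=
    \sum_(0 <= i < K) hausdorff_gauge m (F i) + (gauge_cst m * eta)%:E)%E.
  rewrite -sumEFin big_mkord.
  apply: (@le_trans _ _ (\sum_(i < K) (hausdorff_gauge m (F i)
     + (gauge_cst m * (eta * 2^-1 ^+ i.+1))%:E))%E).
    by apply: lee_sum => i _; have [] := Hpa i.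
  rewrite big_split /= leeD2l// sumEFin lee_fin -mulr_sumr ler_pM2l//.
  exact: half_sum (ltW eta0).
have total : (\sum_(0 <= i < K) hausdorff_gauge m (F i) <=
    \sum_(i <oo) hausdorff_gauge m (F i))%E.
  by apply: nneseries_lim_ge => i _ _; exact: gauge_ge0.
apply: le_trans total.
rewrite -(leeD2rE (x := (gauge_cst m * eta)%:E))//; apply: le_trans bound.
by rewrite -EFinD lee_fin -mulrDr.
Qed.

End sphere_measure_positive.

(** * Conclusion *)

Section volume_comparison.
Context {R : realType}.

Lemma expr1D_le (a : R) m : 0 <= a -> a <= 1 -> (1 + a) ^+ m <= 1 + m%:R * 2 ^+ m * a.
Proof.
move=> a0 a1; elim: m => [|m IH]; first by rewrite expr0 !mul0r addr0.
rewrite exprS; apply: (@le_trans _ _ ((1 + a) * (1 + m%:R * 2 ^+ m * a))).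
  by rewrite ler_wpM2l// addr_ge0.
have h : 0 <= m%:R * 2 ^+ m * a by rewrite !mulr_ge0// exprn_ge0.
have h2 : a * (m%:R * 2 ^+ m * a) <= m%:R * 2 ^+ m * a by rewrite ler_piMl.
have h3 : a <= 2 ^+ m.+1 * a by rewrite ler_peMl// exprn_ege1// ler1n.
have -> : m.+1%:R * 2 ^+ m.+1 * a = 2 * (m%:R * 2 ^+ m * a) + 2 ^+ m.+1 * a.
  by rewrite -natr1 exprS; ring.
move: h h2 h3; move: (m%:R * 2 ^+ m * a) (2 ^+ m.+1 * a) => x y h h2 h3.
by rewrite mulrDl mul1r mulrDr mulr1; lra.
Qed.

(** A gain linear in [E] with positive slope is enough, since the loss to be beaten is of higher
    order. *)
Lemma powR_root_ge (m : nat) (E : R) : (0 < m)%N -> 0 <= E -> E <= 1 ->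
  1 + (m%:R * 2 ^+ m)^-1 * E <= (1 + E) `^ m%:R^-1.
Proof.
move=> m0 E0 E1; have m1 : 1 <= m%:R * 2 ^+ m :> R.
  by rewrite -[leLHS]mulr1 ler_pM// ?ler1n// exprn_ege1// ler1n.
have mp : 0 < m%:R * 2 ^+ m :> R by exact: lt_le_trans m1.
set b := _^-1; have b0 : 0 < b by rewrite invr_gt0.
have b1 : b <= 1 by rewrite invf_le1.
have bE : 0 <= b * E by rewrite mulr_ge0// ltW.
have bE1 : b * E <= 1 by rewrite mulr_ile1// ltW.
have h : (1 + b * E) ^+ m <= 1 + E.
  by apply: le_trans (expr1D_le m bE bE1) _; rewrite mulrA divff ?mul1r// gt_eqF.
have p0 : 0 <= 1 + b * E by rewrite addr_ge0.
have -> : 1 + b * E = ((1 + b * E) ^+ m) `^ m%:R^-1.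
  by rewrite -powR_mulrn// -powRrM divff ?powRr1// pnatr_eq0 -lt0n.
apply: ge0_ler_powR => //; rewrite ?nnegrE ?exprn_ge0 ?addr_ge0//.
Qed.

End volume_comparison.

Theorem proposition3p1 (R : realType) (n : nat) (hn : (3 <= n)%N) :
  [/\ (forall k : nat, (1 <= k)%N ->
        exists C : R, \forall eps \near (0 : R)^'+,
          `|steklov k (@shell R n eps)
             - (k%:R - (k%:R * (2 * k + n - 2)%:R) / (k + n - 2)%:R
                         * eps ^+ (2 * k + n - 2))|
          <= C * eps ^+ (2 * k + n - 1)),
      (exists C : R, \forall eps \near (0 : R)^'+,
          `|steklov 1 (@shell R n eps)
             - (1 - n%:R / (n - 1)%:R * eps ^+ n)|
          <= C * eps ^+ (n + 1))
    & (forall k : nat, (1 <= k)%N ->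
        \forall eps \near (0 : R)^'+,
          ((steklov k (@eball R n 1))%:E
             * (boundary_volume (@eball R n 1)) `^ ((n - 1)%:R^-1)
           < (steklov k (@shell R n eps))%:E
             * (boundary_volume (@shell R n eps)) `^ ((n - 1)%:R^-1))%E)].
Proof.
have asymp k : (1 <= k)%N -> exists C : R, \forall eps \near (0 : R)^'+,
    `|steklov k (@shell R n eps)
       - (k%:R - (k%:R * (2 * k + n - 2)%:R) / (k + n - 2)%:R
                   * eps ^+ (2 * k + n - 2))|
    <= C * eps ^+ (2 * k + n - 1).
  move=> k1; have [C HC] := @steklov_shell R n k hn k1; exists C.
  apply: filterS HC => e [_].
  have -> : (2 * k + n - 2 = n + 2 * k - 2)%N by rewrite addnC.
  have -> : (2 * k + n - 1 = (n + 2 * k - 2).+1)%N by lia.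
  have -> : (k + n - 2)%:R = (n + k)%:R - 2 :> R by rewrite natrB 1?addnC//; lia.
  by rewrite degreeM// exprS.
split=> //.
  have [C HC] := asymp 1%N isT; exists C; apply: filterS HC => e.
  have -> : (2 * 1 + n - 2 = n)%N by lia.
  have -> : (2 * 1 + n - 1 = n + 1)%N by lia.
  have -> : (1 + n - 2 = n - 1)%N by lia.
  by rewrite mul1r.
move=> k k1; rewrite steklov_ball//.
have [C HC] := @steklov_shell R n k hn k1.
have m0 : (0 < n.-1)%N by move: hn; clear; lia.
(* The loss in the eigenvalue carries at least one more factor [e] than the gain [e ^+ n.-1] in the
   measure. *)
have nk : (n.-1.+1 <= n + 2 * k - 2)%N by move: hn k1; clear; lia.
(* With a measure of the unit sphere equal to 0 or infinity the inequality could not be strict; as a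
   positive real it can be divided out. *)
have [h h0 hE] : exists2 h : R, 0 < h & hausdorff_measure n.-1 (@usphere R n 1) = h%:E.
  case: n hn m0 {asymp HC nk} => // m _ m0.
  have [B HB] := @sphere_measure_finite R m.
  have [c c0 Hc] := @sphere_measure_positive R m m0.
  have fin : hausdorff_measure m (@usphere R m.+1 1) \is a fin_num.
    rewrite fin_numE; apply/andP; split.
      by rewrite gt_eqF// (lt_le_trans _ Hc)// ltNyr.
    by rewrite lt_eqF// (le_lt_trans HB)// ltry.
  exists (fine (hausdorff_measure m (@usphere R m.+1 1))); last by rewrite fineK.
  by rewrite -lte_fin fineK//; apply: lt_le_trans Hc.
pose b : R := (n.-1%:R * 2 ^+ n.-1)^-1.
pose c : R := k%:R * ((n + k)%:R - 2 + k%:R) / ((n + k)%:R - 2).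
have k0 : 0 < k%:R :> R by rewrite ltr0n.
have b0 : 0 < b by rewrite invr_gt0 mulr_gt0 ?ltr0n// exprn_gt0.
(* The eigenvalue loses at most [D * (e * E)] while the volume factor gains [k%:R * b * E]; the
   threshold ensures [2 * D * e < k%:R * b], the 2 bounding [1 + b * E]. *)
pose D := `|c| + `|C|.
have D0 : 0 <= D by rewrite addr_ge0.
have thr : 0 < k%:R * b / (2 * D + 1).
  by rewrite divr_gt0 ?mulr_gt0// ltr_wpDl// mulr_ge0.
near=> e.
have e0 : 0 < e by near: e; exact: nbhs_right_gt.
have e1 : e < 1 by near: e; exact: nbhs_right_lt.
have et : e < k%:R * b / (2 * D + 1) by near: e; exact: nbhs_right_lt.
have [slow sC] : k%:R - 2^-1 < steklov k (@shell R n e) /\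
   `|steklov k (@shell R n e) - (k%:R - c * e ^+ (n + 2 * k - 2))|
   <= C * (e * e ^+ (n + 2 * k - 2)) by near: e.
have e01 : 0 < e < 1 by rewrite e0.
move: slow sC; set s := steklov k (shell e) => slow sC.
have s0 : 0 < s.
  have : 1 <= k%:R :> R by rewrite ler1n.
  by move: slow; clear; lra.
pose E := e ^+ n.-1.
have E0 : 0 < E by rewrite exprn_gt0.
have E1 : E <= 1 by rewrite exprn_ile1// ltW.
have ME : e ^+ (n + 2 * k - 2) <= e * E.
  rewrite /E -exprS; apply: ler_wiXn2l => //; exact: ltW.
have M0 : 0 < e ^+ (n + 2 * k - 2) by rewrite exprn_gt0.
have sD : k%:R - D * (e * E) <= s.
  have h1 : c * e ^+ (n + 2 * k - 2) <= `|c| * (e * E).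
    apply: le_trans (ler_wpM2l (normr_ge0 c) ME); rewrite ler_wpM2r ?(ltW M0)//.
    exact: ler_norm.
  have h2 : C * (e * e ^+ (n + 2 * k - 2)) <= `|C| * (e * E).
    apply: (@le_trans _ _ (`|C| * (e * e ^+ (n + 2 * k - 2)))).
      by rewrite ler_wpM2r ?ler_norm// mulr_ge0// ltW.
    rewrite ler_wpM2l//; apply: le_trans ME; rewrite ler_piMl// ltW//.
  move: sC h1 h2; rewrite ler_norml /D mulrDl => /andP[+ _].
  move: (c * _) (C * _) (`|c| * _) (`|C| * _) => x y z w; clear; lra.
have main : k%:R < s * (1 + b * E).
  have bE : 0 <= b * E by rewrite mulr_ge0// ltW.
  have bE1 : b * E <= 1.
    rewrite mulr_ile1// ?(ltW b0) ?(ltW E0)// invf_le1 ?mulr_gt0 ?ltr0n ?exprn_gt0//.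
    by rewrite -[leLHS]mulr1 ler_pM// ?ler1n// exprn_ege1// ler1n.
  apply: (@lt_le_trans _ _ ((k%:R - D * (e * E)) * (1 + b * E))); last first.
    by rewrite ler_wpM2r// addr_ge0.
  rewrite -subr_gt0.
  have -> : (k%:R - D * (e * E)) * (1 + b * E) - k%:R =
    E * (k%:R * b - D * e * (1 + b * E)) by ring.
  rewrite mulr_gt0// subr_gt0.
  apply: (@le_lt_trans _ _ (D * e * 2)).
    rewrite ler_wpM2l ?mulr_ge0 ?(ltW e0)//; move: bE1; clear; lra.
  rewrite ltr_pdivlMr in et; last by rewrite ltr_wpDl// mulr_ge0.
  by move: et e0; clear; lra.
rewrite /boundary_volume boundary_eball boundary_shell// subn1.
have two := @hausdorff_two_spheres R n n.-1 e e01.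
rewrite -/(usphere 1) hE -EFinM in two *.
set V := hausdorff_measure _ _ in two *.
apply: (@lt_le_trans _ _ (s%:E * ((1 + E) * h)%:E `^ (n.-1%:R^-1))%E); last first.
  rewrite lee_wpmul2l ?lee_fin ?(ltW s0)//; apply: gt0_ler_poweR => //.
  - by rewrite in_itv /= lee_fin leey andbT mulr_ge0 ?addr_ge0 ?ltW.
  - rewrite in_itv /= leey andbT; apply: le_trans two.
    by rewrite lee_fin mulr_ge0 ?addr_ge0 ?ltW.
rewrite !poweR_EFin -!EFinM lte_fin powRM ?addr_ge0 ?(ltW E0) ?(ltW h0)//.
rewrite mulrA ltr_pM2r ?powR_gt0//; apply: lt_le_trans main _.
by rewrite ler_wpM2l ?(ltW s0)// powR_root_ge// ltW.
Unshelve. all: by end_near. Qed.
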